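(* Fix $\epsilon>0$ and let $H_N$ be an $N\times N$ real symmetric random matrix (rescaled Erdős–Rényi matrix) with parameter $p_N$ satisfying $1-\epsilon\ge p_N\ge\frac{N^\epsilon}{N}$: its entries are independent up to symmetry, and $$(H_N)_{ij}=\frac{1}{\sqrt{Np_N(1-p_N)}}\begin{cases}1&\text{with probability }p_N,\\0&\text{with probability }1-p_N.\end{cases}$$ Then for any $E\in\mathbb{R}$ with $|E|\ne2$, $$\lim_{N\to\infty}\frac1N\log\mathbb{E}[|\det(H_N-E)|]=\int_{\mathbb{R}}\log|\lambda-E|\,\rho_{\mathrm{sc}}(\lambda)\,d\lambda.$$
   Context: $H_N-E$ means $H_N-E\,\mathrm{Id}$. $\rho_{\mathrm{sc}}(x)=\frac{\sqrt{4-x^2}}{2\pi}\mathbf{1}_{x\in[-2,2]}$ is the semicircle density. *)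

(* Defs.v *)
From HB Require Import structures.
From mathcomp Require Import all_boot all_order all_algebra.
From mathcomp Require Import all_classical all_reals all_analysis.
Set Implicit Arguments.
Unset Strict Implicit.
Unset Printing Implicit Defensive.
Import Order.TTheory GRing.Theory Num.Theory.
Import numFieldNormedType.Exports.
Local Open Scope classical_set_scope.
Local Open Scope ring_scope.

Definition mutually_independent (d : measure_display) (T : measurableType d)
    (R : realType) (P : probability T R) (I : finType) (X : I -> T -> R) :=
  forall (J : {set I}) (B : I -> set R), (forall i, measurable (B i)) ->
    P (\bigcap_(i in [set` J]) X i @^-1` B i) =
    (\prod_(i in J) P (X i @^-1` B i))%E.

Definition upper_index (N : nat) : finType :=
  {ij : 'I_N * 'I_N | (ij.1 <= ij.2)%N}.

Definition rescaled_erdos_renyi (d : measure_display) (T : measurableType d)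
    (R : realType) (P : probability T R) (N : nat) (p : R)
    (H : T -> 'M[R]_N) : Prop :=
  [/\ forall i j, measurable_fun setT (fun w => H w i j),
      forall w, (H w)^T = H w,
      mutually_independent P
        (fun (k : upper_index N) w => H w (val k).1 (val k).2)
    & forall i j,
        P [set w | H w i j = 1 / Num.sqrt (N%:R * p * (1 - p))] = p%:E /\
        P [set w | H w i j = 0] = (1 - p)%:E].

Definition rho_sc (R : realType) (x : R) : R :=
  Num.sqrt (4 - x ^+ 2) / (2 * pi) * \1_(`[-2, 2]) x.

(* Main.v *)
(** Normalise [sqrt N *: H = W + m J]: [W] is symmetric with independent centred
    entries of variance 1, [J] is the all-ones matrix, [m = sqrt (p / (1 - p))];
    put [z = E sqrt N].

    Upper bound: by Cauchy-Schwarz it suffices to bound the second moment of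
    [det (W - z + m J)], which is at most twice that of [det (W - z)] plus
    [m^2 N^2] times the mean of the squared entries of the adjugate.  Expanding
    along one vertex gives closed recurrences in [N] for the second moments of
    [det (W - z)], of its adjugate and of the trace of the adjugate.  For
    [phi n = E (det (W_n - z))^2 / n!] they yield a differential inequality for
    the partial sums of [sum phi n x^n], whence by Gronwall
    [sum phi n x^n <= exp (z^2 x / (1 + x) + kap x^2 / 2) (1 - x)^-3].
    Take [x = 1 - 1/N] if [|E| < 2], and [x = r^2] if [|E| = r + 1/r].

    Lower bound: [E |det| >= |E det|], but [E det] is a combination of two
    consecutive Hermite polynomials and may vanish.  The means in sizes [N] and
    [N-1] cannot both be small, by Turan's identity
    [He_(n+1)^2 - He_(n+2) He_n = n! sum_(j <= n) He_j^2 / j!], and [E |det|] in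
    size [N] dominates a multiple of [E |det|] in size [N-1].  In the sum it is
    enough to keep one index [k], close to [min (1, E^2/4) N], for which the
    Hermite polynomials still do not oscillate.

    Both rates equal the logarithmic potential of the semicircle law, which is
    computed in the coordinate [x = 2 cos t] by differentiating the integral of
    [ln |1 - r e^(iu)|^2] with respect to [r]. *)
Require Import Defs.
From HB Require Import structures.
From mathcomp Require Import all_boot all_order all_fingroup all_algebra.
From mathcomp Require Import ring lra zify.
From mathcomp Require Import all_classical all_reals all_analysis.
From mathcomp Require Import measurable_realfun.
Set Implicit Arguments.
Unset Strict Implicit.
Unset Printing Implicit Defensive.
Import Order.TTheory GRing.Theory Num.Theory.
Import numFieldNormedType.Exports.
Local Open Scope classical_set_scope.
Local Open Scope ring_scope.

(** * Determinants and adjugates *)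

(** The condition [p >= N^eps / N] acts twice. The fourth moment [kap] of an entry is at most of
    order [N^(1 - eps)], so the term [kap x^2 / 2] in the exponent is negligible against [N]. And
    [m^2 N >= N^eps] eventually exceeds [E^2], which keeps nonsingular the linear system that
    expresses two consecutive Hermite polynomials through the mean determinants in sizes [N] and
    [N - 1]. All other losses are polynomial in [N].

    The values of [x] come from the upper exponent [-1 - ln x + E^2 x / (1 + x)]. Its derivative
    vanishes when [(1 + x)^2 = E^2 x], that is, at [x = r^2] with [|E| = r + 1/r]. For [|E| < 2]
    there is no critical point: the exponent decreases on [(0, 1)] and [x] must approach 1, where
    the factor [(1 - x)^-3] costs only a power of [N].

    The index [k] comes from the turning point [z^2 / 4] of the Hermite recurrence: up to there
    [X^2 - z X + k] has real roots and the ratios [He_(k+1) / He_k] stay above the larger one. *)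

Lemma det_block_cauchy_neq0 (R : idomainType) n (a : R) (u : 'rV[R]_n)
    (v : 'cV[R]_n) (B : 'M[R]_n) : \det B != 0 ->
  \det (block_mx a%:M u v B) = a * \det B - (u *m \adj B *m v) 0 0.
Proof.
move=> B0.
(* Column elimination with the adjugate in place of the inverse. Comparing determinants leaves a
   common factor [\det B], which is cancelled at the end. *)
have E : block_mx a%:M u v B *m block_mx (\det B)%:M 0 (- (\adj B *m v)) 1%:M
    = block_mx (a * \det B - (u *m \adj B *m v) 0 0)%:M u 0 B.
  rewrite mulmx_block !mulmx0 !mulmx1 !add0r !mulmxN -scalar_mxM.
  congr block_mx.
    by rewrite raddfB /= mulmxA -mx11_scalar.
  by rewrite mulmxA mul_mx_adj mul_mx_scalar mul_scalar_mx subrr.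
have := congr1 (fun M => \det M) E.
rewrite det_mulmx det_lblock det_ublock !det_scalar1 det1 mulr1.
exact: mulIf.
Qed.

(* Apply the previous lemma to ['X%:M + B] and evaluate at [0] to drop the
   hypothesis [\det B != 0]. *)
Lemma det_block_cauchy (F : fieldType) n (a : F) (u : 'rV[F]_n)
    (v : 'cV[F]_n) (B : 'M[F]_n) :
  \det (block_mx a%:M u v B) = a * \det B - (u *m \adj B *m v) 0 0.
Proof.
pose B' := map_mx polyC B + 'X%:M.
have B'0 : \det B' != 0.
  have -> : B' = char_poly_mx (- B).
    by rewrite /char_poly_mx /B' addrC map_mxN opprK.
  exact/monic_neq0/char_poly_monic.
have ev0 (A : 'rV[F]_n) : map_mx (horner_eval 0) (map_mx polyC A) = A.
  by apply/matrixP => i j; rewrite !mxE /horner_eval hornerC.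
have ev0' (A : 'cV[F]_n) : map_mx (horner_eval 0) (map_mx polyC A) = A.
  by apply/matrixP => i j; rewrite !mxE /horner_eval hornerC.
have evB : map_mx (horner_eval 0) B' = B.
  apply/matrixP => i j; rewrite !mxE /horner_eval hornerD hornerC hornerMn hornerX.
  by rewrite mul0rn addr0.
have := congr1 (horner_eval 0)
  (det_block_cauchy_neq0 a%:P (map_mx polyC u) (map_mx polyC v) B'0).
rewrite -det_map_mx map_block_mx ev0 ev0' evB map_scalar_mx /= [horner_eval 0 a%:P]hornerC => ->.
rewrite rmorphB rmorphM /= -det_map_mx evB [horner_eval 0 a%:P]hornerC; congr (_ - _).
have -> (M : 'M[{poly F}]_1) : horner_eval 0 (M 0 0) = (map_mx (horner_eval 0) M) 0 0.
  by rewrite mxE.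
by rewrite !map_mxM map_mx_adj ev0 ev0' evB.
Qed.

(** The perturbation has rank one: bordering by a row of [- m] and a column of ones turns it into a
    bordered determinant over [M], which row operations make block triangular. *)
Lemma det_addJ (F : fieldType) n (M : 'M[F]_n) (m : F) :
  \det (M + const_mx m) = \det M + m * \sum_i \sum_j \adj M i j.
Proof.
have E : block_mx 1%:M 0 (const_mx 1) 1%:M *m
         block_mx 1%:M (const_mx (- m)) 0 (M + const_mx m)
       = block_mx 1%:M (const_mx (- m)) (const_mx 1 : 'cV_n) M.
  rewrite mulmx_block !mul1mx !mulmx1 !mulmx0 !mul0mx !addr0.
  congr block_mx; apply/matrixP => i j.
  by rewrite !mxE big_ord1 !mxE; ring.
have := congr1 (fun M => \det M) E.
rewrite det_mulmx det_lblock det_ublock !det1 !mul1r det_block_cauchy mul1r => ->.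
congr (_ + _); rewrite !mxE -sumrN exchange_big mulr_sumr.
apply: eq_bigr => j _; rewrite !mxE mulr1 mulr_sumr -sumrN.
by apply: eq_bigr => i _; rewrite !mxE; ring.
Qed.

Lemma adj_diag (F : comNzRingType) n (M : 'M[F]_n.+1) i :
  \adj M i i = \det (mxsub (lift i) (lift i) M).
Proof.
rewrite mxE /cofactor addnn -signr_odd odd_double expr0 mul1r.
by congr (\det _); apply/matrixP => a b; rewrite !mxE.
Qed.

Lemma minorE (R : Type) n (A : 'M[R]_n.+1) i j k l :
  row' i (col' j A) k l = A (lift i k) (lift j l).
Proof. by rewrite !mxE. Qed.

Lemma adj_block00 (F : fieldType) n a (u : 'rV[F]_n) v (B : 'M[F]_n) :
  \adj (block_mx a%:M u v B : 'M[_]_(1 + n)) (lshift n 0) (lshift n 0) = \det B.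
Proof.
have := det_block_cauchy 1 u 0 B; rewrite mulmx0 mxE subr0 mul1r => <-.
rewrite (expand_det_col _ (lshift n 0)) big_split_ord /= big_ord1.
rewrite big1 ?addr0 => [|i _].
  rewrite block_mxEul !mxE mul1r /cofactor; congr (_ * \det _).
  apply/matrixP => i j; rewrite !minorE.
  have -> : lift (lshift n (0 : 'I_1)) j = rshift 1 j by apply: val_inj.
  have -> : lift (lshift n (0 : 'I_1)) i = rshift 1 i by apply: val_inj.
  exact: etrans (block_mxEdr a%:M u v B i j) (esym (block_mxEdr _ u 0 B i j)).
by rewrite block_mxEdl mxE mul0r.
Qed.

(** An entry of the first row of the adjugate is the determinant after replacing the first column by
    a unit vector, and this is again a bordered determinant. *)
Lemma adj_block0r (F : fieldType) n a (u : 'rV[F]_n) v (B : 'M[F]_n) k :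
  \adj (block_mx a%:M u v B : 'M[_]_(1 + n)) (lshift n 0) (rshift 1 k)
  = - (u *m \adj B) 0 k.
Proof.
have := det_block_cauchy 0 u (delta_mx k 0) B.
rewrite mul0r sub0r => /esym; rewrite -colE mxE => ->.
rewrite (expand_det_col _ (lshift n 0)) big_split_ord /= big_ord1.
rewrite block_mxEul !mxE mul0r add0r (bigD1 k) //= big1 ?addr0 => [|i ik].
  rewrite block_mxEdl mxE !eqxx mul1r /cofactor; congr (_ * \det _).
  apply/matrixP => i j; rewrite !minorE.
  have -> : lift (lshift n (0 : 'I_1)) j = rshift 1 j by apply: val_inj.
  set l := lift _ i; case: (split_ordP l) => k' ->.
    exact: etrans (block_mxEur a%:M u v B k' j)
      (esym (block_mxEur _ u _ B k' j)).
  exact: etrans (block_mxEdr a%:M u v B k' j)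
    (esym (block_mxEdr _ u _ B k' j)).
by rewrite block_mxEdl mxE (negPf ik) mul0r.
Qed.

Lemma mxsub_block_lift (F : fieldType) n (a : F) (u : 'rV[F]_n.+1) v B k :
  mxsub (lift (rshift 1 k)) (lift (rshift 1 k))
    (block_mx a%:M u v B : 'M[_]_(1 + n.+1)) =
  block_mx a%:M (colsub (lift k) u) (rowsub (lift k) v)
    (mxsub (lift k) (lift k) B) :> 'M[_]_(1 + n).
Proof.
have l0 : lift (rshift 1 k) (lshift n (0 : 'I_1)) = lshift n.+1 0
  by apply: val_inj.
have lr j : lift (rshift 1 k) (rshift 1 j) = rshift 1 (lift k j).
  by apply: val_inj; rewrite /= /bump /= !add1n ltnS addnS.
apply/matrixP => i j; rewrite mxE.
case: (split_ordP i) => {}i ->; case: (split_ordP j) => {}j ->.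
- by rewrite (ord1 i) (ord1 j) !l0 !block_mxEul.
- by rewrite (ord1 i) l0 lr !block_mxEur !mxE.
- by rewrite (ord1 j) l0 lr !block_mxEdl !mxE.
- by rewrite !lr !block_mxEdr !mxE.
Qed.

Lemma det_mxsub_inj (F : fieldType) n (s : 'I_n -> 'I_n) (M : 'M[F]_n) :
  injective s -> \det (mxsub s s M) = \det M.
Proof.
move=> sI; have -> : mxsub s s M = row_perm (perm sI) (col_perm (perm sI) M).
  by apply/matrixP => i j; rewrite !mxE !permE.
rewrite row_permE col_permE !det_mulmx !det_perm odd_permV mulrCA.
by rewrite -signr_addb addbb expr0 mulr1.
Qed.

(** Each entry of the adjugate is a determinant with one column replaced by a unit vector, so
    invariance under relabelling is inherited from the determinant. *)
Lemma adj_mxsub_inj (F : fieldType) n (s : 'I_n -> 'I_n) (M : 'M[F]_n) i j :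
  injective s -> \adj (mxsub s s M) i j = \adj M (s i) (s j).
Proof.
have adjE (A : 'M[F]_n) a b : \adj A a b =
    \det (\matrix_(k, l) (if l == a then (k == b)%:R else A k l)).
  rewrite (expand_det_col _ a) (bigD1 b) //= big1 ?addr0 => [|k kb].
    rewrite !mxE !eqxx mul1r /cofactor; congr (_ * \det _).
    by apply/matrixP => k l; rewrite !mxE eq_sym (negPf (neq_lift _ _)).
  by rewrite mxE eqxx (negPf kb) mul0r.
move=> sI; rewrite !adjE -[RHS](det_mxsub_inj _ sI); congr (\det _).
by apply/matrixP => k l; rewrite !mxE !(inj_eq sI).
Qed.

(** * Finite product expectations *)

Section FiniteExpectation.
Variables (R : realFieldType) (S : finType) (pr : S -> R).

(** Expectation over independent [S]-valued coordinates. Being a finite sum, it raises no question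
    of measurability or integrability. *)
Definition Ef (I : finType) (F : {ffun I -> S} -> R) : R :=
  \sum_(w : {ffun I -> S}) (\prod_i pr (w i)) * F w.

Lemma eq_Ef (I : finType) (F G : {ffun I -> S} -> R) : F =1 G -> Ef F = Ef G.
Proof. by move=> FG; apply: eq_bigr => w _; rewrite FG. Qed.

Lemma EfD (I : finType) (F G : {ffun I -> S} -> R) :
  Ef (fun w => F w + G w) = Ef F + Ef G.
Proof. by rewrite /Ef -big_split; apply: eq_bigr => w _; rewrite mulrDr. Qed.

Lemma EfZ (I : finType) c (F : {ffun I -> S} -> R) :
  Ef (fun w => c * F w) = c * Ef F.
Proof. by rewrite /Ef mulr_sumr; apply: eq_bigr => w _; rewrite mulrCA. Qed.

Lemma EfZr (I : finType) c (F : {ffun I -> S} -> R) :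
  Ef (fun w => F w * c) = Ef F * c.
Proof. by rewrite mulrC -EfZ; apply: eq_Ef => w; rewrite mulrC. Qed.

Lemma EfN (I : finType) (F : {ffun I -> S} -> R) :
  Ef (fun w => - F w) = - Ef F.
Proof. by rewrite -mulN1r -EfZ; apply: eq_Ef => w; rewrite mulN1r. Qed.

Lemma Ef_sum (I J : finType) (F : J -> {ffun I -> S} -> R) :
  Ef (fun w => \sum_j F j w) = \sum_j Ef (F j).
Proof.
by rewrite /Ef exchange_big; apply: eq_bigr => w _; rewrite mulr_sumr.
Qed.

Lemma exchange_Ef (I J : finType) (F : {ffun I -> S} -> {ffun J -> S} -> R) :
  Ef (fun a => Ef (F a)) = Ef (fun b => Ef (F^~ b)).
Proof.
rewrite /Ef; under eq_bigr => a _ do rewrite mulr_sumr.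
rewrite exchange_big; apply: eq_bigr => b _; rewrite mulr_sumr.
by apply: eq_bigr => a _; ring.
Qed.

Hypothesis pr1 : \sum_s pr s = 1.

Lemma Ef_cst (I : finType) c : Ef (fun _ : {ffun I -> S} => c) = c.
Proof.
rewrite /Ef -mulr_suml -(bigA_distr_bigA (fun _ s => pr s)) big1 ?mul1r //.
Qed.

Lemma Ef_inj (I J : finType) (g : J -> I) (F : {ffun J -> S} -> R) :
  injective g -> Ef (fun w => F [ffun j => w (g j)]) = Ef F.
Proof.
move=> gI; rewrite /Ef.
rewrite (partition_big (fun w : {ffun I -> S} => [ffun j => w (g j)]) xpredT) //=.
apply: eq_bigr => a _.
under eq_bigr => w /eqP -> do [].
rewrite -mulr_suml; congr (_ * _).
(* The fibre over [a] is a product set: [Q i] allows only [a j] at [i = g j] and every value off the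
   image of [g]. The sum over the fibre therefore factors. *)
pose Q i s := [forall j, (g j == i) ==> (s == a j)].
have -> : \sum_(w : {ffun I -> S} | [ffun j => w (g j)] == a) \prod_i pr (w i)
    = \sum_(w in family Q) \prod_i pr (w i).
  apply: eq_bigl => w; apply/eqP/familyP => [wa i|wQ].
    by apply/forallP => j; apply/implyP => /eqP <-; rewrite -wa ffunE.
  apply/ffunP => j; rewrite ffunE; apply/eqP.
  by have /forallP/(_ j) := wQ (g j); rewrite eqxx.
rewrite -(bigA_distr_big_dep _ (fun _ s => pr s)).
rewrite (bigID (mem [set g j | j in J])%SET) /= mulrC big1 ?mul1r => [|i ig].
  rewrite big_imset /=; last by move=> ? ? _ _; exact: gI.
  apply: eq_bigr => j _; rewrite (big_pred1 (a j)) // => s.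
  apply/forallP/eqP => [/(_ j)|-> j']; first by rewrite eqxx => /eqP.
  by apply/implyP => /eqP/gI ->.
rewrite (eq_bigl predT) ?pr1 // => s; apply/forallP => j.
by apply/implyP => /eqP gj; case/negP: ig; rewrite -gj imset_f.
Qed.

(** Fubini for two disjoint groups of coordinates, by marginalising onto [J1 + J2]. *)
Lemma Ef_split (I J1 J2 : finType) (g1 : J1 -> I) (g2 : J2 -> I)
    (F : {ffun J1 -> S} -> {ffun J2 -> S} -> R) :
  injective g1 -> injective g2 -> (forall a b, g1 a != g2 b) ->
  Ef (fun w => F [ffun j => w (g1 j)] [ffun j => w (g2 j)]) =
  Ef (fun a => Ef (F a)).
Proof.
move=> g1I g2I g12.
pose g (j : J1 + J2) := match j with inl a => g1 a | inr b => g2 b end.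
have gI : injective g.
  by move=> [a|b] [a'|b'] //= => [/g1I->|/eqP|/esym/eqP|/g2I->] //;
     rewrite (negPf (g12 _ _)).
pose G (w : {ffun J1 + J2 -> S}) := F [ffun a => w (inl a)] [ffun b => w (inr b)].
transitivity (Ef G).
  rewrite -(Ef_inj _ gI); apply: eq_Ef => w.
  by congr F; apply/ffunP => j; rewrite !ffunE.
rewrite /Ef; under [RHS]eq_bigr => a _ do rewrite mulr_sumr.
rewrite pair_big /=.
pose h (p : {ffun J1 -> S} * {ffun J2 -> S}) : {ffun J1 + J2 -> S} :=
  [ffun j => match j with inl a => p.1 a | inr b => p.2 b end].
have hI : bijective h.
  exists (fun w : {ffun J1 + J2 -> S} =>
    ([ffun a => w (inl a)], [ffun b => w (inr b)])).
    by case=> a b; congr pair; apply/ffunP => j; rewrite !ffunE.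
  by move=> w; apply/ffunP => -[j|j]; rewrite !ffunE.
rewrite (reindex h) /=; last exact: onW_bij.
apply: eq_bigr => -[a b] _ /=; rewrite big_sumType /= mulrA.
congr (_ * _ * _).
- by apply: eq_bigr => j _; rewrite ffunE.
- by apply: eq_bigr => j _; rewrite ffunE.
- by congr F; apply/ffunP => j; rewrite !ffunE.
Qed.

Hypothesis pr_ge0 : forall s, 0 <= pr s.

Lemma Ef_le (I : finType) (F G : {ffun I -> S} -> R) :
  (forall w, F w <= G w) -> Ef F <= Ef G.
Proof.
by move=> FG; apply: ler_sum => w _; rewrite ler_wpM2l ?prodr_ge0.
Qed.

Lemma Ef_ge0 (I : finType) (F : {ffun I -> S} -> R) :
  (forall w, 0 <= F w) -> 0 <= Ef F.
Proof. by move=> F0; apply: sumr_ge0 => w _; rewrite mulr_ge0 ?prodr_ge0. Qed.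

Lemma Ef_norm (I : finType) (F : {ffun I -> S} -> R) :
  `|Ef F| <= Ef (fun w => `|F w|).
Proof.
apply: le_trans (ler_norm_sum _ _ _) _; apply: ler_sum => w _.
by rewrite normrM ger0_norm ?prodr_ge0.
Qed.

Lemma Ef_sqr (I : finType) (F : {ffun I -> S} -> R) :
  Ef F ^+ 2 <= Ef (fun w => F w ^+ 2).
Proof.
have : 0 <= Ef (fun w => (F w - Ef F) ^+ 2) by apply: Ef_ge0 => w; exact: sqr_ge0.
set c := Ef F; rewrite (eq_Ef (G := fun w => F w ^+ 2 + ((- c *+ 2) * F w + c ^+ 2))).
  by rewrite !EfD EfZ Ef_cst -/c; nra.
by move=> w; ring.
Qed.

End FiniteExpectation.

(** * Moment recurrences for random symmetric matrices *)

Section RandomSymmetric.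
Variables (R : realFieldType) (S : finType) (pr : S -> R) (x : S -> R).

(** [X] builds the random object from the sample, so that [F] is a function of the scalar, vector or
    matrix itself. *)
Definition Ex (I : finType) (V : Type) (X : {ffun I -> S} -> V) (F : V -> R) : R :=
  Ef pr (fun w => F (X w)).

Section Linearity.
Variables (I : finType) (V : Type) (X : {ffun I -> S} -> V).
Implicit Types F G : V -> R.

Lemma eq_Ex F G : F =1 G -> Ex X F = Ex X G.
Proof. by move=> FG; apply: eq_Ef => w; exact: FG. Qed.
Lemma ExD F G : Ex X (fun v => F v + G v) = Ex X F + Ex X G.
Proof. exact: EfD. Qed.
Lemma ExZ c F : Ex X (fun v => c * F v) = c * Ex X F.
Proof. exact: EfZ. Qed.
Lemma ExZr c F : Ex X (fun v => F v * c) = Ex X F * c.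
Proof. exact: EfZr. Qed.
Lemma ExN F : Ex X (fun v => - F v) = - Ex X F.
Proof. exact: EfN. Qed.
Lemma Ex_sum (J : finType) (F : J -> V -> R) :
  Ex X (fun v => \sum_j F j v) = \sum_j Ex X (F j).
Proof. exact: Ef_sum. Qed.
Lemma exchange_Ex (I' : finType) (V' : Type) (X' : {ffun I' -> S} -> V')
    (F : V -> V' -> R) :
  Ex X (fun v => Ex X' (F v)) = Ex X' (fun v' => Ex X (F^~ v')).
Proof. exact: exchange_Ef. Qed.
End Linearity.

Definition scal1 (w : {ffun 'I_1 -> S}) : R := x (w ord0).
Definition vec n (w : {ffun 'I_n -> S}) : 'rV[R]_n := \row_j x (w j).
(* Unordered pairs of indices are encoded as the sets [[set i; j]], so that
   injections of indices act on the sample space; the coordinates at the other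
   sets are never read. *)
Definition symx n (w : {ffun {set 'I_n} -> S}) : 'M[R]_n :=
  \matrix_(i, j) x (w [set i; j]%SET).

Notation Em := (Ex scal1).
Notation Ev n := (Ex (@vec n)).
Notation EW n := (Ex (@symx n)).

Lemma symx_sym n (w : {ffun {set 'I_n} -> S}) : (symx w)^T = symx w.
Proof. by apply/matrixP => i j; rewrite !mxE finset.setUC. Qed.

Hypothesis pr1 : \sum_s pr s = 1.

Lemma Ex_cst (I : finType) (V : Type) (X : {ffun I -> S} -> V) c :
  Ex X (fun=> c) = c.
Proof. exact: Ef_cst. Qed.

Lemma Em_sum (f : R -> R) : Em f = \sum_s pr s * f (x s).
Proof.
rewrite /Ex /Ef (reindex (fun s => [ffun _ : 'I_1 => s])) /=; last first.
  exists (fun w : {ffun 'I_1 -> S} => w ord0) => [s|w] _; first by rewrite ffunE.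
  by apply/ffunP => i; rewrite ffunE (ord1 i).
by apply: eq_bigr => s _; rewrite big_ord1 /scal1 !ffunE.
Qed.

Lemma EvS n (F : 'rV[R]_(1 + n) -> R) :
  Ev n.+1 F = Em (fun a => Ev n (fun u => F (row_mx a%:M u))).
Proof.
rewrite /Ex -(@Ef_split _ _ pr pr1 'I_n.+1 'I_1 'I_n (fun=> ord0) (lift ord0)
  (fun a b => F (row_mx (scal1 a)%:M (vec b)))).
- apply: eq_Ef => w; congr F; apply/rowP => j.
  rewrite -[j]/(j : 'I_(1 + n)); case: (split_ordP j) => k ->.
    rewrite row_mxEl !mxE /scal1 ffunE (ord1 k) /=; congr (x (w _)).
    exact: val_inj.
  by rewrite row_mxEr !mxE ffunE; congr (x (w _)); apply: val_inj.
- by move=> i j _; rewrite (ord1 i) (ord1 j).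
- exact: lift_inj.
- by move=> a b; rewrite neq_lift.
Qed.

Lemma Ev0 (F : 'rV[R]_0 -> R) : Ev 0 F = F 0.
Proof.
rewrite -[RHS](Ex_cst (@vec 0)); apply: eq_Ex => v.
by rewrite (thinmx0 v).
Qed.

Lemma EW0 (F : 'M[R]_0 -> R) : EW 0 F = F 0.
Proof.
rewrite -[RHS](Ex_cst (@symx 0)); apply: eq_Ex => v.
by rewrite (thinmx0 v).
Qed.

(** The sets containing [ord0] carry the first row and the images under [lift ord0] carry the minor;
    they are disjoint, so the first row is independent of the minor. *)
Lemma EWS n (F : 'M[R]_(1 + n) -> R) : EW n.+1 F =
  Em (fun a => Ev n (fun u => EW n (fun B => F (block_mx a%:M u u^T B)))).
Proof.
transitivity (Ev n.+1 (fun v : 'rV_(1 + n) =>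
    EW n (fun B => F (block_mx (lsubmx v) (rsubmx v) (rsubmx v)^T B)))); last first.
  rewrite EvS; apply: eq_Ex => a; apply: eq_Ex => u.
  by rewrite row_mxKl row_mxKr.
have neq0l (a : 'I_n.+1) (b : {set 'I_n}) :
    [set ord0; a]%SET != (lift ord0 @: b)%SET.
  apply/eqP => /setP/(_ ord0); rewrite !inE eqxx => /esym/imsetP[i _ /eqP].
  by rewrite (negPf (neq_lift _ _)).
rewrite /Ex -(@Ef_split _ _ pr pr1 {set 'I_n.+1} 'I_n.+1 {set 'I_n}
  (fun i => [set ord0; i]%SET) (fun s : {set 'I_n} => lift ord0 @: s)%SET
  (fun a b => F (block_mx (lsubmx (vec a : 'rV_(1 + n))) (rsubmx (vec a : 'rV_(1 + n)))
     (rsubmx (vec a : 'rV_(1 + n)))^T (symx b)))) //.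
- apply: eq_Ef => w; congr F; apply/matrixP => i j.
  have l0 : lshift n (0 : 'I_1) = ord0 by apply: val_inj.
  have r0 k : rshift 1 k = lift ord0 k by apply: val_inj.
  rewrite -[i]/(i : 'I_(1 + n)) -[j]/(j : 'I_(1 + n)).
  case: (split_ordP i) => {}i ->; case: (split_ordP j) => {}j ->.
  + by rewrite block_mxEul !mxE !ffunE (ord1 i) (ord1 j) l0.
  + by rewrite block_mxEur !mxE !ffunE (ord1 i) l0.
  + by rewrite block_mxEdl !mxE !ffunE (ord1 j) l0 finset.setUC.
  + by rewrite block_mxEdr !mxE !ffunE imsetU !imset_set1 !r0.
- move=> i j /setP ij; have := ij i; rewrite !inE eqxx orbT => /esym/orP[/eqP i0|/eqP//].
  by have := ij j; rewrite !inE eqxx orbT i0 orbb => /eqP.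
- exact: imset_inj (@lift_inj _ ord0).
Qed.

(** Exchangeability and consistency at once: a permutation and a restriction of the index set are
    both injections. *)
Lemma EW_mxsub k n (f : 'I_k -> 'I_n) (F : 'M[R]_k -> R) :
  injective f -> EW n (fun M => F (mxsub f f M)) = EW k F.
Proof.
move=> fI; rewrite /Ex -(Ef_inj pr1 (fun w => F (symx w)) (imset_inj fI)).
apply: eq_Ef => w; congr F; apply/matrixP => i j.
by rewrite !mxE !ffunE imsetU !imset_set1.
Qed.

Hypothesis m1 : Em id = 0.
Hypothesis m2 : Em (fun a => a ^+ 2) = 1.
Variable kap : R.
Hypothesis m4 : Em (fun a => a ^+ 4) = kap.

Lemma Ev_lin n (c : 'cV[R]_n) : Ev n (fun u => (u *m c) 0 0) = 0.
Proof.
elim: n c => [|n IH] c; first by rewrite Ev0 mul0mx mxE.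
rewrite (@EvS n (fun u => (u *m (c : 'cV_(1 + n))) 0 0)).
rewrite -(vsubmxK (c : 'cV_(1 + n))).
under eq_Ex => a do under eq_Ex => u do rewrite mul_row_col mxE mul_scalar_mx mxE.
under eq_Ex => a do rewrite ExD IH addr0 Ex_cst.
by rewrite ExZr m1 mul0r.
Qed.

Lemma Ev_lin2 n (c : 'cV[R]_n) :
  Ev n (fun u => (u *m c) 0 0 ^+ 2) = \sum_i c i 0 ^+ 2.
Proof.
elim: n c => [|n IH] c; first by rewrite Ev0 mul0mx mxE expr0n big_ord0.
rewrite (@EvS n (fun u => (u *m (c : 'cV_(1 + n))) 0 0 ^+ 2)).
rewrite -(vsubmxK (c : 'cV_(1 + n))).
set c0 := usubmx _; set c' := dsubmx _.
under eq_Ex => a do under eq_Ex => u do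
  rewrite mul_row_col mxE mul_scalar_mx mxE sqrrD exprMn -mulrnAl.
under eq_Ex => a do rewrite !ExD Ex_cst ExZ Ev_lin mulr0 addr0 IH.
rewrite ExD Ex_cst ExZr m2 mul1r [RHS](@big_split_ord _ _ _ 1 n) /= big_ord1.
by rewrite (col_mxEu c0 c' ord0 0); congr (_ + _); apply: eq_bigr => i _;
   rewrite (col_mxEd c0 c' i 0).
Qed.

Definition qf n (A : 'M[R]_n) (u : 'rV[R]_n) := (u *m A *m u^T) 0 0.

Lemma qf_block n a u (A : 'M[R]_(1 + n)) : A^T = A ->
  qf A (row_mx a%:M u) = a ^+ 2 * A 0 0 +
    (a *+ 2 * (u *m dlsubmx A) 0 0 + qf (drsubmx A) u).
Proof.
move=> sA; rewrite /qf -{1}(submxK A) tr_row_mx tr_scalar_mx.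
rewrite mul_row_block mul_row_col !mul_scalar_mx.
have -> : ursubmx A = (dlsubmx A)^T by rewrite trmx_dlsub sA.
rewrite mulmxDl mul_mx_scalar mulmxDl -scalemxAl -trmx_mul.
rewrite !mxE big_ord1 !mxE.
set s := \sum_j _; set s' := \sum_j _.
have -> : lshift n (0 : 'I_1) = 0 by apply: val_inj.
by rewrite eqxx mulr1n; ring.
Qed.

Lemma Ev_qf n (A : 'M[R]_n) : A^T = A -> Ev n (qf A) = \tr A.
Proof.
elim: n A => [|n IH] A sA.
  by rewrite Ev0 /qf !mul0mx mxE /mxtrace big_ord0.
rewrite EvS; under eq_Ex => a do under eq_Ex => u do rewrite qf_block //.
have sA' : (drsubmx (A : 'M[_]_(1 + n)))^T = drsubmx (A : 'M[_]_(1 + n)).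
  by rewrite trmx_drsub sA.
under eq_Ex => a do rewrite !ExD Ex_cst ExZ Ev_lin mulr0 add0r IH //.
rewrite ExD Ex_cst ExZr m2 mul1r /mxtrace big_ord_recl; congr (_ + _).
by apply: eq_bigr => i _; rewrite !mxE; congr (A _ _); apply: val_inj.
Qed.

(** The Gaussian value plus a correction by the excess kurtosis [kap - 3] on the diagonal. Third
    moments never enter: in the induction each one is multiplied by a mean that is zero. *)
Lemma Ev_qf2 n (A : 'M[R]_n) : A^T = A -> Ev n (fun u => qf A u ^+ 2) =
  \tr A ^+ 2 + 2 * (\sum_i \sum_j A i j ^+ 2) + (kap - 3) * \sum_i A i i ^+ 2.
Proof.
elim: n A => [|n IH] A sA.
  by rewrite Ev0 /qf !mul0mx mxE /mxtrace !big_ord0; ring.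
have sA' : (drsubmx (A : 'M[_]_(1 + n)))^T = drsubmx (A : 'M[_]_(1 + n)).
  by rewrite trmx_drsub sA.
rewrite EvS; under eq_Ex => a do under eq_Ex => u do rewrite qf_block //.
set A' := drsubmx _ in sA' *; set b := dlsubmx _.
transitivity (kap * (A 0 0) ^+ 2 + 4 * (\sum_i b i 0 ^+ 2) +
   Ev n (fun u => qf A' u ^+ 2) + 2 * A 0 0 * \tr A').
  have Hin a : Ev n (fun u => (a ^+ 2 * A 0 0 +
      (a *+ 2 * (u *m b) 0 0 + qf A' u)) ^+ 2) =
      a ^+ 4 * A 0 0 ^+ 2 + (a ^+ 2 * (4 * (\sum_i b i 0 ^+ 2)) +
      (Ev n (fun u => qf A' u ^+ 2) + (a ^+ 2 * (2 * A 0 0 * \tr A') +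
      a * (4 * Ev n (fun u => (u *m b) 0 0 * qf A' u))))).
    rewrite (@eq_Ex _ _ _ _ (fun u => a ^+ 4 * A 0 0 ^+ 2 +
      ((a ^+ 2 * 4) * (u *m b) 0 0 ^+ 2 + (qf A' u ^+ 2 +
      ((a ^+ 2 * (2 * A 0 0)) * qf A' u + ((a * 4) * ((u *m b) 0 0 * qf A' u) +
      (4 * a ^+ 3 * A 0 0) * (u *m b) 0 0)))))) => [|u]; last by ring.
    rewrite ExD Ex_cst ExD ExZ Ev_lin2 ExD ExD ExZ Ev_qf // ExD ExZ ExZ Ev_lin.
    by ring.
  rewrite (eq_Ex _ Hin) ExD ExZr m4 ExD ExZr m2 ExD Ex_cst ExD ExZr m2 ExZr m1.
  by ring.
rewrite IH //.
have r0 i : rshift 1 i = lift ord0 i :> 'I_n.+1 by apply: val_inj.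
have -> : \tr A = A 0 0 + \tr A'.
  by rewrite /mxtrace big_ord_recl; congr (_ + _); apply: eq_bigr => i _; rewrite !mxE r0.
have -> : \sum_i A i i ^+ 2 = A 0 0 ^+ 2 + \sum_i A' i i ^+ 2.
  by rewrite big_ord_recl; congr (_ + _); apply: eq_bigr => i _; rewrite !mxE r0.
have -> : \sum_i \sum_j A i j ^+ 2 =
    A 0 0 ^+ 2 + 2 * (\sum_i b i 0 ^+ 2) + \sum_i \sum_j A' i j ^+ 2.
  rewrite big_ord_recl big_ord_recl /=.
  have -> : \sum_(i < n) A ord0 (lift ord0 i) ^+ 2 = \sum_i b i 0 ^+ 2.
    apply: eq_bigr => i _; rewrite !mxE -[in LHS]sA mxE r0.
    by congr (A _ _ ^+ 2); apply: val_inj.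
  under eq_bigr => i _ do rewrite big_ord_recl.
  rewrite big_split /=.
  have -> : \sum_(i < n) A (lift ord0 i) ord0 ^+ 2 = \sum_i b i 0 ^+ 2.
    apply: eq_bigr => i _; rewrite !mxE r0.
    by congr (A _ _ ^+ 2); apply: val_inj.
  have -> : \sum_i \sum_j A' i j ^+ 2 =
      \sum_(i < n) \sum_(i0 < n) A (lift ord0 i) (lift ord0 i0) ^+ 2.
    by apply: eq_bigr => i _; apply: eq_bigr => j _; rewrite !mxE !r0.
  by ring.
by ring.
Qed.

Lemma EWS' n (F : 'M[R]_(1 + n) -> R) : EW n.+1 F =
  EW n (fun B => Em (fun a => Ev n (fun u => F (block_mx a%:M u u^T B)))).
Proof.
rewrite EWS; under eq_Ex => a do rewrite exchange_Ex.
by rewrite exchange_Ex.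
Qed.

Lemma eq_EW n (F G : 'M[R]_n -> R) :
  (forall M, M^T = M -> F M = G M) -> EW n F = EW n G.
Proof. by move=> FG; apply: eq_Ef => w; apply: FG; exact: symx_sym. Qed.

Lemma Ev_colsub k n (f : 'I_k -> 'I_n) (F : 'rV[R]_k -> R) :
  injective f -> Ev n (fun u => F (colsub f u)) = Ev k F.
Proof.
move=> fI; rewrite /Ex -(Ef_inj pr1 (fun w => F (vec w)) fI).
by apply: eq_Ef => w; congr F; apply/rowP => j; rewrite !mxE ffunE.
Qed.

Variable z : R.

Definition cdet n (W : 'M[R]_n) := \det (W - z%:M).
Definition cadj n (W : 'M[R]_n) := \adj (W - z%:M).

Lemma sub_block n a (u : 'rV[R]_n) (B : 'M[R]_n) :
  block_mx a%:M u u^T B - z%:M = block_mx (a - z)%:M u u^T (B - z%:M).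
Proof.
by rewrite (scalar_mx_block 1 n) opp_block_mx add_block_mx -raddfB !oppr0 !addr0.
Qed.

Lemma cdet_block n a (u : 'rV[R]_n) (B : 'M[R]_n) :
  cdet (block_mx a%:M u u^T B) = (a - z) * cdet B - qf (cadj B) u.
Proof. by rewrite /cdet sub_block det_block_cauchy. Qed.

Lemma cadj_sym n (B : 'M[R]_n) : B^T = B -> (cadj B)^T = cadj B.
Proof.
by move=> sB; rewrite /cadj trmx_adj linearB /= sB tr_scalar_mx.
Qed.

Lemma mxsub_subz k n (f : 'I_k -> 'I_n) (W : 'M[R]_n) :
  injective f -> mxsub f f (W - z%:M) = mxsub f f W - z%:M.
Proof. by move=> fI; apply/matrixP => i j; rewrite !mxE (inj_eq fI). Qed.

Lemma cdet_mxsub n (s : 'I_n -> 'I_n) (W : 'M[R]_n) :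
  injective s -> cdet (mxsub s s W) = cdet W.
Proof. by move=> sI; rewrite /cdet -mxsub_subz // det_mxsub_inj. Qed.

Lemma cadj_mxsub n (s : 'I_n -> 'I_n) (W : 'M[R]_n) i j :
  injective s -> cadj (mxsub s s W) i j = cadj W (s i) (s j).
Proof. by move=> sI; rewrite /cadj -mxsub_subz // adj_mxsub_inj. Qed.

Lemma cadj_diag n (W : 'M[R]_n.+1) i :
  cadj W i i = cdet (mxsub (lift i) (lift i) W).
Proof. by rewrite /cadj adj_diag /cdet -mxsub_subz //; exact: lift_inj. Qed.

(** The permutation that brings [k] to position 0 and keeps the order of the others; through it
    exchangeability reduces sums over vertices to the vertex 0. *)
Definition to_front n (k i : 'I_n.+1) : 'I_n.+1 :=
  if unlift ord0 i is Some j then lift k j else k.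

Lemma to_front0 n (k : 'I_n.+1) : to_front k ord0 = k.
Proof. by rewrite /to_front unlift_none. Qed.

Lemma to_front_lift n (k : 'I_n.+1) j : to_front k (lift ord0 j) = lift k j.
Proof. by rewrite /to_front liftK. Qed.

Lemma to_front_inj n (k : 'I_n.+1) : injective (to_front k).
Proof.
move=> i j; case: (unliftP ord0 i) => [i'|] ->; case: (unliftP ord0 j) => [j'|] ->.
- by rewrite !to_front_lift => /lift_inj ->.
- by rewrite to_front_lift to_front0 => /esym/eqP; rewrite (negPf (neq_lift _ _)).
- by rewrite to_front_lift to_front0 => /eqP; rewrite (negPf (neq_lift _ _)).
- by [].
Qed.

Lemma EW_front n (k : 'I_n.+1) (F : 'M[R]_n.+1 -> R) :
  EW n.+1 F = EW n.+1 (fun W => F (mxsub (to_front k) (to_front k) W)).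
Proof. by rewrite EW_mxsub //; exact: to_front_inj. Qed.

(** Conditional mean given the minor: [D] and [A] stand for its determinant and its adjugate. *)
Lemma mean_step n (D : R) (A : 'M[R]_n) : A^T = A ->
  Em (fun a => Ev n (fun u => (a - z) * D - qf A u)) = - z * D - \tr A.
Proof.
move=> sA; rewrite (eq_Ex _ (G := fun a => a * D + (- z * D - \tr A))).
  by rewrite ExD ExZr m1 Ex_cst mul0r add0r.
by move=> a; rewrite ExD Ex_cst ExN Ev_qf //; ring.
Qed.

Lemma square_step n (D : R) (A : 'M[R]_n) : A^T = A ->
  Em (fun a => Ev n (fun u => ((a - z) * D - qf A u) ^+ 2)) =
  (1 + z ^+ 2) * D ^+ 2 + (2 * z * (D * \tr A) + (\tr A ^+ 2 +
    (2 * (\sum_i \sum_j A i j ^+ 2) + (kap - 3) * \sum_i A i i ^+ 2))).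
Proof.
move=> sA; set Q := \tr A ^+ 2 + _.
rewrite (eq_Ex _ (G := fun a => a ^+ 2 * D ^+ 2 +
   (a * (- 2 * z * D ^+ 2 - 2 * (D * \tr A)) +
    (z ^+ 2 * D ^+ 2 + 2 * z * (D * \tr A) + Q)))).
  by rewrite ExD ExZr m2 ExD ExZr m1 Ex_cst; ring.
move=> a; rewrite (eq_Ex _ (G := fun u => ((a - z) * D) ^+ 2 +
   ((- 2 * (a - z) * D) * qf A u + qf A u ^+ 2))) => [|u]; last by ring.
by rewrite ExD Ex_cst ExD ExZ Ev_qf // Ev_qf2 // /Q; ring.
Qed.

Definition mean_cdet n := EW n (@cdet n).
Definition cdet2 n := EW n (fun W => cdet W ^+ 2).
Definition cdet_tr n := EW n (fun W => cdet W * \tr (cadj W)).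
Definition tr2 n := EW n (fun W => \tr (cadj W) ^+ 2).
Definition adj2 n := EW n (fun W => \sum_i \sum_j cadj W i j ^+ 2).
Definition diag2 n := EW n (fun W => \sum_i cadj W i i ^+ 2).

Lemma EW_cadj_diag n i (G : R -> R) :
  EW n.+1 (fun W => G (cadj W i i)) = EW n (fun W => G (cdet W)).
Proof.
under eq_Ex => W do rewrite cadj_diag.
by rewrite (EW_mxsub (fun W => G (cdet W))) //; exact: lift_inj.
Qed.

Lemma mean_cdet0 : mean_cdet 0 = 1.
Proof. by rewrite /mean_cdet EW0 /cdet det_mx00. Qed.

Lemma EW_tr n : EW n.+1 (fun W => \tr (cadj W)) = n.+1%:R * mean_cdet n.
Proof.
rewrite Ex_sum (eq_bigr (fun=> mean_cdet n)) => [|i _].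
  by rewrite sumr_const card_ord mulr_natl.
exact: EW_cadj_diag id.
Qed.

Lemma EW_tr0 : EW 0 (fun W => \tr (cadj W)) = 0.
Proof. by rewrite EW0 /mxtrace big_ord0. Qed.

Lemma mean_cdetS n : mean_cdet n.+1 = - z * mean_cdet n - EW n (fun W => \tr (cadj W)).
Proof.
rewrite /mean_cdet EWS' -ExZ -ExN -ExD; apply: eq_EW => B sB.
under eq_Ex => a do under eq_Ex => u do rewrite cdet_block.
by rewrite mean_step //; exact: cadj_sym.
Qed.

Lemma cdet2S n : cdet2 n.+1 =
  (1 + z ^+ 2) * cdet2 n + 2 * z * cdet_tr n + tr2 n + 2 * adj2 n + (kap - 3) * diag2 n.
Proof.
rewrite /cdet2 EWS' /cdet_tr /tr2 /adj2 /diag2 -!addrA -!ExZ -!ExD; apply: eq_EW => B sB.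
under eq_Ex => a do under eq_Ex => u do rewrite cdet_block.
by rewrite square_step //; exact: cadj_sym.
Qed.

Lemma diag2S n : diag2 n.+1 = n.+1%:R * cdet2 n.
Proof.
rewrite /diag2 Ex_sum (eq_bigr (fun=> cdet2 n)) => [|i _].
  by rewrite sumr_const card_ord mulr_natl.
exact: EW_cadj_diag (fun y => y ^+ 2).
Qed.

Lemma cadj_block00 n a (u : 'rV[R]_n) (B : 'M[R]_n) :
  cadj (block_mx a%:M u u^T B) (lshift n 0) (lshift n 0) = cdet B.
Proof. by rewrite /cadj sub_block adj_block00. Qed.

Lemma ord0E n : (ord0 : 'I_n.+1) = lshift n (0 : 'I_1).
Proof. exact: val_inj. Qed.
Lemma lift0E n (k : 'I_n) : lift ord0 k = rshift 1 k :> 'I_n.+1.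
Proof. exact: val_inj. Qed.

Lemma lift00E n (k : 'I_n) : lift (lshift n (0 : 'I_1)) k = rshift 1 k.
Proof. exact: val_inj. Qed.

(** By exchangeability every diagonal entry of the adjugate contributes as much as entry [(0, 0)].
    That entry is the determinant of the minor, so averaging over the first row acts on [cdet]
    alone. *)
Lemma cdet_trS n : cdet_tr n.+1 = - n.+1%:R * (z * cdet2 n + cdet_tr n).
Proof.
rewrite /cdet_tr; under eq_Ex => W do rewrite /mxtrace mulr_sumr.
rewrite Ex_sum (eq_bigr (fun=> - (z * cdet2 n + cdet_tr n))) => [|i _].
  by rewrite sumr_const card_ord mulNr mulr_natl mulNrn.
transitivity (EW n.+1 (fun W => cdet W * cadj W ord0 ord0)).
  rewrite [RHS](EW_front i); apply: eq_Ex => W.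
  by rewrite cdet_mxsub ?cadj_mxsub ?to_front0 //; exact: to_front_inj.
rewrite EWS' /cdet2 /cdet_tr -ExZ -ExD -ExN; apply: eq_EW => B sB.
under eq_Ex => a do under eq_Ex => u do rewrite ord0E cadj_block00 cdet_block.
under eq_Ex => a do rewrite ExZr.
by rewrite ExZr mean_step //; [ring | exact: cadj_sym].
Qed.

Lemma cadj_block0r n a (u : 'rV[R]_n) (B : 'M[R]_n) k :
  cadj (block_mx a%:M u u^T B) (lshift n 0) (rshift 1 k) = - (u *m cadj B) 0 k.
Proof. by rewrite /cadj sub_block adj_block0r. Qed.

(** The first row of the adjugate is [cdet B] followed by the entries of [- (u *m cadj B)];
    averaging over [u] turns the squares of the latter into all squared entries of [cadj B]. *)
Lemma adj2S n : adj2 n.+1 = n.+1%:R * (cdet2 n + adj2 n).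
Proof.
rewrite /adj2 Ex_sum (eq_bigr (fun=> cdet2 n + adj2 n)) => [|i _].
  by rewrite sumr_const card_ord mulr_natl.
transitivity (EW n.+1 (fun W => \sum_j cadj W ord0 j ^+ 2)).
  rewrite [RHS](EW_front i); apply: eq_Ex => W.
  rewrite (reindex_inj (@to_front_inj _ i)); apply: eq_bigr => j _.
  by rewrite cadj_mxsub ?to_front0 //; exact: to_front_inj.
rewrite EWS' /cdet2 /adj2 -ExD; apply: eq_EW => B sB.
rewrite (eq_Ex _ (G := fun=> cdet B ^+ 2 + \sum_i \sum_j cadj B i j ^+ 2)).
  by rewrite Ex_cst.
move=> a; under eq_Ex => u do rewrite big_ord_recl ord0E cadj_block00.
rewrite ExD Ex_cst Ex_sum; congr (_ + _); rewrite [RHS]exchange_big.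
apply: eq_bigr => k _.
under eq_Ex => u do rewrite lift00E cadj_block0r sqrrN.
transitivity (Ev n (fun u => (u *m col k (cadj B)) 0 0 ^+ 2)).
  apply: eq_Ex => u; congr (_ ^+ 2).
  by rewrite [LHS]mxE [RHS]mxE; apply: eq_bigr => l _; rewrite [in RHS]mxE.
by rewrite Ev_lin2; apply: eq_bigr => l _; rewrite mxE.
Qed.

(** After relabelling, the entry is linear in the centred row [u]. *)
Lemma EW_cadj_offdiag n (i j : 'I_n) : i != j -> EW n (fun W => cadj W i j) = 0.
Proof.
case: n i j => [[]//|n] i j ij.
case: (unliftP i j) => [k jE|jE]; last by rewrite jE eqxx in ij.
transitivity (EW n.+1 (fun W => cadj W ord0 (lift ord0 k))).
  rewrite [RHS](EW_front i); apply: eq_Ex => W.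
  by rewrite cadj_mxsub ?to_front0 ?to_front_lift ?jE //; exact: to_front_inj.
rewrite EWS' -[RHS](Ex_cst (@symx n)); apply: eq_Ex => B.
rewrite -[RHS](Ex_cst scal1); apply: eq_Ex => a.
under eq_Ex => u do rewrite lift0E ord0E cadj_block0r.
rewrite ExN -[RHS]oppr0; congr (- _).
transitivity (Ev n (fun u => (u *m col k (cadj B)) 0 0)).
  apply: eq_Ex => u.
  by rewrite [LHS]mxE [RHS]mxE; apply: eq_bigr => l _; rewrite [in RHS]mxE.
exact: Ev_lin.
Qed.

(** For two distinct vertices 0 and [k], one factor is the determinant of the minor [B] and the
    other a bordered determinant over [B] without [k]. Averaging the first row replaces the latter
    by its conditional mean [G]; expanding [B] along [k] and averaging again produces a second [G].
    Thus [h] is the mean of [G ^+ 2]. *)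
Lemma tr2S n : tr2 n.+2 =
  n.+2%:R * (cdet2 n.+1 + n.+1%:R * (z ^+ 2 * cdet2 n + 2 * z * cdet_tr n + tr2 n)).
Proof.
set h := _ + 2 * z * _ + _.
rewrite /tr2; under eq_Ex => W do rewrite /mxtrace expr2 mulr_suml.
rewrite Ex_sum (eq_bigr (fun=> cdet2 n.+1 + n.+1%:R * h)) => [|i _].
  by rewrite sumr_const card_ord [RHS]mulr_natl.
transitivity (EW n.+2 (fun W => \sum_j cadj W ord0 ord0 * cadj W j j)).
  rewrite [RHS](EW_front i); apply: eq_Ex => W.
  rewrite mulr_sumr (reindex_inj (@to_front_inj _ i)); apply: eq_bigr => j _.
  by rewrite !cadj_mxsub ?to_front0 //; exact: to_front_inj.
rewrite Ex_sum big_ord_recl; congr (_ + _).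
  exact: (EW_cadj_diag _ (fun y => y * y)).
rewrite (eq_bigr (fun=> h)) => [|k _].
  by rewrite sumr_const card_ord mulr_natl.
pose G n (B : 'M[R]_n) := - z * cdet B - \tr (cadj B).
transitivity (EW n.+1 (fun B => cdet B * G n (mxsub (lift k) (lift k) B))).
  rewrite EWS'; apply: eq_EW => B sB.
  have sB' : (mxsub (lift k) (lift k) B)^T = mxsub (lift k) (lift k) B.
    by rewrite trmx_mxsub sB.
  rewrite /G -(mean_step (cdet (mxsub (lift k) (lift k) B)) (cadj_sym sB')) -ExZ.
  apply: eq_Ex => a.
  rewrite -(Ev_colsub (fun u => (a - z) * _ - qf _ u) (@lift_inj _ k)) -ExZ.
  apply: eq_Ex => u; rewrite lift0E ord0E cadj_block00; congr (_ * _).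
  rewrite /cadj sub_block adj_diag mxsub_block_lift det_block_cauchy.
  have lI := @lift_inj _ k.
  by rewrite mxsub_subz // /qf /cdet -trmx_mxsub.
transitivity (EW n.+1 (fun B => cdet B * G n (mxsub (lift ord0) (lift ord0) B))).
  rewrite [RHS](EW_front k); apply: eq_Ex => W.
  rewrite cdet_mxsub; last exact: to_front_inj.
  congr (_ * G n _); apply/matrixP => i' j'.
  by rewrite !mxE !to_front_lift.
rewrite EWS' /h /cdet2 /cdet_tr /tr2 -!ExZ -!ExD; apply: eq_EW => B sB.
have BE a u : mxsub (lift ord0) (lift ord0) (block_mx a%:M u u^T B : 'M[_]_(1 + n)) = B.
  apply/matrixP => i' j'; rewrite mxE !lift0E.
  exact: (block_mxEdr a%:M u u^T B i' j').
under eq_Ex => a do under eq_Ex => u do rewrite BE cdet_block.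
under eq_Ex => a do rewrite ExZr.
by rewrite ExZr mean_step ?/G; [ring | exact: cadj_sym].
Qed.

Lemma cdet2_0 : cdet2 0 = 1.
Proof. by rewrite /cdet2 EW0 /cdet det_mx00 expr1n. Qed.
Lemma cdet_tr0 : cdet_tr 0 = 0.
Proof. by rewrite /cdet_tr EW0 /mxtrace big_ord0 mulr0. Qed.
Lemma tr2_0 : tr2 0 = 0.
Proof. by rewrite /tr2 EW0 /mxtrace big_ord0 expr0n. Qed.
Lemma adj2_0 : adj2 0 = 0.
Proof. by rewrite /adj2 EW0 big_ord0. Qed.
Lemma diag2_0 : diag2 0 = 0.
Proof. by rewrite /diag2 EW0 big_ord0. Qed.
Lemma tr2_1 : tr2 1 = 1.
Proof.
rewrite /tr2; under eq_Ex => W do rewrite /mxtrace big_ord1.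
by rewrite (EW_cadj_diag _ (fun y => y ^+ 2)) -/(cdet2 0) cdet2_0.
Qed.

End RandomSymmetric.

(** * Hermite polynomials and the shifted determinant *)

(** Probabilists' Hermite polynomials, each computed together with its predecessor. *)
Fixpoint hermite2 (R : pzRingType) (z : R) n : R * R :=
  if n is m.+1 then
    let: (a, b) := hermite2 z m in (z * a - m%:R * b, a)
  else (1, 0).
Definition hermite (R : pzRingType) (z : R) n := (hermite2 z n).1.

Section Hermite.
Variables (R : realFieldType) (z : R).
Notation He := (hermite z).

Lemma hermite0 : He 0 = 1. Proof. by []. Qed.
Lemma hermite1 : He 1 = z.
Proof. by rewrite /hermite /= mulr1 mul0r subr0. Qed.
Lemma hermiteSS n : He n.+2 = z * He n.+1 - n.+1%:R * He n.
Proof. by rewrite /hermite /=; case: (hermite2 z n). Qed.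

Definition turan n := He n.+1 ^+ 2 - He n.+2 * He n.

Lemma turanS n : turan n.+1 = n.+1%:R * turan n + He n.+1 ^+ 2.
Proof.
rewrite /turan (hermiteSS n.+1) (hermiteSS n).
rewrite -[n.+2%:R]natr1; ring.
Qed.

Lemma turan_sum n : turan n = n`!%:R * \sum_(j < n.+1) He j ^+ 2 / j`!%:R.
Proof.
elim: n => [|n IH].
  by rewrite big_ord1 /turan hermiteSS hermite1 hermite0 fact0; field.
rewrite turanS IH [in RHS]big_ord_recr /= mulrDr factS natrM mulrA; congr (_ + _).
by field; rewrite nat1r !pnatr_eq0 -lt0n fact_gt0.
Qed.

Lemma turan_ge n k : (k <= n)%N -> n`!%:R * (He k ^+ 2 / k`!%:R) <= turan n.
Proof.
move=> kn; rewrite turan_sum ler_wpM2l ?ler0n //.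
rewrite (bigD1 (Ordinal (kn : (k < n.+1)%N))) //= lerDl sumr_ge0 // => j _.
by rewrite divr_ge0 ?sqr_ge0 ?ler0n.
Qed.

Lemma turan_quad n :
  turan n = He n.+1 ^+ 2 - z * He n.+1 * He n + n.+1%:R * He n ^+ 2.
Proof. by rewrite /turan hermiteSS; ring. Qed.

End Hermite.

(** * First and second moments of the shifted determinant *)

Section Moments.
Variables (R : realFieldType) (S : finType) (pr x : S -> R).
Notation Em := (Ex pr (scal1 x)).
Notation EW n := (Ex pr (@symx R S x n)).
Hypothesis pr1 : \sum_s pr s = 1.
Hypothesis pr_ge0 : forall s, 0 <= pr s.
Hypothesis m1 : Em id = 0.
Hypothesis m2 : Em (fun a => a ^+ 2) = 1.
Variable kap : R.
Hypothesis m4 : Em (fun a => a ^+ 4) = kap.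
Variable z : R.
Notation He := (hermite z).
Notation p := (mean_cdet pr x z).
Notation f := (cdet2 pr x z).
Notation St := (cdet_tr pr x z).
Notation T := (tr2 pr x z).
Notation U := (adj2 pr x z).
Notation V := (diag2 pr x z).

Lemma mean_cdetE n : p n = (-1) ^+ n * He n.
Proof.
have p1 : p 1 = - z by rewrite mean_cdetS // mean_cdet0 // EW_tr0 // mulr1 subr0.
suff: p n = (-1) ^+ n * He n /\ p n.+1 = (-1) ^+ n.+1 * He n.+1 by case.
elim: n => [|n [IH1 IH2]].
  by rewrite mean_cdet0 // p1 hermite1 expr0 expr1 mul1r mulN1r.
split => //; rewrite mean_cdetS // EW_tr // IH1 IH2 hermiteSS !exprS; ring.
Qed.

Variable m : R.
Definition sdet n (W : 'M[R]_n) := \det (W - z%:M + const_mx m).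

Lemma mean_sdet n : EW n.+1 (@sdet n.+1) = p n.+1 + m * n.+1%:R * p n.
Proof.
under eq_Ex => W do rewrite /sdet det_addJ.
rewrite ExD ExZ -/(p n.+1) -mulrA; congr (_ + _ * _).
rewrite -EW_tr // Ex_sum /mxtrace [in RHS]Ex_sum; apply: eq_bigr => i _.
rewrite Ex_sum (bigD1 i) //= big1 ?addr0 // => j ij.
by rewrite EW_cadj_offdiag // eq_sym.
Qed.

Lemma sdet_sqr n : EW n (fun W => sdet W ^+ 2) <=
  2 * f n + 2 * m ^+ 2 * n%:R ^+ 2 * U n.
Proof.
rewrite -!ExZ -ExD; apply: Ef_le => // w.
set W := symx _ _; rewrite /sdet det_addJ -/(cdet z W) -/(cadj z W).
set s := \sum_i \sum_j cadj z W i j; set q := \sum_i \sum_j _ ^+ 2.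
have sq : s ^+ 2 <= n%:R ^+ 2 * q.
  (* Used once for the sum over rows and once inside each row, whence the factor [n ^+ 2]. *)
  have CS (a : 'I_n -> R) : (\sum_i a i) ^+ 2 <= n%:R * \sum_i a i ^+ 2.
    case: n a {w W s q} => [|k] a; first by rewrite !big_ord0 expr0n mul0r.
    set s := \sum_i a i; set q := \sum_i a i ^+ 2; set K := k.+1%:R.
    have : 0 <= \sum_i (K * a i - s) ^+ 2 by apply: sumr_ge0 => i _; exact: sqr_ge0.
    rewrite (eq_bigr (fun i => K ^+ 2 * a i ^+ 2 + ((- 2 * K * s) * a i + s ^+ 2)));
      last by move=> i _; ring.
    rewrite !big_split /= -!mulr_sumr -/s -/q sumr_const card_ord -(mulr_natl _ k.+1) -/K.
    have -> : K ^+ 2 * q + (- 2 * K * s * s + s * (K * s)) = K * (K * q - s ^+ 2) by ring.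
    by rewrite pmulr_rge0 ?ltr0Sn // subr_ge0.
  apply: le_trans (CS _) _; rewrite expr2 -mulrA ler_wpM2l ?ler0n // /q mulr_sumr.
  by apply: ler_sum => i _; exact: CS.
have : 0 <= m ^+ 2 by exact: sqr_ge0.
move/ler_wpM2l/(_ _ _ sq) => sq'.
have : 0 <= (cdet z W - m * s) ^+ 2 by exact: sqr_ge0.
by rewrite -!mulrA; nra.
Qed.

Lemma sdet_block n a (u : 'rV[R]_n) (B : 'M[R]_n) :
  sdet (block_mx a%:M u u^T B) = (a - z + m) * sdet B -
    ((u + const_mx m) *m \adj (B - z%:M + const_mx m) *m (u^T + const_mx m)) 0 0.
Proof.
rewrite /sdet sub_block -det_block_cauchy; congr (\det _).
apply/matrixP => i j; rewrite [LHS]mxE [X in _ + X]mxE.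
case: (split_ordP i) => {}i ->; case: (split_ordP j) => {}j ->.
- by rewrite !block_mxEul !mxE (ord1 i) (ord1 j) eqxx !mulr1n.
- by rewrite !block_mxEur !mxE.
- by rewrite !block_mxEdl !mxE.
- by rewrite !block_mxEdr !mxE.
Qed.

Variable c : R.
Hypothesis c_spread : forall D Q : R, c * `|D| <= Em (fun a => `|a * D - Q|).

(** With the rest of the matrix fixed, the determinant is affine in the corner entry with slope
    [sdet B]; by [c_spread] no constant term can cancel this slope on average. *)
Lemma norm_sdetS n :
  c * EW n (fun B => `|sdet B|) <= EW n.+1 (fun W => `|sdet W|).
Proof.
rewrite EWS' // -ExZ; apply: Ef_le => // w.
set B := symx x w; rewrite exchange_Ex.
rewrite -[leLHS](@Ex_cst _ _ pr pr1 _ _ (@vec R S x n)).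
apply: Ef_le => // u; set u' := vec x u.
set Q := ((u' + const_mx m) *m \adj (B - z%:M + const_mx m) *m
  (u'^T + const_mx m)) 0 0.
apply: le_trans (c_spread _ (Q + (z - m) * sdet B)) _.
rewrite le_eqVlt; apply/orP; left; apply/eqP; apply: eq_Ex => a.
by rewrite sdet_block -/Q; congr `|_|; ring.
Qed.

(* The means of [sdet] in sizes [n.+1] and [n.+2] form an invertible linear
   system in [He n], [He n.+1], so these are controlled by [E |sdet|]; the Turan
   determinant is a quadratic form in them. *)
Lemma hermite_le_norm_sdet n k : (k <= n)%N -> 0 < c <= 1 -> 0 <= m ->
  1 <= m ^+ 2 * n.+2%:R - m * z + 1 ->
  n`!%:R * (He k ^+ 2 / k`!%:R) <=
  3 * (1 + m * n.+3%:R + `|z|) ^+ 3 / c ^+ 2 *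
    EW n.+2 (fun W => `|sdet W|) ^+ 2.
Proof.
move=> kn /andP[c0 c1] m0 kap1; apply: le_trans (turan_ge z kn) _.
set X := EW n.+2 _; set K := 1 + _ + _.
have X1 : `|p n.+2 + m * n.+2%:R * p n.+1| <= X.
  by rewrite -mean_sdet; exact: Ef_norm.
have X2 : c * `|p n.+1 + m * n.+1%:R * p n| <= X.
  apply: le_trans (norm_sdetS n.+1); rewrite -mean_sdet ler_wpM2l ?(ltW c0) //.
  exact: Ef_norm.
have pSS : p n.+2 = - z * p n.+1 - n.+1%:R * p n.
  by rewrite !mean_cdetE hermiteSS !exprS; ring.
set e2 := p n.+2 + _ in X1; set e1 := p n.+1 + _ in X2.
(* Cramer's rule for [e1] and [e2] as linear forms in [p n.+1] and [n.+1%:R * p n]. The determinant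
   of the system is the left factor, at least 1 by [kap1]. *)
have E1 : (m ^+ 2 * n.+2%:R - m * z + 1) * p n.+1 = m * e2 + e1.
  by rewrite /e2 /e1 pSS; ring.
have E2 : (m ^+ 2 * n.+2%:R - m * z + 1) * (n.+1%:R * p n) =
    (m * n.+2%:R - z) * e1 - e2.
  by rewrite /e2 /e1 pSS; ring.
have X0 : 0 <= X by apply: Ef_ge0.
pose Y := X / c.
have XY : X <= Y by rewrite ler_pdivlMr // ler_piMr.
have e1Y : `|e1| <= Y by rewrite ler_pdivlMr // mulrC.
have Y0 : 0 <= Y by rewrite divr_ge0 // ltW.
have N0 : 0 <= m * n.+2%:R by rewrite mulr_ge0 ?ler0n.
have KE : K = 1 + m + m * n.+2%:R + `|z| by rewrite /K -[n.+3%:R]natr1; ring.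
have B1 : `|p n.+1| <= K * Y.
  have : `|p n.+1| <= `|(m ^+ 2 * n.+2%:R - m * z + 1) * p n.+1|.
    by rewrite normrM ler_peMl // ger0_norm //; exact: le_trans kap1.
  rewrite E1 => /le_trans; apply; apply: le_trans (ler_normD _ _) _.
  rewrite normrM (ger0_norm m0).
  have := ler_wpM2l m0 (le_trans X1 XY).
  have := mulr_ge0 N0 Y0; have := mulr_ge0 (normr_ge0 z) Y0.
  by rewrite KE; nra.
have B2 : n.+1%:R * `|p n| <= K * Y.
  have : `|n.+1%:R * p n| <= `|(m ^+ 2 * n.+2%:R - m * z + 1) * (n.+1%:R * p n)|.
    by rewrite [leRHS]normrM ler_peMl // ger0_norm //; exact: le_trans kap1.
  rewrite {1}normrM normr_nat E2 => /le_trans; apply.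
  apply: le_trans (ler_normB _ _) _; rewrite normrM.
  have : `|m * n.+2%:R - z| <= m * n.+2%:R + `|z|.
    by apply: le_trans (ler_normB _ _) _; rewrite (ger0_norm N0).
  move=> h; have := ler_pM (normr_ge0 _) (normr_ge0 _) h e1Y.
  have := le_trans X1 XY; have := mulr_ge0 m0 Y0.
  by rewrite KE; nra.
have Hn i : `|He i| = `|p i| by rewrite mean_cdetE normrM normr_sign mul1r.
rewrite turan_quad.
have n1 : 1 <= n.+1%:R :> R by rewrite ler1n.
have B3 : `|p n| <= K * Y.
  by apply: le_trans B2; rewrite ler_peMl.
have K1 : 1 <= K by rewrite KE; have := normr_ge0 z; lra.
have zK : `|z| <= K by rewrite KE; have := normr_ge0 z; lra.
have -> : 3 * K ^+ 3 / c ^+ 2 * X ^+ 2 = 3 * K * (K * Y) ^+ 2.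
  by rewrite /Y; field; rewrite gt_eqF.
set W := K * Y in B1 B2 B3 *.
have W0 : 0 <= W by apply: le_trans B1.
have hT1 : He n.+1 ^+ 2 <= W ^+ 2.
  by rewrite -[He n.+1 ^+ 2](@real_normK _ _ (num_real _)) Hn lerXn2r ?nnegrE.
have hT2 : - (z * He n.+1 * He n) <= K * W ^+ 2.
  apply: le_trans (ler_norm _) _; rewrite normrN !normrM !Hn expr2 mulrA.
  by rewrite !ler_pM ?mulr_ge0.
have hT3 : n.+1%:R * He n ^+ 2 <= W ^+ 2.
  by rewrite -[He n ^+ 2](@real_normK _ _ (num_real _)) Hn expr2 mulrA expr2 ler_pM ?mulr_ge0 ?ler0n.
have : 0 <= W ^+ 2 by exact: sqr_ge0.
by nra.
Qed.

Definition phi n := f n / n`!%:R.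

Let factR n : n`!%:R != 0 :> R.
Proof. by rewrite pnatr_eq0 -lt0n fact_gt0. Qed.

Lemma phi_ge0 n : 0 <= phi n.
Proof. by rewrite divr_ge0 ?ler0n // Ef_ge0 // => w; exact: sqr_ge0. Qed.

Lemma phi0 : phi 0 = 1.
Proof. by rewrite /phi cdet2_0 // fact0 divr1. Qed.

Lemma cdet2E n : f n = n`!%:R * phi n.
Proof. by rewrite /phi; field; exact: factR. Qed.

(** Dividing by [n!] makes the recurrences solvable: each auxiliary moment becomes a convolution of
    [phi] with an explicit kernel. *)
Lemma adj2E n : U n = n`!%:R * \sum_(i < n) phi i.
Proof.
elim: n => [|n IH]; first by rewrite adj2_0 // big_ord0 mulr0.
rewrite adj2S // IH big_ord_recr factS natrM /= cdet2E; ring.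
Qed.

Lemma cdet_trE n : St n = n`!%:R * (z * \sum_(i < n) (-1) ^+ (n - i) * phi i).
Proof.
elim: n => [|n IH]; first by rewrite cdet_tr0 // big_ord0 !mulr0.
rewrite cdet_trS // IH [in RHS]big_ord_recr factS natrM /= subSnn cdet2E expr1.
under [in RHS]eq_bigr => i _ do rewrite subSn ?(ltnW (ltn_ord i)) // exprS mulN1r mulNr.
by rewrite sumrN; ring.
Qed.

(** For [k >= 1], the coefficients of [z^2 x^2 / (1 + x)^2 + x / (1 - x^2)]. *)
Definition kerT k : R := z ^+ 2 * (-1) ^+ k * (k%:R - 1) + (odd k)%:R.

Lemma tr2E n : T n = n`!%:R * \sum_(i < n) kerT (n - i) * phi i.
Proof.
suff: T n = n`!%:R * (\sum_(i < n) kerT (n - i) * phi i) /\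
      T n.+1 = n.+1`!%:R * (\sum_(i < n.+1) kerT (n.+1 - i) * phi i) by case.
elim: n => [|n [IH1 IH2]].
  rewrite tr2_0 // tr2_1 // big_ord0 big_ord1 mulr0; split => //.
  by rewrite /kerT phi0 subn0 factS fact0 /=; ring.
split => //; rewrite tr2S // IH1 cdet_trE.
rewrite 2!big_ord_recr /= subSnn subSn // subSnn.
have -> : \sum_(i < n) kerT (n.+2 - i) * phi i = \sum_(i < n) kerT (n - i) * phi i +
    2 * z * (z * \sum_(i < n) (-1) ^+ (n - i) * phi i).
  rewrite mulrA mulr_sumr -big_split; apply: eq_bigr => i _ /=.
  rewrite 2?subSn ?(leqW (ltnW (ltn_ord i))) ?(ltnW (ltn_ord i)) //.
  rewrite /kerT /= negbK !exprS -[(n - i).+2%:R]natr1 -[(n - i).+1%:R]natr1.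
  by ring.
rewrite !cdet2E 2!factS !natrM /kerT /=.
by ring.
Qed.

(* Coefficients of [z^2 / (1 + x)^2 + 3 / (1 - x) + kap x]. *)
Definition kerphi k : R := z ^+ 2 * (-1) ^+ k * k.+1%:R + 3 + kap * (k == 1%N)%:R.

(** The exact kernel is enlarged to one whose generating function has a simple primitive: the parity
    term is raised to 1, the [-3] in the kurtosis term is dropped and the constant at [k = 0] is
    raised to 3. Since [phi] is nonnegative this only increases the sum. *)
Lemma phi_rec n :
  n.+1%:R * phi n.+1 <= \sum_(i < n.+1) kerphi (n - i) * phi i.
Proof.
have -> : n.+1%:R * phi n.+1 = f n.+1 / n`!%:R.
  by rewrite /phi factS natrM; field; rewrite factR nat1r pnatr_eq0.
rewrite (cdet2S pr1 m1 m2 m4).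
rewrite ler_pdivrMr ?ltr0n ?fact_gt0 // adj2E cdet_trE tr2E.
have -> : V n = n`!%:R * \sum_(i < n) ((n - i)%N == 1%N)%:R * phi i.
  case: n => [|n]; first by rewrite diag2_0 // big_ord0 mulr0.
  rewrite diag2S // big_ord_recr /= subSnn eqxx mul1r big1 => [|i _].
    by rewrite add0r cdet2E factS natrM mulrA.
  by rewrite subSn ?(ltnW (ltn_ord i)) // eqSS subn_eq0 leqNgt ltn_ord mul0r.
rewrite big_ord_recr /= subnn {2}/kerphi cdet2E.
set a := \sum_(i < n) _; set b := \sum_(i < n) _; set c' := \sum_(i < n) _.
set d := \sum_(i < n) _; set e := \sum_(i < n) _.
have : 2 * z * (z * a) + b + 2 * c' + (kap - 3) * d <= e.
  rewrite mulrA !mulr_sumr -!big_split; apply: ler_sum => i _ /=.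
  have o1 : (odd (n - i))%:R <= 1 :> R by case: odd.
  have d0 : 0 <= ((n - i)%N == 1%N)%:R :> R by exact: ler0n.
  rewrite -subr_ge0 /kerT /kerphi -natr1.
  set o := _%:R in o1 *; set d' := _%:R in d0 *.
  have : 0 <= (1 - o + 3 * d') * phi i.
    by rewrite mulr_ge0 ?phi_ge0 // addr_ge0 ?subr_ge0 // mulr_ge0.
  congr (0 <= _); ring.
move=> h; rewrite -subr_ge0.
have : 0 <= n`!%:R * ((e - (2 * z * (z * a) + b + 2 * c' + (kap - 3) * d))
    + 2 * phi n).
  by rewrite mulr_ge0 ?ler0n // addr_ge0 ?subr_ge0 // mulr_ge0 ?phi_ge0.
by congr (0 <= _); rewrite /= expr0; ring.
Qed.

End Moments.

(** * The second moment: a generating-function inequality *)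

Lemma is_derive_le (R : realType) (f df : R -> R) (a b : R) : a <= b ->
  (forall t, a <= t <= b -> is_derive t 1 f (df t)) ->
  (forall t, a <= t <= b -> df t <= 0) -> f b <= f a.
Proof.
move=> ab fd df0.
apply: (@ler0_derive1_nincr R f a b) => //.
- by move=> t; rewrite in_itv /= => /andP[/ltW at1 /ltW tb]; have := fd t; rewrite at1 tb => /(_ isT) [].
- move=> t; rewrite in_itv /= => /andP[/ltW at1 /ltW tb].
  have tab : a <= t <= b by rewrite at1 tb.
  have d := fd t tab.
  by rewrite derive1E derive_val; exact: df0.
- apply: derivable_within_continuous => t; rewrite in_itv /= => tab.
  by have [] := fd t tab.
Qed.

Lemma is_derive_inv (R : realType) (f : R -> R) (t df : R) : f t != 0 ->
  is_derive t 1 f df -> is_derive t 1 (fun y => (f y)^-1) (- (f t) ^- 2 * df).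
Proof.
move=> ft [d <-]; apply: DeriveDef; first exact: derivableV.
by rewrite deriveV.
Qed.

(** Integrating factor [expR (- A t)]; it is at most 1 because [A] is nonnegative, so the error
    contributes at most [e] per unit length. *)
Lemma gronwall (R : realType) (g g' A A' : R -> R) (e x : R) : 0 <= x -> 0 <= e ->
  (forall t, 0 <= t <= x -> is_derive t 1 g (g' t)) ->
  (forall t, 0 <= t <= x -> is_derive t 1 A (A' t)) ->
  (forall t, 0 <= t <= x -> 0 <= A t) -> A 0 = 0 ->
  (forall t, 0 <= t <= x -> g' t <= A' t * g t + e) ->
  g x <= expR (A x) * (g 0 + e * x).
Proof.
move=> x0 e0 dg dA A0 A00 gA.
have : g x * expR (- A x) - e * x <= g 0 * expR (- A 0) - e * 0.
  apply: (@is_derive_le R (fun t => g t * expR (- A t) - e * t)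
    (fun t => (g' t - A' t * g t) * expR (- A t) - e)) => // t tx.
    have dg1 := dg t tx; have dA1 := dA t tx.
    have dE : is_derive t 1 (fun t => expR (- A t)) (- A' t * expR (- A t)).
      have dN : is_derive t 1 (fun t => - A t) (- A' t) by apply: is_deriveN.
      rewrite mulrC; exact: (is_derive1_comp (f := expR)).
    apply: is_deriveB.
    - apply: is_derive_eq; rewrite /GRing.scale /=; ring.
    - apply: is_derive_eq; rewrite /GRing.scale /=; ring.
  have E1 : expR (- A t) <= 1 by rewrite expR_le1 oppr_le0 A0.
  have := gA t tx; have := expR_ge0 (- A t); nra.
rewrite A00 oppr0 expR0 mulr1 mulr0 subr0 lerBlDr => h.
rewrite -ler_pdivrMl ?expR_gt0 // -expRN mulrC.
exact: h.
Qed.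

Lemma sum_alt_lin (R : realFieldType) (t : R) m : 1 + t != 0 ->
  \sum_(k < m) k.+1%:R * (- t) ^+ k =
  (1 - m.+1%:R * (- t) ^+ m + m%:R * (- t) ^+ m.+1) / (1 + t) ^+ 2.
Proof.
move=> t1; elim: m => [|m IH]; first by rewrite big_ord0 expr0 mul0r mulr1 subrr add0r mul0r.
rewrite big_ord_recr /= IH -[m.+2%:R]natr1 -natr1 !exprS.
by field; exact: t1.
Qed.

Lemma sum_alt_lin_le (R : realFieldType) (t : R) m : 0 <= t <= 1 ->
  \sum_(k < m) k.+1%:R * (- t) ^+ k <= (1 + t) ^- 2 + m.+1%:R * t ^+ m.
Proof.
move=> /andP[t0 t1]; rewrite sum_alt_lin; last by rewrite gt_eqF // ltr_wpDr.
rewrite -lerBlDl -{2}[_ ^- 2]mul1r -mulrBl ler_pdivrMr ?exprn_gt0 ?ltr_wpDr //.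
have tm : 0 <= t ^+ m by rewrite exprn_ge0.
have m0 : 0 <= m%:R :> R by [].
have -> : (- t) ^+ m.+1 = (-1) ^+ m * (- t * t ^+ m).
  by rewrite exprS (exprNn t m); ring.
rewrite (exprNn t m) -signr_odd -natr1; set u := t ^+ m in tm *.
have mu : 0 <= m%:R * u by rewrite mulr_ge0.
have mut : 0 <= m%:R * u * t by rewrite mulr_ge0.
have ut : 0 <= u * t by rewrite mulr_ge0.
have mut2 : 0 <= m%:R * u * t * t by rewrite mulr_ge0.
have ut2 : 0 <= u * t * t by rewrite mulr_ge0.
case: (odd m); rewrite ?expr0 ?expr1; nra.
Qed.

Lemma sum_geom_le (R : realFieldType) (t : R) m : 0 <= t < 1 ->
  \sum_(k < m) t ^+ k <= (1 - t)^-1.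
Proof.
move=> /andP[t0 t1]; rewrite -[leRHS]mul1r ler_pdivlMr ?subr_gt0 //.
have -> : (\sum_(k < m) t ^+ k) * (1 - t) = 1 - t ^+ m.
  by rewrite -{2}(expr1n R m) subrXX mulrC; congr (_ * _); apply: eq_bigr => i _; rewrite expr1n mul1r.
by rewrite gerBl exprn_ge0.
Qed.

Lemma sum_lin_le (R : realFieldType) (t : R) m : 0 <= t < 1 ->
  \sum_(k < m) k.+1%:R * t ^+ k <= (1 - t) ^- 2.
Proof.
move=> /andP[t0 t1]; have -> : \sum_(k < m) k.+1%:R * t ^+ k = \sum_(k < m) k.+1%:R * (- (- t)) ^+ k.
  by rewrite opprK.
rewrite sum_alt_lin; last by rewrite gt_eqF // subr_gt0.
have t1' : 0 <= 1 - t by rewrite subr_ge0 ltW.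
rewrite -{2}[_ ^- 2]mul1r opprK ler_wpM2r ?invr_ge0 ?exprn_ge0 //.
have tm : 0 <= t ^+ m by rewrite exprn_ge0.
rewrite exprS -natr1; have m0 : 0 <= m%:R :> R by [].
have : m%:R * (t * t ^+ m) <= m%:R * t ^+ m by rewrite ler_wpM2l // ler_piMl // ltW.
nra.
Qed.

Section Tauberian.
Variables (R : realType) (z kap : R) (phi : nat -> R).
Hypothesis kap0 : 0 <= kap.
Hypothesis phi_ge0 : forall n, 0 <= phi n.
Hypothesis phi0 : phi 0%N = 1.
Let ker k : R := z ^+ 2 * (-1) ^+ k * k.+1%:R + 3 + kap * (k == 1%N)%:R.
Hypothesis phi_rec : forall n,
  n.+1%:R * phi n.+1 <= \sum_(i < n.+1) ker (n - i) * phi i.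

Let sp n : {poly R} := \poly_(j < n.+1) phi j.

Let spE n t : (sp n).[t] = \sum_(j < n.+1) phi j * t ^+ j.
Proof. by rewrite horner_poly. Qed.

Let sp0 n : (sp n).[0] = 1.
Proof.
by rewrite spE big_ord_recl big1 ?addr0 /= ?expr0 ?mulr1 // => i _; rewrite exprS mul0r mulr0.
Qed.

(** Inserting the recurrence in the derivative gives a truncated Cauchy product; exchanging the sums
    attaches to each [i] a partial sum of the kernel series. *)
Let sp_deriv n (t : R) : 0 <= t ->
  (sp n)^`().[t] <= \sum_(i < n) phi i * t ^+ i * \sum_(k < n - i) ker k * t ^+ k.
Proof.
move=> t0.
have -> : (sp n)^`() = \poly_(j < n) (phi j.+1 *+ j.+1).
  apply/polyP => j; rewrite coef_deriv !coef_poly ltnS.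
  by case: ifP => // _; rewrite mul0rn.
rewrite horner_poly.
apply: (@le_trans _ _ (\sum_(j < n) \sum_(i < n | (i <= j)%N) phi i * t ^+ i * (ker (j - i) * t ^+ (j - i)))).
  apply: ler_sum => j _; rewrite -mulr_natl.
  have jn := ltn_ord j.
  apply: le_trans (ler_wpM2r (exprn_ge0 j t0) (phi_rec j)) _.
  rewrite mulr_suml (big_ord_widen _ (fun i => ker (j - i) * phi i * t ^+ j) jn).
  rewrite le_eqVlt; apply/orP; left; apply/eqP; apply: eq_big => // i.
  rewrite ltnS => ij; have -> : t ^+ j = t ^+ (j - i) * t ^+ i by rewrite -exprD subnK.
  ring.
rewrite (exchange_big_dep xpredT) //=; apply: ler_sum => i _.
rewrite -mulr_sumr ler_wpM2l ?mulr_ge0 ?exprn_ge0 //.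
rewrite -(big_mkord (fun j => i <= j)%N (fun j => ker (j - i) * t ^+ (j - i))).
rewrite -(big_mkord xpredT (fun k => ker k * t ^+ k)).
rewrite (big_cat_nat (n := i)) //=; last exact: ltnW.
rewrite big_nat_cond big1 ?add0r => [|j /andP[/andP[_ ji]]]; last by rewrite leqNgt ji.
rewrite -{1}(add0n (i : nat)) big_addn.
rewrite big_mkcond /=; under eq_bigr => j _ do rewrite leq_addl addnK.
exact: lexx.
Qed.

(** Chosen so that [ker k <= K * k.+1%:R]. *)
Let K : R := z ^+ 2 + 3 + kap.

Let K0 : 0 <= K. Proof. by rewrite /K !addr_ge0 ?sqr_ge0. Qed.

(* A bound uniform in [n], only used to show that truncating the convolution at
   order [n] costs an error vanishing as [n] grows. *)
Let crude n (y : R) : 0 <= y < 1 -> (sp n).[y] <= expR (K * (y / (1 - y))).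
Proof.
move=> /andP[y0 y1].
have := @gronwall R (fun t => (sp n).[t]) (fun t => (sp n)^`().[t])
  (fun t => K * (t / (1 - t))) (fun t => K * (1 - t) ^- 2) 0 y y0 (lexx 0).
rewrite /= !mul0r addr0 sp0 mulr1 mulr0; apply.
- by move=> t _; exact: is_derive_poly.
- move=> t /andP[t0 ty]; have t1 : 1 - t != 0 by rewrite gt_eqF // subr_gt0 (le_lt_trans ty).
  have d1 : is_derive t 1 (fun t : R => (1 - t)^-1) ((1 - t) ^- 2).
    have d0 : is_derive t 1 (fun t : R => 1 - t) (-1).
      by apply: is_derive_eq; ring.
    by have := @is_derive_inv R (fun t => 1 - t) t (-1) t1 d0; rewrite mulrN1 opprK.
  apply: is_derive_eq; rewrite /GRing.scale /=; field => //.
- move=> t /andP[t0 ty].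
  have t1 : 0 <= 1 - t by rewrite subr_ge0 ltW // (le_lt_trans ty).
  by rewrite mulr_ge0 ?divr_ge0.
- by [].
- move=> t /andP[t0 ty]; have t1 : t < 1 by exact: le_lt_trans y1.
  rewrite addr0; apply: le_trans (sp_deriv n t0) _.
  rewrite spE mulr_sumr big_ord_recr /= ler_wpDr ?mulr_ge0 ?invr_ge0 ?exprn_ge0 ?subr_ge0 ?(ltW t1) //.
  apply: ler_sum => i _; rewrite mulrC ler_wpM2r ?mulr_ge0 ?exprn_ge0 //.
  apply: (@le_trans _ _ (\sum_(k < n - i) K * (k.+1%:R * t ^+ k))).
    apply: ler_sum => k _; rewrite mulrA ler_wpM2r ?exprn_ge0 // /ker /K.
    have k1 : 1 <= k.+1%:R :> R by rewrite ler1n.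
    have s1 : (-1) ^+ k <= 1 :> R by rewrite -signr_odd; case: odd; rewrite ?expr0 ?expr1; lra.
    have e1 : (k == 1%N :> nat)%:R <= 1 :> R by case: eqP.
    have := ler_wpM2l (sqr_ge0 z) (ler_wpM2r (ler0n R k.+1) s1).
    have := ler_wpM2l kap0 e1; have := ler_wpM2l kap0 k1.
    rewrite !mulrDl -!mulrA; nra.
  by rewrite -mulr_sumr ler_wpM2l // sum_lin_le // t0.
Qed.

(** The primitive, zero at 0, of the generating function of [ker]. *)
Let logbound (t : R) := z ^+ 2 * (t / (1 + t)) + (kap / 2 * t ^+ 2 - 3 * ln (1 - t)).

Let ker_sum_le m (t : R) : 0 <= t < 1 -> \sum_(k < m) ker k * t ^+ k <=
  z ^+ 2 * ((1 + t) ^- 2 + m.+1%:R * t ^+ m) + (kap * t + 3 / (1 - t)).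
Proof.
move=> /andP[t0 t1].
have h1 := @sum_alt_lin_le R t m; rewrite t0 ltW // in h1.
have h2 := @sum_geom_le R t m; rewrite t0 t1 in h2.
have -> : \sum_(k < m) ker k * t ^+ k = z ^+ 2 * (\sum_(k < m) k.+1%:R * (- t) ^+ k)
    + (kap * (\sum_(k < m) ((k : nat) == 1%N)%:R * t ^+ k) + 3 * \sum_(k < m) t ^+ k).
  rewrite !mulr_sumr -!big_split; apply: eq_bigr => k _ /=.
  by rewrite /ker (exprNn t k); ring.
rewrite lerD ?ler_wpM2l ?sqr_ge0 ?h1 // lerD ?ler_wpM2l ?h2 //.
case: m {h1 h2} => [|[|m]]; first by rewrite big_ord0.
  by rewrite big_ord1 mul0r.
rewrite 2!big_ord_recl big1 /= ?mul0r ?add0r ?mul1r ?addr0 // => i _.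
by rewrite mul0r.
Qed.

(** Cutting the alternating series after [m] terms costs at most [(m + 1) t^m]. As [y] lies strictly
    between [x] and 1, [x^n] is at most [(x / y)^n y^i], and the crude bound at [y] controls the sum
    over [i]. The error then decays geometrically in [n]. *)
Let sp_tail (x : R) (y := (1 + x) / 2) n (t : R) : 0 < x < 1 -> 0 <= t <= x ->
  (sp n)^`().[t] <= (z ^+ 2 * (1 + t) ^- 2 + (kap * t + 3 / (1 - t))) * (sp n).[t]
    + z ^+ 2 * expR (K * (y / (1 - y))) * (n.+1%:R * (x / y) ^+ n).
Proof.
move=> /andP[x0 x1] /andP[t0 tx].
have t1 : t < 1 by exact: le_lt_trans x1.
have y01 : 0 < y < 1 by rewrite /y; lra.
have [y0 y1] := andP y01.
have q0 : 0 <= (1 + t) ^- 2 by rewrite invr_ge0 exprn_ge0 // addr_ge0.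
have q1 : 0 <= 3 / (1 - t) by rewrite divr_ge0 // subr_ge0 ltW.
set Rt := _ + (kap * t + _).
have Rt0 : 0 <= Rt.
  by apply: addr_ge0; [exact: mulr_ge0 (sqr_ge0 z) q0|apply: addr_ge0; [exact: mulr_ge0|exact: q1]].
apply: le_trans (sp_deriv n t0) _.
apply: (@le_trans _ _ (\sum_(i < n) (Rt * (phi i * t ^+ i) +
    z ^+ 2 * n.+1%:R * (x / y) ^+ n * (phi i * y ^+ i)))).
  apply: ler_sum => i _.
  have h := ker_sum_le (n - i)%N (t := t); rewrite t0 t1 in h.
  have p0 : 0 <= phi i * t ^+ i by rewrite mulr_ge0 ?exprn_ge0.
  apply: le_trans (ler_wpM2l p0 (h isT)) _.
  have -> : phi i * t ^+ i * (z ^+ 2 * ((1 + t) ^- 2 + (n - i).+1%:R * t ^+ (n - i)) +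
      (kap * t + 3 / (1 - t))) = Rt * (phi i * t ^+ i) +
      z ^+ 2 * phi i * ((n - i).+1%:R * (t ^+ i * t ^+ (n - i))) by rewrite /Rt; ring.
  rewrite lerD2l -exprD subnKC ?(ltnW (ltn_ord i)) //.
  have -> : z ^+ 2 * n.+1%:R * (x / y) ^+ n * (phi i * y ^+ i) =
    z ^+ 2 * phi i * (n.+1%:R * ((x / y) ^+ n * y ^+ i)) by ring.
  rewrite ler_wpM2l ?(mulr_ge0 (sqr_ge0 z) (phi_ge0 i)) // ler_pM ?exprn_ge0 //.
    by rewrite ler_nat ltnS leq_subr.
  apply: (@le_trans _ _ (x ^+ n)); first by rewrite lerXn2r ?nnegrE // (le_trans t0).
  have -> : (x / y) ^+ n * y ^+ i = x ^+ n * (y ^+ i / y ^+ n).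
    by rewrite expr_div_n; ring.
  rewrite ler_peMr ?exprn_ge0 ?(ltW x0) // ler_pdivlMr ?exprn_gt0 // mul1r.
  by rewrite ler_wiXn2l ?(ltW y0) ?(ltW y1) ?(ltnW (ltn_ord i)).
rewrite big_split /= -!mulr_sumr.
have sub (s : R) : 0 <= s -> \sum_(i < n) phi i * s ^+ i <= (sp n).[s].
  by move=> s0; rewrite spE big_ord_recr /= lerDl mulr_ge0 ?exprn_ge0.
rewrite lerD ?ler_wpM2l ?sub //.
have -> : z ^+ 2 * expR (K * (y / (1 - y))) * (n.+1%:R * (x / y) ^+ n) =
  z ^+ 2 * n.+1%:R * (x / y) ^+ n * expR (K * (y / (1 - y))) by ring.
have xy0 : 0 <= (x / y) ^+ n by rewrite exprn_ge0 // divr_ge0 ?(ltW x0) ?(ltW y0).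
have z20 := sqr_ge0 z.
apply: ler_wpM2l; first exact: mulr_ge0 (mulr_ge0 z20 (ler0n _ _)) xy0.
apply: le_trans (sub _ (ltW y0)) _; apply: crude; by rewrite ltW.
Qed.

Lemma phi_sum_le N (x : R) : 0 < x < 1 ->
  \sum_(j < N.+1) phi j * x ^+ j <=
  expR (z ^+ 2 * (x / (1 + x)) + (kap / 2 * x ^+ 2 - 3 * ln (1 - x))).
Proof.
move=> x01; have [x0 x1] := andP x01; rewrite -/(logbound x).
pose y := (1 + x) / 2.
have y01 : x < y < 1 by rewrite /y; lra.
have [xy y1] := andP y01; have y0 : 0 < y := lt_trans x0 xy.
pose C := expR (logbound x) * (z ^+ 2 * expR (K * (y / (1 - y))) * x).
have z20 := sqr_ge0 z.
have C0 : 0 <= C.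
  apply: mulr_ge0; first exact: expR_ge0.
  exact: mulr_ge0 (mulr_ge0 z20 (expR_ge0 _)) (ltW x0).
have main n : (N <= n)%N -> \sum_(j < N.+1) phi j * x ^+ j <=
    expR (logbound x) + C * (n.+1%:R * (x / y) ^+ n).
  move=> Nn; apply: (@le_trans _ _ (sp n).[x]).
    rewrite spE (big_ord_widen n.+1 (fun j => phi j * x ^+ j)) //.
    rewrite [leRHS](bigID (fun j : 'I_n.+1 => j < N.+1)%N) /= lerDl.
    by rewrite sumr_ge0 // => j _; rewrite mulr_ge0 ?exprn_ge0 ?(ltW x0).
  have := @gronwall R (fun t => (sp n).[t]) (fun t => (sp n)^`().[t]) logbound
    (fun t => z ^+ 2 * (1 + t) ^- 2 + (kap * t + 3 / (1 - t)))
    (z ^+ 2 * expR (K * (y / (1 - y))) * (n.+1%:R * (x / y) ^+ n)) x (ltW x0).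
  rewrite sp0 => h; apply: le_trans (h _ _ _ _ _ _) _.
  - have xy0 : 0 <= (x / y) ^+ n by rewrite exprn_ge0 // divr_ge0 ?(ltW x0) ?(ltW y0).
    exact: mulr_ge0 (mulr_ge0 z20 (expR_ge0 _)) (mulr_ge0 (ler0n _ _) xy0).
  - by move=> t _; exact: is_derive_poly.
  - move=> t /andP[t0 tx].
    have t1 : 0 < 1 - t by rewrite subr_gt0 (le_lt_trans tx).
    have t2 : 1 + t != 0 by rewrite gt_eqF // ltr_wpDr.
    have d0 : is_derive t 1 (fun t : R => 1 + t) 1 by apply: is_derive_eq; ring.
    have d1 := @is_derive_inv R (fun t => 1 + t) t 1 t2 d0.
    have d2 : is_derive t 1 (fun t : R => 1 - t) (-1) by apply: is_derive_eq; ring.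
    have d3 : is_derive t 1 (fun t => ln (1 - t)) ((1 - t)^-1 * -1).
      by apply: (@is_derive1_comp R (@ln R) (fun t => 1 - t)); exact: is_derive1_ln.
    apply: is_derive_eq; rewrite /GRing.scale /= /GRing.scale /=.
    by field; rewrite t2 gt_eqF.
  - move=> t /andP[t0 tx].
    have t1 : 0 < 1 - t by rewrite subr_gt0 (le_lt_trans tx).
    have l0 : ln (1 - t) <= 0 by apply: ln_le0; rewrite gerBl.
    have h1 : 0 <= z ^+ 2 * (t / (1 + t)) by rewrite mulr_ge0 // divr_ge0 // addr_ge0.
    have h2 : 0 <= kap / 2 * t ^+ 2 by rewrite mulr_ge0 ?divr_ge0 ?sqr_ge0.
    by rewrite /logbound; lra.
  - by rewrite /logbound mul0r expr0n subr0 ln1 /=; ring.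
  - by move=> t tx; exact: sp_tail.
  by rewrite /C le_eqVlt; apply/orP; left; apply/eqP; ring.
rewrite leNgt; apply/negP => lt.
(* A gap [d > 0] would lie below the error for every [n >= N]. The errors are summable, so [m]
   copies of [d] would stay below a fixed constant for every [m]. *)
pose d := \sum_(j < N.+1) phi j * x ^+ j - expR (logbound x).
have d0 : 0 < d by rewrite subr_gt0.
have q01 : 0 <= x / y < 1 by rewrite divr_ge0 ?(ltW x0) ?(ltW y0) //= ltr_pdivrMr // mul1r.
have bnd m : m%:R * d <= C * (1 - x / y) ^- 2.
  have h : C * (\sum_(k < N + m) k.+1%:R * (x / y) ^+ k) <= C * (1 - x / y) ^- 2.
    by rewrite ler_wpM2l // sum_lin_le.
  apply: le_trans h; rewrite big_split_ord /= [leRHS]mulrDr.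
  have h0 : 0 <= C * (\sum_(i < N) i.+1%:R * (x / y) ^+ i).
    apply: mulr_ge0 => //; apply: sumr_ge0 => i _; apply: mulr_ge0 => //.
    by apply: exprn_ge0; case/andP: q01.
  rewrite ler_wpDl // mulr_sumr -[m in leLHS]card_ord mulr_natl -sumr_const.
  by apply: ler_sum => i _; rewrite lerBlDl; apply: main; exact: leq_addr.
pose M := Num.truncn (C * (1 - x / y) ^- 2 / d).
have := bnd M.+1; rewrite -ler_pdivlMr // leNgt.
by rewrite truncnS_gt.
Qed.

End Tauberian.

(** * Growth of Hermite polynomials *)

Section LnBounds.
Variable R : realType.

Lemma ln_le_sub1 (t : R) : 0 < t -> ln t <= t - 1.
Proof.
by move=> t0; have := @le_ln1Dx R (t - 1); rewrite subrKC; apply; lra.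
Qed.

Lemma ln_ge_sub1V (t : R) : 0 < t -> 1 - t^-1 <= ln t.
Proof.
move=> t0; have := @ln_le_sub1 t^-1; rewrite invr_gt0 lnV ?posrE // => /(_ t0).
lra.
Qed.

(** The Padé bound, exact to second order at 1. This precision is used for Stirling's upper bound
    and for [edge_int_le], which has no error term. *)
Lemma ln_ge_pade (r : R) : 1 <= r -> 2 * (r - 1) <= (r + 1) * ln r.
Proof.
move=> r1.
have := @is_derive_le R (fun t => 2 * (t - 1) - (t + 1) * ln t)
  (fun t => 2 - (ln t + (t + 1) / t)) 1 r r1.
rewrite subrr ln1 !mulr0 subr0 subr_le0; apply.
  move=> t /andP[t1 _]; have t0 : 0 < t by exact: lt_le_trans t1.
  have dl := is_derive1_ln t0.
  by apply: is_derive_eq; rewrite /GRing.scale /=; ring.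
move=> t /andP[t1 _]; have t0 : 0 < t by exact: lt_le_trans t1.
have := ln_ge_sub1V t0; rewrite mulrDl divff ?gt_eqF // mul1r.
lra.
Qed.

Lemma ln_fact_ge n : n%:R * ln n%:R - n%:R <= ln n`!%:R :> R.
Proof.
elim: n => [|n IH]; first by rewrite fact0 ln1 mul0r subr0.
have n0 : 0 < n.+1%:R :> R by [].
rewrite factS natrM lnM ?posrE // ?ltr0n ?fact_gt0 //.
have [->|npos] := posnP n; first by rewrite ?fact0 ?ln1; lra.
have k0 : 0 < n%:R :> R by rewrite ltr0n.
have := @ln_le_sub1 (n.+1%:R / n%:R); rewrite divr_gt0 // => /(_ isT).
rewrite ln_div ?posrE // => h.
have := ler_wpM2l (ltW k0) h.
have -> : n%:R * (n.+1%:R / n%:R - 1) = 1 :> R.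
  by rewrite -natr1; field; rewrite gt_eqF.
rewrite -natr1; lra.
Qed.

Lemma ln_fact_le n : (0 < n)%N ->
  ln n`!%:R <= 1 + ln n.+1%:R + n%:R * ln n%:R - n%:R :> R.
Proof.
elim: n => // n IH _.
have n0 : 0 < n.+1%:R :> R by [].
rewrite factS natrM lnM ?posrE // ?ltr0n ?fact_gt0 //.
have [->|npos] := posnP n.
  by rewrite ?fact0 ?ln1; have := @ln_ge0 R 2; rewrite ler1n => /(_ isT); lra.
have k0 : 0 < n%:R :> R by rewrite ltr0n.
have k1 : 1 <= n%:R :> R by rewrite ler1n.
have h1 : 2 <= (2 * n%:R + 1) * (ln n.+1%:R - ln n%:R) :> R.
  have := @ln_ge_pade (n.+1%:R / n%:R).
  rewrite ler_pdivlMr // mul1r ler_nat leqnSn ln_div ?posrE // => /(_ isT).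
  move/(ler_wpM2l (ltW k0)); rewrite !mulrA.
  have -> : n%:R * 2 * (n.+1%:R / n%:R - 1) = 2 :> R.
    by rewrite -natr1; field; rewrite gt_eqF.
  have -> : n%:R * (n.+1%:R / n%:R + 1) = 2 * n%:R + 1 :> R.
    by rewrite -natr1; field; rewrite gt_eqF.
  by [].
have h2 : 1 <= (n%:R + 2) * (ln n.+2%:R - ln n.+1%:R) :> R.
  have := @ln_ge_sub1V (n.+2%:R / n.+1%:R); rewrite divr_gt0 // => /(_ isT).
  have p2 : 0 <= n%:R + 2 :> R by rewrite addr_ge0.
  rewrite ln_div ?posrE // => /(ler_wpM2l p2).
  have -> : (n%:R + 2) * (1 - (n.+2%:R / n.+1%:R)^-1) = 1 :> R.
    have -> : n.+2%:R = n%:R + 2 :> R by rewrite -natr1 -natr1; ring.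
    rewrite -natr1; field.
    by rewrite !gt_eqF ?addr_gt0.
  by [].
set l := ln n.+1%:R - _ in h1; set a := ln n.+2%:R - _ in h2.
have l1 : 2 / (2 * n%:R + 1) <= l.
  by rewrite ler_pdivrMr ?addr_gt0 ?mulr_gt0 // mulrC.
have a1 : (n%:R + 2)^-1 <= a by rewrite -div1r ler_pdivrMr ?addr_gt0 // mulrC.
(* The bound on [n * l] falls short of 1 by [1 / (2 n + 1)]; the growth of the correction
   [ln n.+1%:R] makes up for it. *)
have : 1 <= n%:R * (2 / (2 * n%:R + 1)) + (n%:R + 2)^-1 :> R.
  rewrite -subr_ge0.
  have -> : n%:R * (2 / (2 * n%:R + 1)) + (n%:R + 2)^-1 - 1 =
      (n%:R - 1) / ((2 * n%:R + 1) * (n%:R + 2)) :> R.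
    by field; rewrite !gt_eqF ?addr_gt0 ?mulr_gt0.
  by rewrite divr_ge0 ?subr_ge0 // mulr_ge0 // addr_ge0 // mulr_ge0.
have := ler_wpM2l (ltW k0) l1.
have := IH npos; rewrite /l /a in a1 *.
move: (ln n.+1%:R) (ln n.+2%:R) a1 => L1 L2 a1; rewrite -natr1; nra.
Qed.
End LnBounds.

Section HermiteGrowth.
Variables (R : realType) (z : R).
Hypothesis z0 : 0 < z.
Notation He := (hermite z).

(* The larger root of ['X^2 - z 'X + t], which approximates the ratio
   [He k.+1 / He k] for [k] close to [t]. *)
Definition edge (t : R) := (z + Num.sqrt (z ^+ 2 - 4 * t)) / 2.

Lemma edge_ge t : z / 2 <= edge t.
Proof. by rewrite /edge ler_pM2r // lerDl sqrtr_ge0. Qed.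

Lemma edge_gt0 t : 0 < edge t.
Proof. by apply: lt_le_trans (edge_ge t); rewrite divr_gt0. Qed.

Lemma edge_root t : 4 * t <= z ^+ 2 -> edge t * (z - edge t) = t.
Proof.
move=> tz; have := @sqr_sqrtr R (z ^+ 2 - 4 * t).
rewrite subr_ge0 => /(_ tz); rewrite /edge; set s := Num.sqrt _ => sE.
have -> : (z + s) / 2 * (z - (z + s) / 2) = (z ^+ 2 - s ^+ 2) / 4 by field.
by rewrite sE; field.
Qed.

Lemma edge0 : edge 0 = z.
Proof. by rewrite /edge mulr0 subr0 sqrtr_sqr gtr0_norm //; field. Qed.

Lemma edge_anti s t : s <= t -> edge t <= edge s.
Proof.
by move=> st; rewrite /edge ler_pM2r // lerD2l ler_wsqrtr // lerB // ler_wpM2l.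
Qed.

Definition edge_int (t : R) := t * ln (edge t) - z * edge t + edge t ^+ 2 / 2.

(* [edge_int] is a primitive of the decreasing function [ln (edge t)]. *)
Lemma edge_int_le s t : 0 <= t -> s <= t -> 4 * t <= z ^+ 2 ->
  edge_int t - edge_int s <= (t - s) * ln (edge s).
Proof.
move=> t0 st tz; rewrite /edge_int.
have tE := edge_root tz.
have sE := @edge_root s (le_trans (ler_wpM2l (ler0n _ 4) st) tz).
have nu0 := edge_gt0 t; have mu0 := edge_gt0 s.
have nu1 := edge_ge t; have mu1 := edge_ge s.
have munu := edge_anti st.
set m := edge s in sE mu0 mu1 munu *; set n := edge t in tE nu0 nu1 munu *.
have := @ln_ge_pade R (m / n); rewrite ler_pdivlMr // mul1r => /(_ munu).
rewrite ln_div ?posrE // => h.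
have h1 : 2 * (m - n) <= (m + n) * (ln m - ln n).
  have -> : 2 * (m - n) = n * (2 * (m / n - 1)) by field; rewrite gt_eqF.
  have -> : (m + n) * (ln m - ln n) = n * ((m / n + 1) * (ln m - ln n)).
    by field; rewrite gt_eqF.
  by rewrite ler_wpM2l // ltW.
rewrite -subr_ge0.
have -> : (t - s) * ln m - (t * ln n - z * n + n ^+ 2 / 2 -
    (s * ln m - z * m + m ^+ 2 / 2)) =
    t * (ln m - ln n) - (m - n) * (z - (m + n) / 2) by field.
have zn : 0 <= z - n by rewrite -(pmulr_rge0 _ nu0) tE.
rewrite -tE; set l := ln m - ln n in h1 *.
have mn0 : 0 < m + n by rewrite addr_gt0.
have l1 : 2 * (m - n) / (m + n) <= l by rewrite ler_pdivrMr // [leRHS]mulrC.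
have := ler_wpM2l (mulr_ge0 (ltW nu0) zn) l1.
suff : (m - n) * (z - (m + n) / 2) <= n * (z - n) * (2 * (m - n) / (m + n)) by lra.
(* The difference factors, and the last factor is nonnegative because [m] and [n] are both at least
   [z / 2]. *)
rewrite mulrA ler_pdivlMr // -subr_ge0.
have -> : n * (z - n) * (2 * (m - n)) - (m - n) * (z - (m + n) / 2) * (m + n) =
   (m - n) ^+ 2 * ((m + 3 * n) / 2 - z) by field.
by rewrite mulr_ge0 ?sqr_ge0 //; lra.
Qed.

(** Induction on the ratio: it maps to [z - k.+1 / ratio], which is increasing in the ratio and
    fixes [edge k.+1]; and [edge] decreases in its argument. *)
Lemma hermite_ratio k : 4 * k%:R <= z ^+ 2 ->
  0 < He k /\ edge k%:R * He k <= He k.+1.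
Proof.
elim: k => [|k IH] kz; first by rewrite hermite0 hermite1 edge0 mulr1.
have [//|hk hk1] := IH.
  by apply: le_trans kz; rewrite ler_wpM2l // ler_nat.
have ek := edge_gt0 k%:R; have ek1 := edge_gt0 k.+1%:R.
have hk1p : 0 < He k.+1 by apply: lt_le_trans hk1; rewrite mulr_gt0.
split => //; rewrite hermiteSS.
have e1 : edge k.+1%:R <= edge k%:R by apply: edge_anti; rewrite ler_nat.
have h : edge k.+1%:R * He k <= He k.+1.
  by apply: le_trans hk1; rewrite ler_wpM2r // ltW.
have rE := edge_root kz; have : 0 <= z - edge k.+1%:R.
  by rewrite -(@pmulr_rge0 _ (edge k.+1%:R)) // rE.
rewrite -{3}rE; nra.
Qed.

(** The product of the ratios, compared with the integral of [ln (edge t)]; the constant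
    [z ^+ 2 / 2] is [- edge_int 0]. *)
Lemma ln_hermite_ge k : 4 * k%:R <= z ^+ 2 ->
  0 < He k /\ edge_int k%:R + z ^+ 2 / 2 <= ln (He k).
Proof.
elim: k => [|k IH] kz.
  split; first by rewrite hermite0.
  by rewrite hermite0 ln1 /edge_int edge0 mul0r; lra.
have kz' : 4 * k%:R <= z ^+ 2 by apply: le_trans kz; rewrite ler_wpM2l // ler_nat.
have [hk0 hk] := IH kz'; have [hk1 _] := hermite_ratio kz.
split => //; have [_ r] := hermite_ratio kz'.
have : ln (edge k%:R * He k) <= ln (He k.+1).
  by rewrite ler_ln ?posrE // mulr_gt0 // edge_gt0.
rewrite lnM ?posrE ?edge_gt0 //.
have := @edge_int_le k%:R k.+1%:R (ler0n _ _) _ kz; rewrite ler_nat leqnSn => /(_ isT).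
rewrite -natr1 [k%:R + 1 - _]addrAC subrr add0r mul1r.
lra.
Qed.

(** The real parameter [t] is later the turning point or [N], where [edge_int] is explicit, while
    [k] is an integer close below. Moving from [k] to [t] costs at most [4 * ln z]; the rest of the
    error is Stirling's. *)
Lemma hermite_sqr_fact_ge k (t : R) : 1 <= z -> (0 < k)%N ->
  k%:R <= t <= k%:R + 2 -> 4 * t <= z ^+ 2 ->
  2 * edge_int t + z ^+ 2 - (t * ln t - t) <=
  ln (He k ^+ 2 / k`!%:R) + (4 * ln z + ln k.+1%:R + 1).
Proof.
move=> z1 k0 /andP[kt tk] tz.
have kR : 0 < k%:R :> R by rewrite ltr0n.
have t0 : 0 < t by exact: lt_le_trans kt.
have kz : 4 * k%:R <= z ^+ 2 by apply: le_trans tz; rewrite ler_wpM2l.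
have [hk0 hk] := ln_hermite_ge kz.
rewrite ln_div ?posrE ?exprn_gt0 ?ltr0n ?fact_gt0 // lnXn // -mulr_natl.
have h1 := edge_int_le (ltW t0) kt tz.
have h2 : (t - k%:R) * ln (edge k%:R) <= 2 * ln z.
  have : ln (edge k%:R) <= ln z.
    by rewrite ler_ln ?posrE ?edge_gt0 // -edge0 edge_anti ?ler0n.
  have := ln_ge0 z1; nra.
have h3 := @ln_fact_le R k k0.
have h4 : k%:R * ln k%:R - k%:R <= t * ln t - t.
  have := @ln_ge_sub1V R (t / k%:R); rewrite divr_gt0 // => /(_ isT).
  rewrite ln_div ?posrE // => /(ler_wpM2l (ltW t0)).
  have -> : t * (1 - (t / k%:R)^-1) = t - k%:R by field; rewrite !gt_eqF.
  have : 0 <= ln (k%:R : R) by apply: ln_ge0; rewrite ler1n.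
  nra.
lra.
Qed.

End HermiteGrowth.

(** * Reduction to Bernoulli variables *)

(** The events [A b] are disjoint and their probabilities add up to 1, so their union carries all
    the mass; the integrand is constant on each. *)
Lemma integral_independent_finite (d : measure_display) (T : measurableType d)
    (R : realType) (P : probability T R) (I S : finType) (X : I -> T -> R)
    (pr v : S -> R) (G : (I -> R) -> R) :
  (forall i, measurable_fun setT (X i)) -> mutually_independent P X ->
  injective v -> (forall s, 0 <= pr s) -> \sum_s pr s = 1 ->
  (forall i s, P (X i @^-1` [set v s]) = (pr s)%:E) ->
  (forall y, 0 <= G y) -> measurable_fun setT (fun w => G (X ^~ w)) ->
  (\int[P]_w (G (X ^~ w))%:E = (Ef pr (fun b : {ffun I -> S} => G (v \o b)))%:E)%E.
Proof.
move=> mX indX vI pr0 pr1 PX G0 mG.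
pose A (b : {ffun I -> S}) := \bigcap_(i in [set` [set: I]%SET]) X i @^-1` [set v (b i)].
have AE b w : A b w <-> forall i, X i w = v (b i).
  by split=> [h i|h i _]; [apply: h; rewrite /= inE|exact: h].
have mA b : measurable (A b).
  apply: fin_bigcap_measurable; first exact: finite_finset.
  by move=> i _; rewrite -[X in measurable X]setTI; apply: mX.
have PA b : P (A b) = (\prod_i pr (b i))%:E.
  rewrite /A (indX [set: I]%SET (fun i => [set v (b i)])) // -prodEFin.
  by apply: eq_big => [i|i _]; [rewrite inE|rewrite PX].
have tA : trivIset setT A.
  move=> b b' _ _ [w [/AE h /AE h']].
  by apply/ffunP => i; apply: vI; rewrite -h -h'.
pose D := \big[setU/set0]_(b <- enum {ffun I -> S}) A b.
have mD : measurable D by apply: bigsetU_measurable.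
have mGD E : measurable_fun E (EFin \o (fun w => G (X ^~ w))).
  by apply: (measurable_funS measurableT) => //; exact/measurable_EFinP.
have PD : P D = 1%E.
  rewrite -[LHS]mul1e -integral_cst // (ge0_integral_bigsetU P mA) ?enum_uniq //.
    rewrite big_enum /=.
    under eq_bigr => b _ do rewrite integral_cst // mul1e.
    rewrite (eq_bigr _ (fun b _ => PA b)) sumEFin; congr EFin.
    by rewrite -(bigA_distr_bigA (fun (_ : I) s => pr s)) big1.
  exact: sub_trivIset tA.
have PnD : P (~` D) = 0%E by rewrite probability_setC // PD subee.
rewrite (@ge0_negligible_integral _ _ _ _ setT (~` D)) //; last 2 first.
- exact: measurableC.
- by move=> w _; rewrite lee_fin.
rewrite setDE setCK setTI (ge0_integral_bigsetU P mA) ?enum_uniq //; last 2 first.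
- exact: sub_trivIset tA.
- by move=> w _; rewrite lee_fin.
rewrite big_enum /= /Ef -sumEFin; apply: eq_bigr => b _.
rewrite EFinM -PA muleC -integral_cst //; apply: eq_integral => w.
rewrite inE => /AE h; congr (G _)%:E; apply/funext => i; exact: h.
Qed.

Section Bernoulli.
Variables (R : realType) (p : R).
Hypothesis p01 : 0 < p < 1.
Let s := Num.sqrt (p * (1 - p)).

Definition bern_pr (b : bool) : R := if b then p else 1 - p.
Definition bern_std (b : bool) : R := (if b then 1 - p else - p) / s.

Let p0 : 0 < p. Proof. by case/andP: p01. Qed.
Let q0 : 0 < 1 - p. Proof. by case/andP: p01; rewrite subr_gt0. Qed.
Let pq0 : 0 < p * (1 - p). Proof. by rewrite mulr_gt0. Qed.
Let s0 : 0 < s. Proof. by rewrite sqrtr_gt0. Qed.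
Let s2 : s ^+ 2 = p * (1 - p). Proof. by rewrite sqr_sqrtr ?ltW. Qed.
Notation Em := (Ex bern_pr (scal1 bern_std)).

Lemma bern_pr_sum : \sum_b bern_pr b = 1.
Proof. by rewrite big_bool /bern_pr /=; ring. Qed.

Lemma bern_pr_ge0 b : 0 <= bern_pr b.
Proof. by case: b; rewrite /bern_pr ltW. Qed.

Lemma bern_m1 : Em id = 0.
Proof.
rewrite Em_sum big_bool /bern_pr /bern_std /=; field.
by rewrite gt_eqF.
Qed.

Lemma bern_m2 : Em (fun a => a ^+ 2) = 1.
Proof.
rewrite Em_sum big_bool /bern_pr /bern_std /= !exprMn exprVn s2; field.
by rewrite !gt_eqF.
Qed.

(** In the sparse regime this is large; it is how sparsity enters the second-moment bound. *)
Lemma bern_m4 : 0 <= Em (fun a => a ^+ 4) <= (p * (1 - p))^-1.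
Proof.
rewrite Em_sum big_bool /bern_pr /bern_std /= !exprMn exprVn.
rewrite (_ : s ^+ 4 = (p * (1 - p)) ^+ 2); last by rewrite -s2 -exprM.
apply/andP; split.
  rewrite exprNn -signr_odd /= mul1r.
  by rewrite addr_ge0 // mulr_ge0 ?(ltW p0) ?(ltW q0) // divr_ge0 ?exprn_ge0 ?(ltW p0) ?(ltW q0) ?(ltW pq0).
have -> : p * ((1 - p) ^+ 4 / (p * (1 - p)) ^+ 2) + (1 - p) * ((- p) ^+ 4 / (p * (1 - p)) ^+ 2)
   = ((1 - p) ^+ 3 + p ^+ 3) * (p * (1 - p))^-1 by field; rewrite !gt_eqF.
rewrite ler_piMl ?invr_ge0 ?(ltW pq0) //.
by have := p0; have := q0; nra.
Qed.

(** The two values of the entry differ by [1 / s] and each has probability at least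
    [Num.min p (1 - p)]; the triangle inequality eliminates [Q]. *)
Lemma bern_spread (D Q : R) :
  Num.min p (1 - p) / s * `|D| <= Em (fun a => `|a * D - Q|).
Proof.
rewrite Em_sum big_bool /=; set c := Num.min p (1 - p).
have c0 : 0 <= c by rewrite le_min (ltW p0) (ltW q0).
have h b : c * `|bern_std b * D - Q| <= bern_pr b * `|bern_std b * D - Q|.
  by rewrite ler_wpM2r // /c; case: b; rewrite /bern_pr ge_min lexx ?orbT.
apply: le_trans (lerD (h true) (h false)); rewrite -mulrDr -mulrA ler_wpM2l //.
have -> : s^-1 * `|D| = `|(bern_std true * D - Q) - (bern_std false * D - Q)|.
  transitivity `|s^-1 * D|; first by rewrite normrM gtr0_norm ?invr_gt0.
  by congr `|_|; rewrite /bern_std /=; ring.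
exact: ler_normB.
Qed.

End Bernoulli.

Section ErdosRenyi.
Variables (R : realType) (N : nat) (p E : R).
Hypothesis p01 : 0 < p < 1.
Hypothesis N0 : (0 < N)%N.

Definition up_pair (i j : 'I_N) : 'I_N * 'I_N := if (i <= j)%N then (i, j) else (j, i).

Lemma up_pairP (i j : 'I_N) : ((up_pair i j).1 <= (up_pair i j).2)%N.
Proof. by rewrite /up_pair; case: ifP => //= /negbT; rewrite -ltnNge => /ltnW. Qed.

Definition up_index (i j : 'I_N) : upper_index N := Sub (up_pair i j) (up_pairP i j).

(** Bridge between the two encodings of the entries: ordered pairs [i <= j] in the hypothesis on
    [H], unordered pairs as sets in [symx]. *)
Definition pair_set (k : upper_index N) : {set 'I_N} := [set (val k).1; (val k).2]%SET.

Lemma pair_set_inj : injective pair_set.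
Proof.
move=> [[a b] /= ab] [[c d] /= cd] /setP h; apply: val_inj => /=.
have := h a; have := h b; have := h c; have := h d.
rewrite !inE /= !eqxx !orbT -!(inj_eq val_inj) /= => /eqP h1 /eqP h2 /eqP h3 /eqP h4.
by congr pair; apply: val_inj => /=; lia.
Qed.

Lemma pair_set_up i j : pair_set (up_index i j) = [set i; j]%SET.
Proof. by rewrite /pair_set /= /up_pair; case: ifP => //= _; rewrite finset.setUC. Qed.

Lemma expectation_erdos_renyi (d : measure_display) (T : measurableType d)
    (P : probability T R) (H : T -> 'M[R]_N) :
  rescaled_erdos_renyi P p H ->
  ('E_P[fun w => `|\det (H w - E%:M)|%R])%E =
  (Num.sqrt N%:R ^- N * Ex (bern_pr p) (@symx R bool (bern_std p) N)
    (fun W => `|sdet (E * Num.sqrt N%:R) (p / Num.sqrt (p * (1 - p))) W|))%:E.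
Proof.
have [p0 p1] := andP p01; have q0 : 0 < 1 - p by rewrite subr_gt0.
move=> [mH sH indH PH].
have NR : 0 < N%:R :> R by rewrite ltr0n.
have sN0 : 0 < Num.sqrt N%:R :> R by rewrite sqrtr_gt0.
have pq0 : 0 < p * (1 - p) by rewrite mulr_gt0.
have s0 : 0 < Num.sqrt (p * (1 - p)) by rewrite sqrtr_gt0.
pose v b := if b then 1 / Num.sqrt (N%:R * p * (1 - p)) else 0 : R.
have vE : Num.sqrt (N%:R * p * (1 - p)) = Num.sqrt N%:R * Num.sqrt (p * (1 - p)).
  by rewrite -mulrA sqrtrM // ltW.
pose G (y : upper_index N -> R) :=
  `|\det (\matrix_(i, j) y (up_index i j) - E%:M)|.
have HE w : H w = \matrix_(i, j) H w (val (up_index i j)).1 (val (up_index i j)).2.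
  apply/matrixP => i j; rewrite mxE /= /up_pair; case: ifP => //= _.
  by rewrite -[in LHS](sH w) mxE.
rewrite unlock; under eq_integral => w _ do rewrite HE.
rewrite (@integral_independent_finite _ _ _ _ _ bool
  (fun (k : upper_index N) w => H w (val k).1 (val k).2) (bern_pr p) v G) //.
- congr EFin; rewrite -(Ef_inj (bern_pr_sum p) _ pair_set_inj) -EfZ.
  apply: eq_Ef => w; rewrite /G.
  have -> : \matrix_(i, j) (v \o [ffun k => w (pair_set k)]) (up_index i j) - E%:M =
      (Num.sqrt N%:R)^-1 *: (symx (bern_std p) w - (E * Num.sqrt N%:R)%:M +
        const_mx (p / Num.sqrt (p * (1 - p)))).
    apply/matrixP => i j; rewrite !mxE /= ffunE pair_set_up /v vE /bern_std.
    case: (i == j); rewrite ?mulr1n ?mulr0n; case: (w _);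
    by field; rewrite !gt_eqF.
  by rewrite detZ normrM normrX gtr0_norm ?invr_gt0 // exprVn.
- have v0 : 0 < 1 / Num.sqrt (N%:R * p * (1 - p)) by rewrite divr_gt0 // vE mulr_gt0.
  by move=> b b'; rewrite /v; case: b; case: b' => //= /eqP;
    rewrite ?(gt_eqF v0) ?(lt_eqF v0).
- by move=> b; exact: bern_pr_ge0.
- exact: bern_pr_sum.
- move=> k b; have [P1 P0] := PH (val k).1 (val k).2.
  by case: b; [exact: P1|exact: P0].
- by move=> y; rewrite /G.
- have mdet : measurable_fun setT (fun w =>
      \det (\matrix_(i, j) H w (val (up_index i j)).1 (val (up_index i j)).2 - E%:M)).
    rewrite /determinant; apply: measurable_sum => s.
    apply: measurable_funM => //; apply: measurable_prod => i _.
    under eq_fun => w do rewrite !mxE.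
    by apply: measurable_funB => //; exact: mH.
  exact: (measurable_comp measurableT (@subsetT _ _) (@normr_measurable R setT) mdet).
Qed.
End ErdosRenyi.

(** * The logarithmic potential of the semicircle law *)

Section PoissonKernel.
Variable R : realType.
Notation mu := (@lebesgue_measure R).
Implicit Types r u t : R.

Lemma is_derive_continuous (f : R -> R) (x df : R) :
  is_derive x 1 f df -> {for x, continuous f}.
Proof. by move=> [d _]; exact/differentiable_continuous/derivable1_diffP. Qed.

Lemma continuous_Rintegral (f F : R -> R) (a b : R) : a < b ->
  continuous f -> (forall x : R, is_derive x 1 F (f x)) ->
  \int[mu]_(x in `[a, b]) f x = F b - F a.
Proof.
move=> ab cf dF; rewrite /Rintegral (@continuous_FTC2 R f F a b) //.
- exact: continuous_subspaceT.
- have cF x : {for x, continuous F} := is_derive_continuous (dF x).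
  split; first by move=> x _; have [] := dF x.
  + exact: cvg_at_right_filter (cF a).
  + exact: cvg_at_left_filter (cF b).
- by move=> x _; rewrite derive1E derive_val.
Qed.

(* [|1 - r e^{iu}|^2], the denominator of the Poisson kernel. *)
Definition pk r u := 1 - 2 * r * cos u + r ^+ 2.

Lemma pk_ge r u : (1 - `|r|) ^+ 2 <= pk r u.
Proof.
rewrite /pk; have h : r * cos u <= `|r|.
  by apply: le_trans (ler_norm _) _; rewrite normrM ler_piMr // cos_max.
have : `|r| ^+ 2 = r ^+ 2 by rewrite real_normK // num_real.
by nra.
Qed.

Lemma pk_gt0 r u : `|r| < 1 -> 0 < pk r u.
Proof.
by move=> r1; apply: lt_le_trans (pk_ge r u); rewrite exprn_gt0 // subr_gt0.
Qed.

Lemma pk_one r u : `|r| < 1 -> 0 < 1 - r * cos u.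
Proof.
move=> r1; rewrite subr_gt0; apply: le_lt_trans (ler_norm _) _.
by apply: le_lt_trans r1; rewrite normrM ler_piMr // cos_max.
Qed.

Lemma is_derive_ln (f : R -> R) t df : 0 < f t -> is_derive t 1 f df ->
  is_derive t 1 (fun y => ln (f y)) ((f t)^-1 * df).
Proof. by move=> ft d; apply: (@is_derive1_comp R (@ln R) f); exact: is_derive1_ln. Qed.

Lemma is_derive_lnpk_r r u : `|r| < 1 ->
  is_derive r 1 (fun r => ln (pk r u)) ((2 * r - 2 * cos u) / pk r u).
Proof.
move=> r1; rewrite mulrC; apply: (@is_derive_ln (fun r => pk r u)); first exact: pk_gt0.
by rewrite /pk; apply: is_derive_eq; rewrite /GRing.scale /=; ring.
Qed.

Lemma is_derive_lnpk r u : `|r| < 1 ->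
  is_derive u 1 (fun u => ln (pk r u)) (2 * r * sin u / pk r u).
Proof.
move=> r1; rewrite mulrC; apply: (@is_derive_ln (fun u => pk r u)); first exact: pk_gt0.
by rewrite /pk; apply: is_derive_eq; rewrite /GRing.scale /=; ring.
Qed.

(* The argument of [1 - r e^{-iu}]. *)
Definition pk_arg r u := atan (r * sin u / (1 - r * cos u)).

Lemma pk_argN r u : pk_arg r (- u) = - pk_arg r u.
Proof. by rewrite /pk_arg sinN cosN mulrN mulNr atanN. Qed.

Lemma is_derive_pk_arg r u : `|r| < 1 ->
  is_derive u 1 (pk_arg r) ((r * cos u - r ^+ 2) / pk r u).
Proof.
move=> r1; have n0 := pk_one u r1; have q0 := pk_gt0 u r1.
have d1 : is_derive u 1 (fun u => 1 - r * cos u) (r * sin u).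
  by apply: is_derive_eq; rewrite /GRing.scale /=; ring.
have d2 := @is_derive_inv R (fun u => 1 - r * cos u) u _ (lt0r_neq0 n0) d1.
have d3 : is_derive u 1 (fun u => r * sin u / (1 - r * cos u))
   ((r * cos u - r ^+ 2) / (1 - r * cos u) ^+ 2).
  apply: is_derive_eq; rewrite /GRing.scale /=.
  have := cos2Dsin2 u; set c := cos u in n0 *; set s := sin u => cs.
  have -> : r ^+ 2 = r ^+ 2 * (c ^+ 2 + s ^+ 2) by rewrite cs mulr1.
  by field; rewrite lt0r_neq0.
have := @is_derive1_comp R (@atan R) (fun u => r * sin u / (1 - r * cos u)) u _ _
  (is_derive1_atan _) d3.
congr is_derive.
have := cos2Dsin2 u; rewrite /pk; move: n0 q0; rewrite /pk.
set c := cos u; set s := sin u => n0 q0 cs.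
have qE : 1 - 2 * r * c + r ^+ 2 = (1 - r * c) ^+ 2 + (r * s) ^+ 2.
  have r2 : r ^+ 2 = r ^+ 2 * c ^+ 2 + r ^+ 2 * s ^+ 2 by rewrite -mulrDr cs mulr1.
  by rewrite [X in _ + X = _]r2; ring.
rewrite qE in q0 *; field.
by rewrite !lt0r_neq0.
Qed.

(* [prim_c] and [prim_s] are primitives of [d/dr ln (pk r u)] times [cos (2 u)]
   and [sin (2 u)]. *)
Definition prim_c r u := r^-1 * (sin u * cos u + (1 - r ^+ 2) * sin u / r -
  r ^+ 2 * u - (1 + r ^+ 4) / r ^+ 2 * pk_arg r u).

Definition prim_s r u := r^-1 * (sin u ^+ 2 - (1 - r ^+ 4) / (2 * r ^+ 2) * ln (pk r u)
  - (1 - r ^+ 2) * cos u / r).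

Lemma is_derive_prim_c r u : 0 < r < 1 -> is_derive u 1 (prim_c r)
  ((2 * r - 2 * cos u) / pk r u * (2 * cos u ^+ 2 - 1)).
Proof.
move=> /andP[r0 r1]; have ar : `|r| < 1 by rewrite gtr0_norm.
have d := is_derive_pk_arg u ar; have q0 := pk_gt0 u ar.
have rn0 : r != 0 by rewrite gt_eqF.
apply: is_derive_eq; rewrite /GRing.scale /=.
have := sin2cos2 u; move: q0; rewrite /pk; set c := cos u; set s := sin u => q0 cs.
by field: cs; rewrite rn0 lt0r_neq0.
Qed.

Lemma is_derive_prim_s r u : 0 < r < 1 -> is_derive u 1 (prim_s r)
  ((2 * r - 2 * cos u) / pk r u * (2 * sin u * cos u)).
Proof.
move=> /andP[r0 r1]; have ar : `|r| < 1 by rewrite gtr0_norm.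
have d := is_derive_lnpk u ar; have q0 := pk_gt0 u ar.
have rn0 : r != 0 by rewrite gt_eqF.
apply: is_derive_eq; rewrite /GRing.scale /=.
move: q0; rewrite /pk; set c := cos u; set s := sin u => q0.
by field; rewrite rn0 lt0r_neq0.
Qed.

(** From [sin^2 t = (1 - cos (2 t)) / 2] with [t = u + v]: the double angle is expanded, and
    [- 2 / r * pk_arg r u] handles the constant term. *)
Definition prim r (v u : R) := 2^-1 * (- 2 / r * pk_arg r u -
  cos (2 * v) * prim_c r u + sin (2 * v) * prim_s r u).

Lemma is_derive_prim r v t : 0 < r < 1 -> is_derive t 1 (fun t => prim r v (t - v))
  ((2 * r - 2 * cos (t - v)) / pk r (t - v) * sin t ^+ 2).
Proof.
move=> r01; have /andP[r0 r1] := r01; have ar : `|r| < 1 by rewrite gtr0_norm.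
have ds : is_derive t 1 (fun t => t - v) 1.
  by apply: is_derive_eq; ring.
set u := t - v.
have q0 := pk_gt0 u ar; have rn0 : r != 0 by rewrite gt_eqF.
have d0 := is_derive_pk_arg u ar; have d1 := is_derive_prim_c u r01.
have d2 := is_derive_prim_s u r01.
have d : is_derive u 1 (prim r v) ((2 * r - 2 * cos u) / pk r u * sin t ^+ 2).
  apply: is_derive_eq; rewrite /GRing.scale /=.
  have -> : t = u + v by rewrite /u subrK.
  rewrite sinD (_ : 2 * v = v *+ 2); last by rewrite mulr_natl.
  rewrite cos_mulr2n (_ : sin (v *+ 2) = 2 * (sin v * cos v)); last first.
    by rewrite mulr2n sinD; ring.
  have := sin2cos2 v; have := sin2cos2 u; move: q0; rewrite /pk.
  set c := cos u; set s := sin u => q0 cs.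
  set c' := cos v; set s' := sin v => cs'.
  have -> : (s * c' + c * s') ^+ 2 = s ^+ 2 * c' ^+ 2 + 2 * (s * c) * (s' * c') +
     c ^+ 2 * s' ^+ 2 by ring.
  rewrite cs cs'; field.
  by rewrite rn0 lt0r_neq0.
have := @is_derive1_comp R (prim r v) (fun t => t - v) t _ _ d ds.
by rewrite mulr1.
Qed.

Lemma continuous_pk r v : continuous (fun t : R => pk r (t - v)).
Proof.
move=> t; have ds : is_derive t 1 (fun t => t - v) 1 by apply: is_derive_eq; ring.
have d : is_derive (t - v) 1 (pk r) (2 * r * sin (t - v)).
  by rewrite /pk; apply: is_derive_eq; rewrite /GRing.scale /=; ring.
exact: is_derive_continuous (@is_derive1_comp R (pk r) (fun t => t - v) t _ _ d ds).
Qed.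

Lemma continuous_cosB v : continuous (fun t : R => cos (t - v)).
Proof.
move=> t; apply: (@continuous_comp _ _ _ (fun t => t - v) cos); last exact: continuous_cos.
by apply: cvgB; [exact: cvg_id|exact: cvg_cst].
Qed.

Lemma continuous_sin2 : continuous (fun t : R => sin t ^+ 2).
Proof.
move=> t; have d : is_derive t 1 (fun t : R => sin t ^+ 2) (2 * sin t * cos t).
  by apply: is_derive_eq; rewrite /GRing.scale /=; ring.
exact: is_derive_continuous d.
Qed.

Definition dlnpk r v t := (2 * r - 2 * cos (t - v)) / pk r (t - v) * sin t ^+ 2.

Lemma continuous_dlnpk r v : `|r| < 1 -> continuous (dlnpk r v).
Proof.
move=> r1 t; apply: cvgM; last exact: continuous_sin2.
apply: cvgM; last first.
  by apply: cvgV; [rewrite gt_eqF // pk_gt0|exact: continuous_pk].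
apply: cvgB; first exact: cvg_cst.
by apply: cvgM; [exact: cvg_cst|exact: continuous_cosB].
Qed.

(** Adding the integrands for [v] and [- v] makes the boundary terms cancel by parity, except for
    the linear term [r ^+ 2 * u] of [prim_c] at [t = pi]. The primitives divide by [r], so [r = 0]
    is treated apart. *)
Lemma integral_dlnpk r v : 0 <= r < 1 ->
  \int[mu]_(t in `[0, pi]) (dlnpk r v t + dlnpk r (- v) t) = pi * r * cos (2 * v).
Proof.
move=> /andP[r0 r1]; have ar : `|r| < 1 by rewrite ger0_norm.
have cd w := @continuous_dlnpk r w ar.
move: r0; rewrite le_eqVlt => /predU1P[r0|r0].
  rewrite -r0; apply: etrans.
    apply: (@continuous_Rintegral _ (fun t => - (4 / 3) * cos v * sin t ^+ 3)).
  - exact: pi_gt0.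
  - by move=> t; apply: cvgD; apply: continuous_dlnpk; rewrite normr0.
  - move=> t; apply: is_derive_eq; rewrite /GRing.scale /= /dlnpk /pk.
    by rewrite !mulr0 !mul0r !cosB cosN sinN expr0n /=; field.
  - by rewrite /= sinpi sin0; ring.
have r01 : 0 < r < 1 by rewrite r0.
apply: etrans.
  apply: (@continuous_Rintegral _ (fun t => prim r v (t - v) + prim r (- v) (t - - v))).
- exact: pi_gt0.
- by move=> t; apply: cvgD; exact: cd.
- by move=> t; apply: is_deriveD; exact: is_derive_prim.
- rewrite opprK !sub0r add0r /prim /prim_c /prim_s !mulrN cosN sinN pk_argN /pk.
  have C1 : cos (pi - v) = - cos v by rewrite cosB sinpi cospi; ring.
  have C2 : cos (pi + v) = - cos v by rewrite cosD sinpi cospi; ring.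
  have S1 : sin (pi - v) = sin v by rewrite sinB sinpi cospi; ring.
  have S2 : sin (pi + v) = - sin v by rewrite sinD sinpi cospi; ring.
  have P1 : pk_arg r (pi - v) = - pk_arg r (pi + v).
    by rewrite /pk_arg -atanN C1 C2 S1 S2 !mulrN !mulNr !opprK.
  rewrite P1 C1 C2 S1 S2 ?sinN ?cosN.
  by field; rewrite gt_eqF.
Qed.

Definition lnpk2 r v t := (ln (pk r (t - v)) + ln (pk r (t + v))) * sin t ^+ 2.

Lemma continuous_lnpk2 r v : `|r| < 1 -> continuous (lnpk2 r v).
Proof.
move=> r1 t; apply: cvgM; last exact: continuous_sin2.
have cl w : {for t, continuous (fun t => ln (pk r (t - w)))}.
  apply: (@continuous_comp _ _ _ (fun t => pk r (t - w)) (@ln R)).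
    exact: continuous_pk.
  by apply: continuous_ln; exact: pk_gt0.
apply: cvgD; first exact: cl.
by rewrite -(opprK v); exact: (cl (- v)).
Qed.

Lemma is_derive_lnpk2 r v t : `|r| < 1 ->
  is_derive r 1 (fun r => lnpk2 r v t) (dlnpk r v t + dlnpk r (- v) t).
Proof.
move=> r1; have d1 := is_derive_lnpk_r (t - v) r1; have d2 := is_derive_lnpk_r (t + v) r1.
apply: is_derive_eq; rewrite /GRing.scale /= /dlnpk opprK; ring.
Qed.

Let J v r := \int[mu]_(t in `[0, pi]) lnpk2 r v t.

Lemma is_derive_J v r : 0 <= r < 1 -> is_derive r 1 (J v) (pi * r * cos (2 * v)).
Proof.
move=> r01; have /andP[r0 r1] := r01.
(* Differentiation under the integral needs a neighbourhood of [r] away from 1. For [|x| < s] the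
   denominator [pk] is at least [(1 - s)^2], and each of the two terms has numerator at most 4,
   whence [M]. *)
pose s := (1 + r) / 2.
have s01 : 0 < s < 1 by rewrite /s; lra.
have [s0 s1] := andP s01.
have Ir : `]-s, s[%classic r by rewrite /= in_itv /= /s; lra.
have I1 x : `]-s, s[%classic x -> `|x| < 1.
  by rewrite /= in_itv /= => /andP[x0 x1]; rewrite ltr_norml; lra.
pose M := 8 / (1 - s) ^+ 2.
have M0 : 0 <= M by rewrite divr_ge0 // sqr_ge0.
have h1 x : `]-s, s[%classic x -> mu.-integrable `[0, pi] (EFin \o lnpk2 x v).
  move=> /I1 x1; apply: continuous_compact_integrable; first exact: segment_compact.
  by apply: continuous_subspaceT; exact: continuous_lnpk2.
have h2 x y : `]-s, s[%classic x -> `[0, pi]%classic y -> derivable (lnpk2 ^~ v ^~ y) x 1.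
  by move=> /I1 x1 _; have [] := is_derive_lnpk2 v y x1.
have h3 : mu.-integrable `[0, pi] (EFin \o (fun _ : R => M)).
  apply: continuous_compact_integrable; first exact: segment_compact.
  by apply: continuous_subspaceT => ?; exact: cvg_cst.
have h4 x y : `]-s, s[%classic x -> `[0, pi]%classic y ->
    `|partial1of2 (fun r t => lnpk2 r v t) x y| <= M.
  move=> Ix _; have x1 := I1 x Ix.
  rewrite partial1of2E (@derive_val _ _ _ _ _ _ _ (is_derive_lnpk2 v y x1)).
  have b w : `|dlnpk x w y| <= 4 / (1 - s) ^+ 2.
    rewrite /dlnpk !normrM normfV.
    have xs : `|x| <= s by move: Ix; rewrite /= in_itv /= => /andP[? ?]; rewrite ler_norml; lra.
    have pg := pk_ge x (y - w); have p0 := pk_gt0 (y - w) x1.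
    have ss : (1 - s) ^+ 2 <= pk x (y - w).
      by apply: le_trans pg; rewrite lerXn2r ?nnegrE ?subr_ge0 ?lerD2l ?lerN2 // ltW.
    have sp : 0 < (1 - s) ^+ 2 by rewrite exprn_gt0 // subr_gt0.
    have n1 : `|2 * x - 2 * cos (y - w)| <= 4.
      have := cos_max (y - w); rewrite ler_norml => /andP[? ?].
      move: x1; rewrite ltr_norml => /andP[? ?]; rewrite ler_norml; lra.
    have n2 : `|sin y ^+ 2| <= 1.
      by rewrite ger0_norm ?sqr_ge0 //; have := cos2Dsin2 y; have := sqr_ge0 (cos y); lra.
    rewrite -[leRHS]mulr1 ler_pM ?mulr_ge0 ?invr_ge0 //.
    rewrite ler_pM ?invr_ge0 // (gtr0_norm p0) lef_pV2 ?posrE //.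
  by rewrite -normrM; exact: n2.
  apply: le_trans (ler_normD _ _) _; apply: le_trans (lerD (b _) (b _)) _.
  by rewrite /M -mulrDl (_ : 4 + 4 = 8 :> R) ?lexx //; ring.
have mB : measurable `[0, pi : R]%classic by [].
have dJ := @derivable_under_integral R _ _ mu (fun r t => lnpk2 r v t) _ mB r (- s) s Ir h1 h2
  (fun _ => M) (fun _ => M0) h3 h4.
apply: DeriveDef; first exact: dJ.
rewrite -derive1E (@differentiation_under_integral R _ _ mu (fun r t => lnpk2 r v t) _ mB r (- s) s Ir h1 h2
  (fun _ => M) (fun _ => M0) h3 h4).
rewrite -(integral_dlnpk v r01); apply: eq_Rintegral => t _.
by rewrite partial1of2E (@derive_val _ _ _ _ _ _ _ (is_derive_lnpk2 v t (I1 r Ir))).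
Qed.

Lemma integral_lnpk2 v r : 0 <= r < 1 ->
  \int[mu]_(t in `[0, pi]) lnpk2 r v t = pi / 2 * r ^+ 2 * cos (2 * v).
Proof.
move=> /andP[r0 r1]; rewrite -/(J v r).
have dG t : 0 <= t <= r -> is_derive t 1
    (fun t => J v t - pi / 2 * t ^+ 2 * cos (2 * v)) 0.
  move=> /andP[t0 tr].
  have dt := @is_derive_J v t; rewrite t0 (le_lt_trans tr r1) in dt.
  by have := dt isT => d; apply: is_derive_eq; rewrite /GRing.scale /=; field.
have J0 : J v 0 = 0.
  rewrite /J (@eq_Rintegral _ _ _ _ _ (cst 0)) ?Rintegral_cst ?mul0r // => t' _.
  by rewrite /lnpk2 /pk !mulr0 !mul0r subr0 expr0n /= addr0 ln1 addr0 mul0r.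
(* A function with zero derivative is nonincreasing; applied to the difference and to its opposite,
   this makes it constant. *)
have h1 : J v r - pi / 2 * r ^+ 2 * cos (2 * v) <= J v 0 - pi / 2 * 0 ^+ 2 * cos (2 * v).
  exact: (@is_derive_le _ _ (fun=> 0) 0 r r0 dG (fun _ _ => lexx 0)).
have h2 : - (J v r - pi / 2 * r ^+ 2 * cos (2 * v)) <= - (J v 0 - pi / 2 * 0 ^+ 2 * cos (2 * v)).
  apply: (@is_derive_le _ (fun t => - (J v t - pi / 2 * t ^+ 2 * cos (2 * v))) (fun=> 0) 0 r r0) => //.
  by move=> t /dG d; have := is_deriveN d; rewrite oppr0.
rewrite J0 expr0n mulr0 mul0r subr0 /= in h1 h2; lra.
Qed.

End PoissonKernel.

(** * Transfer to the semicircle law, outside and inside its support *)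

Section SemicirclePotential.
Variable R : realType.
Notation mu := (@lebesgue_measure R).
Implicit Types r v t x : R.

Let pi_neq0 : pi != 0 :> R.
Proof. by apply/lt0r_neq0; exact: pi_gt0. Qed.

(** [Num.sqrt] vanishes on negative numbers, so this is continuous on the whole line. *)
Definition sc_wt x := Num.sqrt (4 - x ^+ 2) / (2 * pi).

Lemma continuous_sc_wt : continuous sc_wt.
Proof.
move=> x; apply: cvgM; last exact: cvg_cst.
apply: (@continuous_comp _ _ _ (fun x => 4 - x ^+ 2) (@Num.sqrt R)); last exact: sqrt_continuous.
have d : is_derive x 1 (fun x => 4 - x ^+ 2) (- (2 * x)).
  by apply: is_derive_eq; rewrite /GRing.scale /=; ring.
exact: is_derive_continuous d.
Qed.

Lemma sc_wt_ge0 x : 0 <= sc_wt x.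
Proof. by rewrite divr_ge0 ?sqrtr_ge0 // mulr_ge0 ?pi_ge0. Qed.

Lemma sc_substitution (G : R -> R) :
  {in `[-2, 2]%classic, continuous G} ->
  (\int[mu]_(x in `[(-2)%R, 2%R]) (G x * sc_wt x)%:E =
   \int[mu]_(t in `[0%R, pi]) (2 / pi * (G (2 * cos t) * sin t ^+ 2))%:E)%E.
Proof.
move=> cG; pose F t := 2 * cos t.
have dF t : is_derive t 1 F (- 2 * sin t).
  by apply: is_derive_eq; rewrite /GRing.scale /=; ring.
have F'E : derive1 F = fun t => - 2 * sin t.
  by apply/funext => t; rewrite derive1E derive_val.
have cF' t : {for t, continuous (fun t => - 2 * sin t)}.
  by apply: cvgM; [exact: cvg_cst|exact: continuous_sin].
have cF t : {for t, continuous F} := is_derive_continuous (dF t).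
have := @integration_by_substitution_decreasing R F (fun x => G x * sc_wt x) 0 pi (pi_ge0 R).
rewrite F'E /F cos0 cospi mulr1 mulrN1 => -> //.
- apply: eq_integral => t; rewrite inE /= in_itv /= => /andP[t0 tp].
  congr EFin.
  change (G (2 * cos t) * sc_wt (2 * cos t) * - (- 2 * sin t) =
    2 / pi * (G (2 * cos t) * sin t ^+ 2)); rewrite /sc_wt.
  have -> : Num.sqrt (4 - (2 * cos t) ^+ 2) = 2 * sin t.
    have -> : 4 - (2 * cos t) ^+ 2 = (2 * sin t) ^+ 2.
      by have := cos2Dsin2 t; lra.
    by rewrite sqrtr_sqr ger0_norm // mulr_ge0 // sin_ge0_pi // t0.
  move: (@pi R) pi_neq0 => P P0; field; exact: P0.
- by move=> s t ss tt st; rewrite ltr_pM2l // ltr_cos.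
- by move=> t _; exact: cF'.
- by apply/cvg_ex; eexists; exact: cvg_at_right_filter (cF' 0).
- by apply/cvg_ex; eexists; exact: cvg_at_left_filter (cF' pi).
- split; first by move=> t _; have [] := dF t.
  + exact: cvg_at_right_filter (cF 0).
  + exact: cvg_at_left_filter (cF pi).
- apply: continuous_in_subspaceT => x xD.
  by apply: cvgM; [exact: cG|exact: continuous_sc_wt].
Qed.

Lemma integral_sin2 : \int[mu]_(t in `[0, pi]) (sin t ^+ 2) = pi / 2.
Proof.
apply: etrans.
  apply: (@continuous_Rintegral _ _ (fun t => t / 2 - sin t * cos t / 2)).
- exact: pi_gt0.
- exact: continuous_sin2.
- move=> t; apply: is_derive_eq; rewrite /GRing.scale /=.
  by have := sin2cos2 t => cs; field: cs.
- by rewrite /= sinpi sin0; ring.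
Qed.

Lemma EFin_Rintegral (f : R -> R) (a b : R) : {within `[a, b], continuous f} ->
  (\int[mu]_(t in `[a, b]) (f t)%:E)%E = (\int[mu]_(t in `[a, b]) f t)%:E.
Proof.
move=> cf; rewrite /Rintegral fineK //; apply: integrable_fin_num => //.
by apply: continuous_compact_integrable => //; exact: segment_compact.
Qed.

(* [|x - (w + w^-1)|^2] for [w = r e^{-iv}]. *)
Definition pk_quad r v x := (x - (r + r^-1) * cos v) ^+ 2 + ((r^-1 - r) * sin v) ^+ 2.

(** Squared modulus of [(1 - w e^{it})(1 - w e^{-it}) = w (w + w^-1 - 2 cos t)] with
    [w = r e^{-iv}]. *)
Lemma pk_quadE r v t : r != 0 ->
  pk r (t - v) * pk r (t + v) = r ^+ 2 * pk_quad r v (2 * cos t).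
Proof.
move=> r0; rewrite /pk /pk_quad cosB cosD.
have := sin2cos2 v; have := sin2cos2 t => h1 h2.
by field: h1 h2.
Qed.

Lemma pk_quad_gt0 r v x : 0 < r < 1 -> -2 <= x <= 2 -> 0 < pk_quad r v x.
Proof.
move=> /andP[r0 r1] /andP[x0 x1].
have -> : x = 2 * cos (acos (x / 2)).
  rewrite acosK; first by field.
  by rewrite in_itv /=; lra.
have ar : `|r| < 1 by rewrite gtr0_norm.
have r2 : 0 < r ^+ 2 by rewrite exprn_gt0.
by rewrite -(pmulr_rgt0 _ r2) -pk_quadE ?gt_eqF // mulr_gt0 // pk_gt0.
Qed.

Lemma continuous_ln_pk_quad r v : 0 < r < 1 ->
  {in `[-2, 2]%classic, continuous (fun x => ln (pk_quad r v x) / 2)}.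
Proof.
move=> r01 x; rewrite inE /= in_itv /= => xD.
apply: cvgM; last exact: cvg_cst.
apply: (@continuous_comp _ _ _ (pk_quad r v) (@ln R)).
  have d : is_derive x 1 (pk_quad r v) (2 * (x - (r + r^-1) * cos v)).
    by rewrite /pk_quad; apply: is_derive_eq; rewrite /GRing.scale /=; ring.
  exact: is_derive_continuous d.
by apply: continuous_ln; exact: pk_quad_gt0.
Qed.

(** The potential at the complex point [w + w^-1]; for [0 < r < 1] it lies off the support and the
    integrand is continuous. *)
Lemma integral_ln_pk_quad r v : 0 < r < 1 ->
  (\int[mu]_(x in `[(-2)%R, 2%R]) (ln (pk_quad r v x) / 2 * sc_wt x)%:E =
   (- ln r + r ^+ 2 * cos (2 * v) / 2)%:E)%E.
Proof.
move=> r01; have /andP[r0 r1] := r01.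
have ar : `|r| < 1 by rewrite gtr0_norm.
rewrite (sc_substitution (@continuous_ln_pk_quad r v r01)).
have -> : (\int[mu]_(t in `[0%R, pi]) (2 / pi * (ln (pk_quad r v (2 * cos t)) / 2 * sin t ^+ 2))%:E =
    \int[mu]_(t in `[0%R, pi]) (pi^-1 * lnpk2 r v t - 2 * ln r / pi * sin t ^+ 2)%:E)%E.
  apply: eq_integral => t _; congr EFin.
  rewrite /lnpk2 -lnM ?posrE ?pk_gt0 // pk_quadE ?gt_eqF //.
  rewrite lnM ?posrE ?exprn_gt0 //; last first.
    by apply: pk_quad_gt0 => //; have := cos_geN1 t; have := cos_le1 t; lra.
  by rewrite lnXn //; move: (@pi R) pi_neq0 => P P0; field; exact: P0.
have c1 : continuous (lnpk2 r v) by exact: continuous_lnpk2.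
have c2 := @continuous_sin2 R.
have iC (f : R -> R) : continuous f -> mu.-integrable `[0%R, pi] (EFin \o f).
  move=> cf; apply: continuous_compact_integrable; first exact: segment_compact.
  exact: continuous_subspaceT.
have cZ c (f : R -> R) : continuous f -> continuous (fun t => c * f t).
  by move=> cf t; apply: cvgM; [exact: cvg_cst|exact: cf].
rewrite EFin_Rintegral; last first.
  by apply: continuous_subspaceT => t; apply: cvgB; [exact: (cZ _ _ c1 t)|exact: (cZ _ _ c2 t)].
rewrite RintegralB //; [|exact/iC/cZ|exact/iC/cZ].
rewrite !RintegralZl //; [|exact/iC|exact/iC].
rewrite integral_lnpk2 ?(ltW r0) // integral_sin2; congr EFin.
by move: (@pi R) pi_neq0 => P P0; field; exact: P0.
Qed.

Lemma integral_sc_wt : (\int[mu]_(x in `[(-2)%R, 2%R]) (sc_wt x)%:E = 1)%E.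
Proof.
have -> : (\int[mu]_(x in `[(-2)%R, 2%R]) (sc_wt x)%:E =
  \int[mu]_(x in `[(-2)%R, 2%R]) ((cst 1%R x : R) * sc_wt x)%:E)%E.
  by apply: eq_integral => x _; rewrite mul1r.
rewrite sc_substitution; last by move=> x _; exact: cvg_cst.
have c2 := @continuous_sin2 R.
rewrite EFin_Rintegral; last first.
  apply: continuous_subspaceT => t; apply: cvgM; first exact: cvg_cst.
  by apply: cvgM; [exact: cvg_cst|exact: c2].
rewrite RintegralZl //; last first.
  apply: continuous_compact_integrable; first exact: segment_compact.
  by apply: continuous_subspaceT => t; apply: cvgM; [exact: cvg_cst|exact: c2].
have -> : \int[mu]_(x in `[0, pi]) (cst 1 (2 * cos x) * sin x ^+ 2) = pi / 2.
  by rewrite -integral_sin2; apply: eq_Rintegral => x _; rewrite mul1r.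
by congr EFin; move: (@pi R) pi_neq0 => P P0; field; exact: P0.
Qed.

Lemma integral_rho_sc (f : R -> R) :
  (\int[mu]_x (f x * rho_sc x)%:E =
   \int[mu]_(x in `[(-2)%R, 2%R]) (f x * sc_wt x)%:E)%E.
Proof.
rewrite [RHS]integral_mkcond; apply: eq_integral => x _.
rewrite patchE /rho_sc indicE -/(sc_wt x); case: (x \in _); rewrite ?mulr1 //.
by rewrite !mulr0.
Qed.

Lemma semicircle_potential_out r E : 0 < r < 1 -> `|E| = r + r^-1 ->
  (\int[mu]_x (ln `|x - E| * rho_sc x)%:E = (- ln r + r ^+ 2 / 2)%:E)%E.
Proof.
move=> r01 Er; have /andP[r0 r1] := r01.
have [v Ev c2v] : exists2 v : R, E = (r + r^-1) * cos v & cos (2 * v) = 1.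
  have [E0|E0] := lerP 0 E.
    by exists 0; rewrite ?mulr0 cos0 // mulr1 -Er ger0_norm.
  exists pi; first by rewrite cospi mulrN1 -Er ltr0_norm // opprK.
  by rewrite mulr_natl cos2pi.
have sv : sin v = 0.
  apply/eqP; rewrite -sqrf_eq0; apply/eqP.
  have := cos_mulr2n v; rewrite -(mulr_natl v 2) c2v; have := cos2Dsin2 v; lra.
rewrite integral_rho_sc; have := integral_ln_pk_quad v r01; rewrite c2v mulr1 => <-.
apply: eq_integral => x _; congr (_ * _)%:E.
rewrite /pk_quad sv mulr0 expr0n addr0 -Ev -[in RHS](@real_normK _ (x - E) (num_real _)).
(* At [x = E] both sides vanish by the convention [ln 0 = 0]. *)
have [->|xE] := eqVneq x E; first by rewrite subrr normr0 expr0n /= !ln0 // mul0r.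
by rewrite lnXn ?normr_gt0 ?subr_eq0 //; field.
Qed.

(** As a function of [b = r + r^-1], which decreases on [(0, 1)], [pk_quad] is a quadratic
    polynomial; it increases for [b >= 2] because [x * cos v <= 2]. *)
Lemma pk_quad_anti r r' v x : 0 < r -> r <= r' -> r' < 1 -> -2 <= x <= 2 ->
  pk_quad r' v x <= pk_quad r v x.
Proof.
move=> r0 rr' r1' /andP[x0 x1]; have r0' : 0 < r' := lt_le_trans r0 rr'.
have two (a : R) : 0 < a -> 2 <= a + a^-1.
  move=> a0; rewrite -subr_ge0.
  have -> : a + a^-1 - 2 = (a - 1) ^+ 2 / a by field; rewrite gt_eqF.
  by rewrite divr_ge0 ?sqr_ge0 // ltW.
have KE (a : R) : 0 < a -> pk_quad a v x =
    x ^+ 2 - 2 * x * cos v * (a + a^-1) + (a + a^-1) ^+ 2 - 4 * sin v ^+ 2.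
  move=> a0; rewrite /pk_quad.
  have -> : ((a^-1 - a) * sin v) ^+ 2 = ((a + a^-1) ^+ 2 - 4) * sin v ^+ 2.
    by field; rewrite gt_eqF.
  by have := sin2cos2 v => cs; ring: cs.
have rho : r' + r'^-1 <= r + r^-1.
  rewrite -subr_ge0.
  have -> : r + r^-1 - (r' + r'^-1) = (r' - r) * (1 - r * r') / (r * r').
    by field; rewrite !gt_eqF.
  have rr1 : 0 <= 1 - r * r' by nra.
  have rr0 : 0 <= r' - r by rewrite subr_ge0.
  exact: divr_ge0 (mulr_ge0 rr0 rr1) (mulr_ge0 (ltW r0) (ltW r0')).
rewrite !KE // -subr_ge0.
set b := r + r^-1 in rho *; set b' := r' + r'^-1 in rho *.
have -> : x ^+ 2 - 2 * x * cos v * b + b ^+ 2 - 4 * sin v ^+ 2 -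
    (x ^+ 2 - 2 * x * cos v * b' + b' ^+ 2 - 4 * sin v ^+ 2) =
    (b - b') * (b + b' - 2 * (x * cos v)) by ring.
rewrite mulr_ge0 ?subr_ge0 //.
have := two r r0; have := two r' r0'; rewrite -/b -/b'.
have := cos_le1 v; have := cos_geN1 v; nra.
Qed.

(* [E = 2 cos v] is the limit of [w + w^-1] for [w = r e^{-iv}], and [pk_quad]
   decreases as [r] increases to 1, so that monotone convergence applies. *)
Lemma semicircle_potential_in E : `|E| < 2 ->
  (\int[mu]_x (ln `|x - E| * rho_sc x)%:E = (E ^+ 2 / 4 - 1 / 2)%:E)%E.
Proof.
move=> E2; have [E0 E1] : -2 < E /\ E < 2 by move: E2; rewrite ltr_norml => /andP.
pose v := acos (E / 2).
have cv : cos v = E / 2 by rewrite acosK // in_itv /=; lra.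
have c2v : cos (2 * v) = E ^+ 2 / 2 - 1.
  by rewrite mulr_natl cos_mulr2n cv; field.
(* The shift by 2 keeps [rn n] in [[1/2, 1)], where [pk_quad] has a bound uniform in [n]. *)
pose rn (n : nat) : R := 1 - n.+2%:R^-1.
have rn01 n : 2^-1 <= rn n < 1.
  rewrite /rn; have h : n.+2%:R^-1 <= 2^-1 :> R by rewrite lef_pV2 ?posrE // ler_nat.
  have h' : 0 < n.+2%:R^-1 :> R by rewrite invr_gt0.
  move: (n.+2%:R^-1) h h' => a h h'; lra.
have rn0 n : 0 < rn n < 1 by have := rn01 n; lra.
have rn1 : rn n @[n --> \oo] --> (1 : R).
  rewrite -[X in _ --> X]subr0; apply: cvgB; first exact: cvg_cst.
  by have := @cvg_harmonic R; rewrite -(@cvg_shiftS R^o (@harmonic R)).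
have rnm n m : (n <= m)%N -> rn n <= rn m.
  by move=> nm; rewrite /rn lerB // lef_pV2 ?posrE // ler_nat !ltnS.
(* At [x = E] the convention [ln 0 = 0] would spoil the pointwise limit; removing one point leaves
   the integrals unchanged. *)
pose D := `[(-2)%R, 2%R]%classic `\ E.
have mD : measurable D by exact: measurableD.
have DP x : D x -> -2 <= x <= 2 /\ x != E.
  by move=> [+ xE]; rewrite /= in_itv /= => xD; split => //; apply/eqP.
have mwt : measurable_fun setT sc_wt by apply: continuous_measurable_fun; exact: continuous_sc_wt.
have mK r : measurable_fun setT (pk_quad r v).
  apply: continuous_measurable_fun => x.
  have d : is_derive x 1 (pk_quad r v) (2 * (x - (r + r^-1) * cos v)).
    by rewrite /pk_quad; apply: is_derive_eq; rewrite /GRing.scale /=; ring.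
  exact: is_derive_continuous d.
(* For [r >= 1/2] and [|x| <= 2] the distance from [x] to [w + w^-1] is at most 5, so [ln 5] makes
   the integrands nonnegative; the minus sign makes them increase with [n]. *)
pose g n x := (ln 5 - ln (pk_quad (rn n) v x) / 2) * sc_wt x.
have mg n : measurable_fun setT (g n).
  apply: measurable_funM => //; apply: measurable_funB => //.
  apply: measurable_funM => //.
  exact: (measurable_comp measurableT (@subsetT _ _) (@measurable_ln R) (mK (rn n))).
pose h x := (ln 5 - ln `|x - E|) * sc_wt x.
have mlnE : measurable_fun setT (fun x : R => ln `|x - E|).
  apply: (measurable_comp measurableT (@subsetT _ _) (@measurable_ln R)).
  apply: (measurable_comp measurableT (@subsetT _ _) (@normr_measurable R setT)).
  exact: measurable_funB.
have mh : measurable_fun setT h.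
  by apply: measurable_funM => //; apply: measurable_funB.
have iC (f : R -> R) : {in `[-2, 2]%classic, continuous f} ->
    mu.-integrable `[(-2)%R, 2%R] (EFin \o f).
  move=> cf; apply: continuous_compact_integrable; first exact: segment_compact.
  exact: continuous_in_subspaceT.
have i5 : mu.-integrable `[(-2)%R, 2%R] (EFin \o (fun x => ln 5 * sc_wt x)).
  by apply: iC => x _; apply: cvgM; [exact: cvg_cst|exact: continuous_sc_wt].
have I5 : (\int[mu]_(x in `[(-2)%R, 2%R]) (ln 5 * sc_wt x)%:E = (ln 5)%:E)%E.
  under eq_integral do rewrite EFinM.
  rewrite integralZl // ?integral_sc_wt ?mule1 //.
  by apply: iC => x _; exact: continuous_sc_wt.
have Ig n : (\int[mu]_(x in D) (g n x)%:E =
    (ln 5 - (- ln (rn n) + rn n ^+ 2 * cos (2 * v) / 2))%:E)%E.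
  rewrite integral_setD1 //; last first.
    by apply/measurable_EFinP; exact: measurable_funTS.
  rewrite EFinB -I5 -integral_ln_pk_quad // -integralB_EFin //.
    by apply: eq_integral => x _; rewrite -EFinB /g mulrBl.
  apply: iC => x xD; apply: cvgM; last exact: continuous_sc_wt.
  exact: (continuous_ln_pk_quad (rn0 n) xD).
have g0 n x : D x -> 0 <= g n x.
  move=> /DP[xD _]; rewrite mulr_ge0 ?sc_wt_ge0 // subr_ge0.
  have Kp := pk_quad_gt0 v (rn0 n) xD.
  have K25 : pk_quad (rn n) v x <= 5 ^+ 2.
    have [r0 r1] := andP (rn01 n).
    apply: le_trans (@pk_quad_anti 2^-1 (rn n) v x _ r0 r1 xD) _; first by lra.
    rewrite /pk_quad invrK; have := cos_le1 v; have := cos_geN1 v.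
    have := cos2Dsin2 v; have := sqr_ge0 (cos v); have := sqr_ge0 (sin v).
    case/andP: xD; set c := cos v; set s := sin v => x0 x1 s2 c2 cs c0 c1.
    have -> : ((2 - 2^-1) * s) ^+ 2 = 9 / 4 * s ^+ 2 by field.
    have h1 : - (9 / 2) <= x - (2^-1 + 2) * c by lra.
    have h2 : x - (2^-1 + 2) * c <= 9 / 2 by lra.
    by nra.
  have : ln (pk_quad (rn n) v x) <= ln (5 ^+ 2) by rewrite ler_ln ?posrE.
  by rewrite lnXn // => h5; rewrite ler_pdivrMr // mulr_natr.
have gnd x : D x -> nondecreasing_seq (fun n => (g n x)%:E).
  move=> /DP[xD _] n m nm; rewrite lee_fin /g ler_wpM2r ?sc_wt_ge0 // lerD2l lerN2.
  rewrite ler_pM2r // ler_ln ?posrE ?pk_quad_gt0 //.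
  have [? _] := andP (rn0 n); have [_ ?] := andP (rn0 m).
  by apply: pk_quad_anti => //; exact: rnm.
have glim x : D x -> (g n x)%:E @[n --> \oo] --> (h x)%:E.
  move=> /DP[xD xE]; apply: cvg_EFin; first by near=> n.
  apply: cvgM; last exact: cvg_cst.
  apply: cvgB; first exact: cvg_cst.
  have -> : ln `|x - E| = ln ((x - E) ^+ 2) / 2.
    rewrite -[(x - E) ^+ 2](@real_normK _ (x - E) (num_real _)).
    by rewrite lnXn ?normr_gt0 ?subr_eq0 //; field.
  apply: cvgM; last exact: cvg_cst.
  apply: (@cvg_comp _ _ _ (fun n => pk_quad (rn n) v x) (@ln R) \oo (nbhs ((x - E) ^+ 2))).
    have rV : (rn n)^-1 @[n --> \oo] --> (1 : R).
      by rewrite -[X in _ --> X]invr1; apply: cvgV => //; exact: oner_neq0.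
    have -> : (x - E) ^+ 2 = (x - (1 + 1) * cos v) * (x - (1 + 1) * cos v) +
        ((1 - 1) * sin v) * ((1 - 1) * sin v) by rewrite cv; field.
    rewrite /pk_quad; under eq_fun do rewrite !expr2.
    have cc : (rn n + (rn n)^-1) * cos v @[n --> \oo] --> (1 + 1) * cos v.
      by apply: cvgM; [exact: cvgD|exact: cvg_cst].
    have ss : ((rn n)^-1 - rn n) * sin v @[n --> \oo] --> (1 - 1) * sin v.
      by apply: cvgM; [exact: cvgB|exact: cvg_cst].
    have xx : x - (rn n + (rn n)^-1) * cos v @[n --> \oo] --> x - (1 + 1) * cos v.
      by apply: cvgB => //; exact: cvg_cst.
    exact: cvgD (cvgM xx xx) (cvgM ss ss).
  apply: continuous_ln; rewrite lt_def sqr_ge0 andbT sqrf_eq0 subr_eq0 //.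
have Ih : (\int[mu]_(x in D) (h x)%:E = (ln 5 - cos (2 * v) / 2)%:E)%E.
  have -> : (\int[mu]_(x in D) (h x)%:E =
      \int[mu]_(x in D) (limn (fun n => (g n x)%:E)))%E.
    by apply: eq_integral => x; rewrite inE => Dx; apply/esym/cvg_lim => //; exact: glim.
  have mgD n : measurable_fun D (EFin \o g n).
    by apply/measurable_EFinP; exact: measurable_funTS.
  have g0D n x : D x -> (0 <= (g n x)%:E)%E by move=> Dx; rewrite lee_fin g0.
  rewrite (@monotone_convergence _ _ _ mu D mD (fun n x => (g n x)%:E) mgD g0D gnd).
  apply: cvg_lim => //; under eq_fun do rewrite Ig.
  apply: cvg_EFin; first by near=> n.
  rewrite -[X in _ --> X](_ : ln 5 - (- ln 1 + 1 * 1 * cos (2 * v) / 2) = _); last first.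
    by rewrite ln1; ring.
  apply: cvgB; first exact: cvg_cst.
  apply: cvgD.
    apply: cvgN; apply: (@cvg_comp _ _ _ rn (@ln R) \oo (nbhs (1 : R))) => //.
    exact: continuous_ln.
  under eq_fun do rewrite expr2.
  by apply: cvgM; [apply: cvgM; [exact: cvgM|exact: cvg_cst]|exact: cvg_cst].
have ih : mu.-integrable D (EFin \o h).
  apply/integrableP; split; first by apply/measurable_EFinP; exact: measurable_funTS.
  have -> : (\int[mu]_(x in D) `|(EFin \o h) x| = \int[mu]_(x in D) (h x)%:E)%E.
    apply: eq_integral => x; rewrite inE => Dx; rewrite /= ger0_norm //.
    rewrite -lee_fin -(cvg_lim _ (glim x Dx)) //; apply: lime_ge.
      by apply/cvg_ex; eexists; exact: glim.
    by near=> n; rewrite lee_fin g0.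
  by rewrite Ih ltry.
rewrite integral_rho_sc -(@integral_setD1 _ _ E) //; last first.
  apply: measurable_funTS; apply/measurable_EFinP.
  exact: measurable_funM.
have i5D : mu.-integrable D (EFin \o (fun x => ln 5 * sc_wt x)).
  by apply: integrableS i5 => //; exact: subDsetl.
have I5D : (\int[mu]_(x in D) (ln 5 * sc_wt x)%:E = (ln 5)%:E)%E.
  rewrite integral_setD1 ?I5 //; apply: measurable_funTS; apply/measurable_EFinP.
  exact: measurable_funM.
have -> : (E ^+ 2 / 4 - 1 / 2)%:E = ((ln 5)%:E - (ln 5 - cos (2 * v) / 2)%:E)%E.
  by rewrite -EFinB c2v; congr EFin; field.
rewrite -Ih -I5D -integralB_EFin //; apply: eq_integral => x _.
by rewrite -EFinB /h; congr EFin; ring.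
Unshelve. all: by end_near. Qed.

End SemicirclePotential.

(** * Exponential rates *)

Section FixedSize.
Variables (R : realType) (N : nat) (p E : R).
Hypothesis p01 : 0 < p < 1.
Hypothesis N0 : (0 < N)%N.
Let sN := Num.sqrt (N%:R : R).
Let z := E * sN.
Let m := p / Num.sqrt (p * (1 - p)).
Let X := Ex (bern_pr p) (@symx R bool (bern_std p) N) (fun W => `|sdet z m W|).
Definition mean_abs_det := sN ^- N * X.

Let NR0 : 0 < N%:R :> R. Proof. by rewrite ltr0n. Qed.
Let sN0 : 0 < sN. Proof. by rewrite sqrtr_gt0. Qed.
Let sN2 : sN ^+ 2 = N%:R. Proof. by rewrite sqr_sqrtr // ltW. Qed.
Let pr_sum := bern_pr_sum p.
Let pr_ge0 := bern_pr_ge0 p01.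
Let m1 := bern_m1 p01.
Let m2 := bern_m2 p01.

Lemma ln_mean_abs_det : 0 < X ->
  2 * ln mean_abs_det = - (N%:R * ln N%:R) + 2 * ln X.
Proof.
move=> X0; rewrite /mean_abs_det lnM ?posrE ?invr_gt0 ?exprn_gt0 //.
rewrite lnV ?posrE ?exprn_gt0 // lnXn // -[ln sN *+ N]mulr_natl.
have -> : ln (N%:R : R) = 2 * ln sN by rewrite -sN2 lnXn // mulr_natl.
ring.
Qed.

(** As [x < 1], the partial sum of [phi] times [x ^+ N] is below the generating sum at [x]; each [x]
    yields a bound, to be optimised later. The [- 1] in the rate is what remains of [N!] against
    [N^N]. *)
Lemma ln_mean_abs_det_le x : 0 < x < 1 -> 0 < mean_abs_det ->
  2 * ln mean_abs_det <= N%:R * (- 1 - ln x + E ^+ 2 * (x / (1 + x))) +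
    (ln 2 + 1 + ln N.+1%:R + ln (1 + m ^+ 2 * N%:R ^+ 2)
     + (p * (1 - p))^-1 / 2 - 3 * ln (1 - x)).
Proof.
move=> x01 Y0; have [x0 x1] := andP x01.
have X0 : 0 < X.
  by move: Y0; rewrite /mean_abs_det pmulr_rgt0 // invr_gt0 exprn_gt0.
rewrite ln_mean_abs_det //.
pose ph := phi (bern_pr p) (bern_std p) z.
pose s := \sum_(j < N.+1) ph j.
have ph0 n : 0 <= ph n by exact: phi_ge0.
have [k0 k1] := andP (bern_m4 p01).
pose kap := Ex (bern_pr p) (scal1 (bern_std p)) (fun a => a ^+ 4).
have sle : x ^+ N * s <= expR (z ^+ 2 * (x / (1 + x)) + (kap / 2 * x ^+ 2 - 3 * ln (1 - x))).
  apply: (@le_trans _ _ (\sum_(j < N.+1) ph j * x ^+ j)); last first.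
    apply: (@phi_sum_le R z kap ph) => //; first exact: phi0.
    by move=> n; exact: phi_rec.
  rewrite /s mulr_sumr; apply: ler_sum => j _; rewrite mulrC ler_wpM2l //.
  by rewrite ler_wiXn2l ?(ltW x0) ?(ltW x1) // -ltnS.
have m0 : 0 <= m ^+ 2 * N%:R ^+ 2 by rewrite -exprMn; exact: sqr_ge0.
have X2 : X ^+ 2 <= 2 * N`!%:R * (1 + m ^+ 2 * N%:R ^+ 2) * s.
  have CS := Ef_sqr pr_sum pr_ge0
    (fun w : {ffun {set 'I_N} -> bool} => `|sdet z m (symx (bern_std p) w)|).
  apply: (le_trans CS) => {CS}.
  rewrite (eq_Ef _ (G := fun w => sdet z m (symx (bern_std p) w) ^+ 2)); last first.
    by move=> w; rewrite real_normK // num_real.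
  have SQ := sdet_sqr (bern_std p) pr_ge0 z m N.
  apply: (le_trans SQ) => {SQ}.
  rewrite (cdet2E (bern_pr p) (bern_std p)) (adj2E pr_sum m1 m2) -/ph /s big_ord_recr /=.
  set s' := \sum_(i < N) ph i; have s'0 : 0 <= s' by exact: sumr_ge0.
  have f0 : 0 <= N`!%:R :> R by [].
  have h1 := mulr_ge0 f0 s'0; have h2 := mulr_ge0 m0 (mulr_ge0 f0 (ph0 N)).
  rewrite -subr_ge0.
  have -> : 2 * N`!%:R * (1 + m ^+ 2 * N%:R ^+ 2) * (s' + ph N) -
      (2 * (N`!%:R * ph N) + 2 * m ^+ 2 * N%:R ^+ 2 * (N`!%:R * s')) =
      2 * (N`!%:R * s') + 2 * (m ^+ 2 * N%:R ^+ 2 * (N`!%:R * ph N)) by ring.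
  by rewrite addr_ge0 // mulr_ge0.
have F0 : 0 < N`!%:R :> R by rewrite ltr0n fact_gt0.
have M1 : 0 < 1 + m ^+ 2 * N%:R ^+ 2 by rewrite ltr_wpDr.
have P0 : 0 < 2 * N`!%:R * (1 + m ^+ 2 * N%:R ^+ 2) by rewrite !mulr_gt0.
have s0 : 0 < s.
  by rewrite -(pmulr_rgt0 _ P0); apply: lt_le_trans X2; rewrite exprn_gt0.
have L1 : 2 * ln X <= ln 2 + ln N`!%:R + ln (1 + m ^+ 2 * N%:R ^+ 2) + ln s.
  rewrite mulr_natl -lnXn // -!lnM ?posrE ?mulr_gt0 //.
  by rewrite ler_ln ?posrE ?mulr_gt0 ?exprn_gt0.
have L2 : N%:R * ln x + ln s <=
    z ^+ 2 * (x / (1 + x)) + (kap / 2 * x ^+ 2 - 3 * ln (1 - x)).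
  rewrite mulr_natl -lnXn // -lnM ?posrE ?exprn_gt0 //.
  by rewrite -[leRHS]expRK ler_ln ?posrE ?mulr_gt0 ?exprn_gt0 ?expR_gt0.
have L3 := @ln_fact_le R N N0.
have L4 : kap / 2 * x ^+ 2 <= (p * (1 - p))^-1 / 2.
  apply: le_trans (_ : kap / 2 <= _); last by rewrite ler_pM2r.
  by rewrite ler_piMr ?divr_ge0 // exprn_ile1 // ltW.
have -> : N%:R * (-1 - ln x + E ^+ 2 * (x / (1 + x))) =
  - N%:R - N%:R * ln x + z ^+ 2 * (x / (1 + x)) by rewrite /z exprMn sN2; ring.
lra.
Qed.

Lemma hermiteN (w : R) k : hermite (- w) k = (-1) ^+ k * hermite w k.
Proof.
suff: hermite (- w) k = (-1) ^+ k * hermite w k /\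
  hermite (- w) k.+1 = (-1) ^+ k.+1 * hermite w k.+1 by case.
elim: k => [|k [IH1 IH2]]; first by rewrite !hermite0 !hermite1; split; ring.
by split=> //; rewrite !hermiteSS IH1 IH2 !exprS; ring.
Qed.

(** The growth estimates require a positive argument; the lower bound on the determinant involves
    only squares. *)
Lemma hermite_norm_sqr (w : R) k : hermite `|w| k ^+ 2 = hermite w k ^+ 2.
Proof.
have [w0|w0] := leP 0 w; first by rewrite ger0_norm.
by rewrite ltr0_norm // hermiteN exprMn sqrr_sign mul1r.
Qed.

Lemma ln_mean_abs_det_ge k : (k.+2 <= N)%N ->
  0 < hermite `|z| k -> 1 <= m ^+ 2 * N%:R - m * z + 1 ->
  0 < mean_abs_det /\
  - N%:R + ln (hermite `|z| k ^+ 2 / k`!%:R) -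
    (2 * ln N%:R + ln 3 + 3 * ln (1 + m * N.+1%:R + `|z|) -
     2 * ln (Num.min p (1 - p) / Num.sqrt (p * (1 - p)))) <= 2 * ln mean_abs_det.
Proof.
move=> kN h0 hm; have [p0 p1] := andP p01.
have q0 : 0 < 1 - p by rewrite subr_gt0.
have pq0 : 0 < p * (1 - p) by rewrite mulr_gt0.
have s0 : 0 < Num.sqrt (p * (1 - p)) by rewrite sqrtr_gt0.
set c := Num.min p (1 - p) / _.
have mn0 : 0 < Num.min p (1 - p) by rewrite lt_min p0 q0.
have c0 : 0 < c by rewrite divr_gt0.
have c1 : c <= 1.
  rewrite ler_pdivrMr // mul1r -[leLHS](ger0_norm (ltW mn0)) -sqrtr_sqr ler_wsqrtr //.
  by rewrite expr2 ler_pM ?(ltW mn0) // ge_min lexx ?orbT.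
have m0 : 0 < m by rewrite divr_gt0.
have [n Nn] : exists n, N = n.+2 by exists N.-2; lia.
have kn : (k <= n)%N by rewrite Nn in kN.
have key : n`!%:R * (hermite z k ^+ 2 / k`!%:R) <=
    3 * (1 + m * N.+1%:R + `|z|) ^+ 3 / c ^+ 2 * X ^+ 2.
  have := @hermite_le_norm_sdet R bool _ _ pr_sum pr_ge0 m1 m2 z m c
    (bern_spread p01) n k kn.
  by rewrite -Nn c0 c1 => /(_ isT (ltW m0) hm).
set K := 1 + _ + `|z| in key *.
have K0 : 0 < K by rewrite /K -addrA ltr_wpDr // addr_ge0 // mulr_ge0 // ltW.
rewrite -hermite_norm_sqr in key; clearbody c K.
have H0 : 0 < hermite `|z| k ^+ 2 / k`!%:R.
  by rewrite divr_gt0 ?exprn_gt0 ?ltr0n ?fact_gt0.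
have n0 : 0 < n`!%:R :> R by rewrite ltr0n fact_gt0.
have X0 : 0 <= X by apply: Ef_ge0.
have Xpos : 0 < X.
  rewrite lt_def X0 andbT; apply/eqP => XE; move: key.
  by rewrite XE expr0n mulr0 leNgt mulr_gt0.
split; first by rewrite mulr_gt0 // invr_gt0 exprn_gt0.
rewrite ln_mean_abs_det //.
have K3 : 0 < K ^+ 3 := exprn_gt0 3 K0.
have C0 : 0 < 3 * K ^+ 3 / c ^+ 2 by rewrite divr_gt0 ?exprn_gt0 // mulr_gt0.
have L1 : ln n`!%:R + ln (hermite `|z| k ^+ 2 / k`!%:R) <=
    ln 3 + 3 * ln K - 2 * ln c + 2 * ln X.
  have -> : ln 3 + 3 * ln K - 2 * ln c + 2 * ln X = ln (3 * K ^+ 3 / c ^+ 2 * X ^+ 2).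
    rewrite lnM ?posrE ?exprn_gt0 // ln_div ?posrE ?mulr_gt0 ?exprn_gt0 //.
    by rewrite lnM ?posrE ?exprn_gt0 // !lnXn // !mulr_natl.
  by rewrite -lnM ?posrE // ler_ln ?posrE ?(mulr_gt0 n0 H0) ?(mulr_gt0 C0 (exprn_gt0 2 Xpos)).
have L2 := @ln_fact_ge R N.
(* The Turan sum is taken at [n = N - 2], and returning from [n!] to [N!] costs
   [N (N - 1) <= N^2]. *)
have L3 : ln (N`!%:R : R) <= 2 * ln N%:R + ln n`!%:R.
  rewrite {1}Nn 2!factS !natrM lnM ?posrE ?mulr_gt0 // lnM ?posrE //.
  have : ln n.+1%:R <= ln (n.+2%:R : R) by rewrite ler_ln ?posrE // ler_nat.
  rewrite -Nn; lra.
lra.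
Qed.
End FixedSize.

(** * Consequences of the sparsity condition *)

Section ParameterBounds.
Variables (R : realType) (eps p : R) (N : nat).
Hypothesis eps0 : 0 < eps.
Hypothesis N0 : (0 < N)%N.
Hypothesis hp : N%:R `^ eps / N%:R <= p <= 1 - eps.
Let m := p / Num.sqrt (p * (1 - p)).

Let NR0 : 0 < N%:R :> R. Proof. by rewrite ltr0n. Qed.
Let pow0 : 0 < N%:R `^ eps :> R. Proof. exact: powR_gt0. Qed.

Lemma param01 : 0 < p < 1.
Proof.
have [h1 h2] := andP hp; apply/andP; split; last by have := eps0; lra.
by apply: lt_le_trans h1; rewrite divr_gt0.
Qed.

Let p0 : 0 < p. Proof. by have /andP[] := param01. Qed.
Let q0 : 0 < 1 - p. Proof. by have /andP[_] := param01; rewrite subr_gt0. Qed.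
Let qeps : eps <= 1 - p. Proof. by have /andP[_] := hp; lra. Qed.
Let pq0 : 0 < p * (1 - p). Proof. exact: mulr_gt0. Qed.

Lemma param_shift_sqr : m ^+ 2 = p / (1 - p).
Proof.
rewrite /m expr_div_n sqr_sqrtr ?(ltW pq0) //.
by field; rewrite !lt0r_neq0.
Qed.

Lemma param_shift_ge0 : 0 <= m.
Proof. by rewrite divr_ge0 ?sqrtr_ge0 // ltW. Qed.

Lemma param_shift_le : m <= 1 + eps^-1.
Proof.
have : m ^+ 2 <= eps^-1.
  rewrite param_shift_sqr ler_pdivrMr //.
  have : 1 <= eps^-1 * (1 - p) by rewrite mulrC ler_pdivlMr // mul1r.
  by have := q0; lra.
have : 0 < eps^-1 by rewrite invr_gt0.
have := param_shift_ge0; nra.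
Qed.

(** Eventually exceeds [E ^+ 2], so that [m sqrt N >= |E|] and the determinant [m^2 N - m z + 1] of
    the system for the means is at least 1. *)
Lemma param_shift_large : N%:R `^ eps <= m ^+ 2 * N%:R.
Proof.
have [+ _] := andP hp; rewrite ler_pdivrMr // => /le_trans; apply.
rewrite ler_pM2r // param_shift_sqr ler_pdivlMr // ler_piMr ?(ltW p0) //.
by have := p0; lra.
Qed.

(** Controls the fourth moment; the exponent below 1 makes its contribution negligible against
    [N]. *)
Lemma param_variance : (p * (1 - p))^-1 <= eps^-1 * N%:R `^ (1 - eps).
Proof.
rewrite powRB; last by rewrite pnatr_eq0 -lt0n N0 implybT.
rewrite powRr1 ?ler0n // invfM mulrC ler_pM ?invr_ge0 ?(ltW p0) ?(ltW q0) //.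
  by rewrite lef_pV2 ?posrE.
rewrite -[leRHS]invrK lef_pV2 ?posrE ?invr_gt0 ?divr_gt0 // invf_div.
by have [] := andP hp.
Qed.

Lemma param_spread : eps^-1 <= N%:R ->
  - ln N%:R <= 2 * ln (Num.min p (1 - p) / Num.sqrt (p * (1 - p))).
Proof.
move=> Ne; have mn0 : 0 < Num.min p (1 - p) by rewrite lt_min p0 q0.
have s0 : 0 < Num.sqrt (p * (1 - p)) by rewrite sqrtr_gt0.
rewrite mulr_natl -lnXn ?divr_gt0 // -lnV ?posrE //.
rewrite ler_ln ?posrE ?invr_gt0 ?exprn_gt0 ?divr_gt0 //.
rewrite expr_div_n sqr_sqrtr ?(ltW pq0) // ler_pdivlMr //.
have N1 : 1 <= N%:R :> R by rewrite ler1n.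
have h1 : N%:R^-1 <= p.
  have [+ _] := andP hp; apply: le_trans.
  rewrite ler_peMl ?invr_ge0 ?ler0n //.
  by have := @ler_powR R N%:R N1 0 eps (ltW eps0); rewrite powRr0.
have h2 : N%:R^-1 <= 1 - p.
  by apply: le_trans qeps; rewrite -[leRHS]invrK lef_pV2 ?posrE ?invr_gt0.
have N10 : 0 < N%:R^-1 :> R by rewrite invr_gt0.
have hm : N%:R^-1 <= Num.min p (1 - p) by rewrite le_min h1 h2.
have hpq : p * (1 - p) <= Num.min p (1 - p).
  by rewrite le_min; have := p0; have := q0; nra.
by rewrite expr2 ler_pM ?(ltW N10) ?(ltW pq0).
Qed.

End ParameterBounds.

(** * Exponential size of the Hermite term in the two regimes *)

Section HermiteRate.
Variables (R : realType) (N : nat).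
Hypothesis N0 : (0 < N)%N.
Let sN := Num.sqrt (N%:R : R).
Let NR0 : 0 < N%:R :> R. Proof. by rewrite ltr0n. Qed.
Let sN0 : 0 < sN. Proof. by rewrite sqrtr_gt0. Qed.
Let sN2 : sN ^+ 2 = N%:R. Proof. by rewrite sqr_sqrtr // ltW. Qed.

Lemma hermite_rate_in (e : R) : 0 < e -> 4 <= e ^+ 2 * N%:R ->
  e ^+ 2 / 4 * N%:R + 2 <= N%:R ->
  exists2 k, (k.+2 <= N)%N & 0 < hermite (e * sN) k /\
    N%:R * (e ^+ 2 / 2) <= ln (hermite (e * sN) k ^+ 2 / k`!%:R) +
      (4 * ln (e * sN) + ln k.+1%:R + 1).
Proof.
move=> e0 h4 hN; set z := e * sN.
have z0 : 0 < z by rewrite mulr_gt0.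
have z2 : z ^+ 2 = e ^+ 2 * N%:R by rewrite exprMn sN2.
(* The turning point: the discriminant vanishes there, so [edge z T = z / 2] and [edge_int] is
   explicit. *)
pose T := z ^+ 2 / 4.
have T1 : 1 <= T by rewrite /T z2; lra.
have z1 : 1 <= z by rewrite -(@expr_ge1 _ 2) ?ltW // z2; lra.
pose k := Num.truncn T.
have /andP[kT Tk] : k%:R <= T < k.+1%:R by rewrite truncn_itv // (le_trans _ T1).
have k1 : (0 < k)%N by rewrite truncn_gt0.
have kN : (k.+2 <= N)%N.
  rewrite -(ler_nat R) -natr1 -natr1; apply: le_trans hN.
  by rewrite -addrA lerD // (le_trans kT) // /T z2; lra.
have kz : 4 * k%:R <= z ^+ 2 by move: kT; rewrite /T; lra.
exists k => //; have [hk _] := hermite_ratio z0 kz; split => //.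
have Tb : k%:R <= T <= k%:R + 2 by rewrite kT /=; move: Tk; rewrite -natr1; lra.
have T4 : 4 * T <= z ^+ 2 by rewrite /T; lra.
have := @hermite_sqr_fact_ge R z z0 k T z1 k1 Tb T4; apply: le_trans.
have -> : edge_int z T = T * ln (z / 2) - z ^+ 2 / 2 + z ^+ 2 / 8.
  rewrite /edge_int /edge; have -> : z ^+ 2 - 4 * T = 0 by rewrite /T; field.
  by rewrite sqrtr0 addr0; field.
have -> : ln T = 2 * ln (z / 2).
  have -> : T = (z / 2) ^+ 2 by rewrite /T; field.
  by rewrite lnXn ?divr_gt0 // mulr_natl.
move: (ln (z / 2)) => l; rewrite /T z2; lra.
Qed.

Lemma hermite_rate_out (r : R) : 0 < r < 1 -> (2 < N)%N ->
  exists2 k, (k.+2 <= N)%N & 0 < hermite ((r + r^-1) * sN) k /\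
    N%:R * (- 2 * ln r + r ^+ 2 + 1) <=
    ln (hermite ((r + r^-1) * sN) k ^+ 2 / k`!%:R) +
      (4 * ln ((r + r^-1) * sN) + ln k.+1%:R + 1).
Proof.
move=> /andP[r0 r1] N3; set z := _ * sN.
have rV : 1 < r^-1 by rewrite invf_gt1.
have rn : r != 0 by rewrite gt_eqF.
have z0 : 0 < z by rewrite mulr_gt0 // addr_gt0 // invr_gt0.
have N1 : 1 <= N%:R :> R by rewrite ler1n.
have zz : z ^+ 2 - 4 * N%:R = ((r^-1 - r) * sN) ^+ 2.
  by rewrite /z !exprMn sN2; field.
have zN : 4 * N%:R <= z ^+ 2 by rewrite -subr_ge0 zz sqr_ge0.
have z1 : 1 <= z by rewrite -(@expr_ge1 _ 2) ?ltW //; lra.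
(* The largest index allowed by [k.+2 <= N]. Here [N] lies below the turning point, and the
   parametrisation by [r] makes the discriminant at [N] a square, with larger root [sN / r]. *)
pose k := (N - 2)%N; have kN : (k + 2 = N)%N by rewrite /k; lia.
have k1 : (0 < k)%N by lia.
have kR : k%:R + 2 = N%:R :> R by rewrite -natrD kN.
have kz : 4 * k%:R <= z ^+ 2 by lra.
exists k; first by lia.
have [hk _] := hermite_ratio z0 kz; split => //.
have kN1 : k%:R <= N%:R :> R by lra.
have kN2 : N%:R <= k%:R + 2 :> R by lra.
have := @hermite_sqr_fact_ge R z z0 k N%:R z1 k1 _ zN.
rewrite kN1 kN2 => /(_ isT); apply: le_trans.
have eE : edge z N%:R = sN / r.
  rewrite /edge zz sqrtr_sqr ger0_norm; first by rewrite /z; field.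
  by rewrite mulr_ge0 ?(ltW sN0) // subr_ge0 ltW // (lt_trans r1).
rewrite /edge_int eE ln_div ?posrE //.
have -> : ln (N%:R : R) = 2 * ln sN by rewrite -sN2 lnXn // mulr_natl.
rewrite -sN2 /z; move: (ln sN) (ln r) => l l'.
rewrite le_eqVlt; apply/orP; left; apply/eqP; field.
by [].
Qed.

End HermiteRate.

Section ErrorTerms.
Variable R : realType.

Lemma near_powR_ge (eps A : R) : 0 < eps -> \forall N \near \oo, A <= N%:R `^ eps.
Proof.
move=> eps0; near=> N.
have [A0|A0] := leP A 0; first by apply: le_trans A0 _; exact: powR_ge0.
have h : A `^ eps^-1 <= N%:R by near: N; exact: nbhs_infty_ger.
have -> : A = (A `^ eps^-1) `^ eps.
  by rewrite -powRrM mulVf ?lt0r_neq0 // powRr1 // ltW.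
by apply: (ge0_ler_powR (ltW eps0)); rewrite ?nnegrE ?powR_ge0 ?ler0n.
Unshelve. all: by end_near. Qed.

(** The common scale of the losses: [ln N] for polynomial factors, [N^(1 - eps)] for the fourth
    moment. *)
Definition err (eps : R) N := 1 + ln N%:R + N%:R `^ (1 - eps).

Lemma near_err_le (eps C e : R) : 0 < eps -> 0 <= C -> 0 < e ->
  \forall N \near \oo, C * err eps N <= e * N%:R.
Proof.
move=> eps0 C0 e0; pose d := Num.min eps 2^-1.
have d0 : 0 < d by rewrite /d lt_min eps0 invr_gt0 ltr0n.
have d1 : d <= 2^-1 by rewrite /d ge_min lexx orbT.
near=> N.
have N0 : (0 < N)%N by near: N; exact: nbhs_infty_gt.
have NR0 : 0 < N%:R :> R by rewrite ltr0n.
have N1 : 1 <= N%:R :> R by rewrite ler1n.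
have h : 4 * C / e <= N%:R `^ d by near: N; exact: near_powR_ge.
have w0 : 0 < N%:R `^ d :> R by exact: powR_gt0.
have e1 : err eps N <= 4 * N%:R `^ (1 - d).
  have a1 : 1 <= N%:R `^ (1 - d) :> R.
    by rewrite -[leLHS](powRr0 N%:R) ler_powR // subr_ge0 (le_trans d1) // invf_le1 // ler1n.
  have a2 : N%:R `^ (1 - eps) <= N%:R `^ (1 - d) :> R.
    by rewrite ler_powR // lerD2l lerN2 ge_min lexx.
  have a3 : ln (N%:R : R) <= 2 * N%:R `^ (1 - d).
    have b1 : 2^-1 * ln (N%:R : R) <= N%:R `^ 2^-1.
      rewrite -ln_powR; apply: le_trans (ln_le_sub1 _) _; first exact: powR_gt0.
      by rewrite gerBl.
    have b2 : N%:R `^ 2^-1 <= N%:R `^ (1 - d) :> R by rewrite ler_powR //; lra.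
    lra.
  rewrite /err; lra.
apply: le_trans (ler_wpM2l C0 e1) _.
have -> : N%:R `^ (1 - d) = N%:R / N%:R `^ d :> R.
  by rewrite powRB ?powRr1 ?ler0n // pnatr_eq0 -lt0n N0 implybT.
rewrite mulrCA mulrA mulrA ler_pdivrMr //.
move: h; rewrite ler_pdivrMr // => h.
have := ler_wpM2l (ltW NR0) h; lra.
Unshelve. all: by end_near. Qed.

End ErrorTerms.

Section Rates.
Variables (R : realType) (eps E : R) (p : R) (N : nat).
Hypothesis eps0 : 0 < eps.
Hypothesis N0 : (0 < N)%N.
Hypothesis hp : N%:R `^ eps / N%:R <= p <= 1 - eps.
Let p01 := param01 eps0 N0 hp.
Let m := p / Num.sqrt (p * (1 - p)).
Let sN := Num.sqrt (N%:R : R).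
Let y := mean_abs_det N p E.
Let NR0 : 0 < N%:R :> R. Proof. by rewrite ltr0n. Qed.
Let N1 : 1 <= N%:R :> R. Proof. by rewrite ler1n. Qed.
Let lN0 : 0 <= ln (N%:R : R). Proof. exact: ln_ge0. Qed.
Let e0 : 0 < eps^-1. Proof. by rewrite invr_gt0. Qed.
Let m0 : 0 <= m := param_shift_ge0 eps0 N0 hp.
Let m_le : m <= 1 + eps^-1 := param_shift_le eps0 N0 hp.
Let lnSN : ln (N.+1%:R : R) <= ln 2 + ln N%:R.
Proof.
rewrite -lnM ?posrE // ler_ln ?posrE ?mulr_gt0 // -natr1.
by have := N1; lra.
Qed.

Lemma upper_rate x : 0 < x < 1 -> 0 < y ->
  2 * ln y <= N%:R * (- 1 - ln x + E ^+ 2 * (x / (1 + x))) +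
   (2 * ln 2 + 1 + ln (1 + (1 + eps^-1) ^+ 2) + eps^-1) * err eps N + 2 * ln N%:R
   - 3 * ln (1 - x).
Proof.
move=> x01 y0; have := ln_mean_abs_det_le p01 N0 x01 y0; move/le_trans; apply.
rewrite -/m -!addrA lerD2l.
have h1 : ln (1 + m ^+ 2 * N%:R ^+ 2) <= ln (1 + (1 + eps^-1) ^+ 2) + 2 * ln N%:R.
  have M0 : 0 < 1 + (1 + eps^-1) ^+ 2 by rewrite ltr_wpDr ?sqr_ge0.
  have mN0 : 0 <= m ^+ 2 * N%:R ^+ 2 by rewrite -exprMn sqr_ge0.
  rewrite mulr_natl -lnXn // -lnM ?posrE ?exprn_gt0 // ler_ln ?posrE ?ltr_wpDr //; last first.
    by apply: mulr_gt0 => //; exact: exprn_gt0.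
  rewrite mulrDl lerD //; first by rewrite mul1r exprn_ege1.
  by rewrite ler_wpM2r ?sqr_ge0 // lerXn2r // nnegrE (le_trans m0).
have h2 := param_variance eps0 N0 hp.
have v0 : 0 <= N%:R `^ (1 - eps) :> R := powR_ge0 _ _.
have M1 : 0 <= ln (1 + (1 + eps^-1) ^+ 2) by apply: ln_ge0; rewrite lerDl sqr_ge0.
have L2 : 0 <= ln (2 : R) by apply: ln_ge0; rewrite ler1n.
have h3 := lnSN.
have l0 := lN0; have e00 := ltW e0.
rewrite /err.
set M := ln (1 + (1 + eps^-1) ^+ 2) in h1 M1 *; set V := N%:R `^ (1 - eps) in h2 v0 *.
clearbody M V.
have l20 : 0 <= 2 * ln 2 + M by rewrite addr_ge0 // mulr_ge0.
have : 0 <= (2 * ln 2 + M) * (ln N%:R + V) := mulr_ge0 l20 (addr_ge0 l0 v0).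
have : 0 <= eps^-1 * (1 + ln N%:R) by rewrite mulr_ge0 // addr_ge0.
have : 0 <= eps^-1 * V by rewrite mulr_ge0.
lra.
Qed.

Lemma lower_rate k G : eps^-1 <= N%:R -> E ^+ 2 <= N%:R `^ eps ->
  (k.+2 <= N)%N -> 0 < hermite (`|E| * sN) k ->
  G <= ln (hermite (`|E| * sN) k ^+ 2 / k`!%:R) +
      (4 * ln (`|E| * sN) + ln k.+1%:R + 1) ->
  0 < y /\ - N%:R + G - (ln 3 + 1 + 7 * ln (3 + 2 * eps^-1 + `|E|) + 11 * ln N%:R)
    <= 2 * ln y.
Proof.
move=> Neps NE kN hk hG.
have sN0 : 0 <= sN := sqrtr_ge0 _.
have sN2 : sN ^+ 2 = N%:R by rewrite sqr_sqrtr // ltW.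
have sNN : sN <= N%:R.
  by rewrite -[leRHS](ger0_norm (ltW NR0)) -sqrtr_sqr ler_wsqrtr // expr2 ler_peMl.
have zE : `|E * sN| = `|E| * sN by rewrite normrM (ger0_norm sN0).
have ms0 : 0 <= m * sN := mulr_ge0 m0 sN0.
have hEm : `|E| <= m * sN.
  rewrite -(ler_pXn2r (n := 2)) ?nnegrE //.
  rewrite real_normK ?num_real // exprMn sN2.
  by apply: le_trans NE _; exact: param_shift_large.
have cond : 1 <= m ^+ 2 * N%:R - m * (E * sN) + 1.
  have -> : m ^+ 2 * N%:R - m * (E * sN) + 1 = (m * sN - E) * (m * sN) + 1.
    by rewrite -sN2; ring.
  rewrite lerDr; apply: mulr_ge0; last exact: ms0.
  by rewrite subr_ge0; exact: le_trans (ler_norm E) hEm.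
rewrite -zE in hk hG.
have [y0 hy] := ln_mean_abs_det_ge p01 N0 kN hk cond.
split => //; apply: le_trans hy; rewrite -/m.
have hc := param_spread eps0 N0 hp Neps.
set c := ln (_ / _) in hc *.
set C := 3 + 2 * eps^-1 + `|E|.
have C1 : 1 <= C.
  by rewrite /C; have := normr_ge0 E; have := ltW e0; lra.
have C0 : 0 < C := lt_le_trans ltr01 C1.
have lC0 : 0 <= ln C := ln_ge0 C1.
have lCN : ln (C * N%:R) = ln C + ln N%:R by rewrite lnM ?posrE.
have CN0 : 0 < C * N%:R by rewrite mulr_gt0.
have b1 : ln (1 + m * N.+1%:R + `|E * sN|) <= ln C + ln N%:R.
  have K0 : 0 < 1 + m * N.+1%:R + `|E * sN|.
    by rewrite -addrA ltr_wpDr // addr_ge0 // mulr_ge0.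
  rewrite -lCN ler_ln ?posrE // zE -natr1 /C.
  have : `|E| * sN <= `|E| * N%:R by rewrite ler_wpM2l.
  have : m * N%:R <= (1 + eps^-1) * N%:R by rewrite ler_wpM2r.
  have := ler_wpM2l (ltW e0) N1; have := m_le; have := N1.
  have := e0; nra.
have b2 : ln (`|E| * sN) <= ln C + ln N%:R.
  (* For [E = 0] the logarithm is 0 by convention. *)
  have [z0|z0] := leP (`|E| * sN) 0; first by rewrite (ln0 z0) addr_ge0.
  rewrite -lCN ler_ln ?posrE // ler_pM // /C.
  by have := e0; lra.
have b3 : ln (k.+1%:R : R) <= ln N%:R by rewrite ler_ln ?posrE // ler_nat ltnW.
rewrite -zE in b2; rewrite -/sN.
move: (ln (hermite _ _ ^+ 2 / _)) (ln (1 + m * N.+1%:R + _)) hG b1 => u v hG b1; lra.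
Qed.

End Rates.

(** * Matching the upper and lower rates *)

Section Limit.
Variables (R : realType) (E F : R).

(** With [attained_below], isolates the deterministic part of the two bounds, so that the passage to
    the limit is done once for [|E| < 2] and [|E| > 2]. *)
Definition attained_above (A : R) N := exists2 x, 0 < x < 1 &
  N%:R * (- 1 - ln x + E ^+ 2 * (x / (1 + x))) - 3 * ln (1 - x) <=
  N%:R * (2 * F) + A * (1 + ln N%:R).

Definition attained_below N := exists2 k, (k.+2 <= N)%N &
  let z := `|E| * Num.sqrt N%:R in 0 < hermite z k /\
  N%:R * (2 * F + 1) <= ln (hermite z k ^+ 2 / k`!%:R) +
    (4 * ln z + ln k.+1%:R + 1).

Lemma ln_mean_abs_det_cvg (eps A : R) (p : nat -> R) : 0 < eps -> 0 <= A ->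
  (\forall N \near \oo, N%:R `^ eps / N%:R <= p N <= 1 - eps) ->
  (\forall N \near \oo, attained_above A N) ->
  (\forall N \near \oo, attained_below N) ->
  (\forall N \near \oo, 0 < mean_abs_det N (p N) E) /\
  N%:R^-1 * ln (mean_abs_det N (p N) E) @[N --> \oo] --> F.
Proof.
move=> eps0 A0 hp up low.
have e0 : 0 < eps^-1 by rewrite invr_gt0.
pose B := 2 * ln 2 + 1 + ln (1 + (1 + eps^-1) ^+ 2) + eps^-1 + 2 + A.
pose D := ln 3 + 1 + 7 * ln (3 + 2 * eps^-1 + `|E|) + 11.
have B0 : 0 <= B.
  have : 0 <= ln (2 : R) by apply: ln_ge0; rewrite ler1n.
  have : 0 <= ln (1 + (1 + eps^-1) ^+ 2) by apply: ln_ge0; rewrite lerDl sqr_ge0.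
  by rewrite /B; lra.
have L3 : 0 <= ln (3 : R) by apply: ln_ge0; rewrite ler1n.
have LC : 0 <= ln (3 + 2 * eps^-1 + `|E|).
  by apply: ln_ge0; have := normr_ge0 E; lra.
have D0 : 0 <= D by rewrite /D; lra.
have pos : \forall N \near \oo, 0 < mean_abs_det N (p N) E /\
    N%:R * (2 * F) - D * err eps N <= 2 * ln (mean_abs_det N (p N) E).
  near=> N; have N0 : (0 < N)%N by near: N; exact: nbhs_infty_gt.
  have hpN : N%:R `^ eps / N%:R <= p N <= 1 - eps by near: N.
  have [k kN /= [hk hG]] : attained_below N by near: N.
  have Ne : eps^-1 <= N%:R by near: N; exact: nbhs_infty_ger.
  have NE : E ^+ 2 <= N%:R `^ eps by near: N; exact: near_powR_ge.
  have [y0 hy] := lower_rate eps0 N0 hpN Ne NE kN hk hG.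
  split=> //; apply: le_trans hy.
  have l0 : 0 <= ln (N%:R : R) by apply: ln_ge0; rewrite ler1n.
  have v0 : 0 <= N%:R `^ (1 - eps) := powR_ge0 _ _.
  move: L3 LC D0 v0; rewrite /err /D; set V := N%:R `^ _; set l := ln N%:R in l0 *.
  set L := ln (3 + _ + _); set L' := ln 3; move=> L3 LC D0 v0; nra.
split; first by apply: filterS pos => N [].
apply/cvgrPdist_le => e ee0.
have e20 : 0 < 2 * e by rewrite mulr_gt0.
near=> N; have N0 : (0 < N)%N by near: N; exact: nbhs_infty_gt.
have hpN : N%:R `^ eps / N%:R <= p N <= 1 - eps by near: N.
have [y0 hlow] : 0 < mean_abs_det N (p N) E /\
    N%:R * (2 * F) - D * err eps N <= 2 * ln (mean_abs_det N (p N) E) by near: N.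
have [x x01 hx] : attained_above A N by near: N.
have hup := upper_rate eps0 N0 hpN x01 y0.
have hB : B * err eps N <= (2 * e) * N%:R by near: N; exact: near_err_le.
have hD : D * err eps N <= (2 * e) * N%:R by near: N; exact: near_err_le.
have l0 : 0 <= ln (N%:R : R) by apply: ln_ge0; rewrite ler1n.
have v0 : 0 <= N%:R `^ (1 - eps) := powR_ge0 _ _.
have NR0 : 0 < N%:R :> R by rewrite ltr0n.
have h2 : (A + 2) * (1 + ln N%:R) <= (A + 2) * err eps N.
  by rewrite ler_wpM2l ?addr_ge0 // /err lerDl.
have -> : F - N%:R^-1 * ln (mean_abs_det N (p N) E) =
   (N%:R * F - ln (mean_abs_det N (p N) E)) / N%:R.
  by field; rewrite lt0r_neq0.
rewrite normrM normfV (ger0_norm (ltW NR0)) ler_pdivrMr // ler_norml.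
move: hlow hB hup; rewrite /B; move: (ln (mean_abs_det _ _ _)) => Y.
move: (err eps N) h2 hD => er h2 hD hlow hB hup.
apply/andP; split; lra.
Unshelve. all: by end_near. Qed.

Lemma near_attained_in : `|E| < 2 -> F = E ^+ 2 / 4 - 1 / 2 ->
  (\forall N \near \oo, attained_above 5 N) /\ \forall N \near \oo, attained_below N.
Proof.
move=> E2 FE; split.
  near=> N; have N2 : (2 <= N)%N by near: N; exact: nbhs_infty_ge.
  have NR : 2 <= N%:R :> R by rewrite ler_nat.
  have l0 : 0 <= ln (N%:R : R) by apply: ln_ge0; lra.
  have V0 : 0 < N%:R^-1 :> R by rewrite invr_gt0; lra.
  have V1 : N%:R^-1 <= 2^-1 :> R by rewrite lef_pV2 ?posrE //; lra.
  have x0 : 0 < 1 - N%:R^-1 :> R by lra.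
  (* The exponent tends to [E^2 / 2 - 1 = 2 F] as [x] tends to 1. Stopping at [1 - 1/N] costs at
     most 2 from [- N ln x] and [3 ln N] from [- 3 ln (1 - x)], whence the constant 5. *)
  exists (1 - N%:R^-1); first by apply/andP; split => //; lra.
  have -> : 1 - (1 - N%:R^-1) = N%:R^-1 :> R by ring.
  rewrite lnV ?posrE; last by lra.
  have h1 := ln_ge_sub1V x0.
  have h2 : N%:R * (1 - (1 - N%:R^-1)^-1) = - (1 - N%:R^-1)^-1 :> R.
    have n0 : N%:R != 0 :> R by rewrite lt0r_neq0; lra.
    have n1 : N%:R - 1 != 0 :> R by rewrite lt0r_neq0; lra.
    by field; rewrite n0 n1.
  have h3 : (1 - N%:R^-1)^-1 <= 2 :> R.
    by rewrite -[leRHS]invrK lef_pV2 ?posrE ?invr_gt0 //; lra.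
  have h4 : N%:R * (1 - (1 - N%:R^-1)^-1) <= N%:R * ln (1 - N%:R^-1) :> R.
    by rewrite ler_wpM2l //; lra.
  have h5 : (1 - N%:R^-1) / (1 + (1 - N%:R^-1)) <= 2^-1 :> R.
    by rewrite ler_pdivrMr; lra.
  have h6 : N%:R * (E ^+ 2 * ((1 - N%:R^-1) / (1 + (1 - N%:R^-1)))) <= N%:R * (E ^+ 2 * 2^-1).
    by rewrite ler_wpM2l ?ler_wpM2l ?sqr_ge0 //; lra.
  rewrite FE; lra.
(* Here [z = 0], outside the growth estimates; [k = 0] suffices because [2 F + 1 = 0] and
   [ln 0 = 0]. *)
have [E0|E0] := eqVneq E 0.
  near=> N; exists 0%N; first by near: N; exact: nbhs_infty_ge.
  rewrite FE E0 normr0 mul0r /= hermite0 expr1n fact0 divr1 ln1 ln0 // expr0n.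
  by split=> //; rewrite /=; lra.
have Ep : 0 < `|E| by rewrite normr_gt0.
have e2 : `|E| ^+ 2 = E ^+ 2 by rewrite real_normK // num_real.
have E4 : E ^+ 2 < 4.
  by rewrite -e2 (_ : 4 = 2 ^+ 2) ?ltrXn2r ?nnegrE //; ring.
have E20 : 0 < E ^+ 2 by rewrite -e2 exprn_gt0.
near=> N; have N0 : (0 < N)%N by near: N; exact: nbhs_infty_gt.
have n1 : 4 / E ^+ 2 <= N%:R by near: N; exact: nbhs_infty_ger.
have n2 : 2 / (1 - E ^+ 2 / 4) <= N%:R by near: N; exact: nbhs_infty_ger.
have := @hermite_rate_in R N N0 `|E| Ep; rewrite e2; case.
- by rewrite mulrC -ler_pdivrMr.
- by move: n2; rewrite ler_pdivrMr; lra.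
move=> k kN [hk hG]; exists k => //=; split=> //.
by apply: le_trans hG; rewrite FE le_eqVlt; apply/orP; left; apply/eqP; field.
Unshelve. all: by end_near. Qed.

Lemma near_attained_out r : 0 < r < 1 -> `|E| = r + r^-1 ->
  F = - ln r + r ^+ 2 / 2 ->
  (\forall N \near \oo, attained_above `|3 * ln (1 - r ^+ 2)| N) /\
  \forall N \near \oo, attained_below N.
Proof.
move=> r01 Er FE; have [r0 r1] := andP r01; split.
  near=> N; have N0 : (0 < N)%N by near: N; exact: nbhs_infty_gt.
  (* The critical point, where [E^2 x / (1 + x) = 1 + x] and the exponent equals [2 F]. It stays
     away from 1, so [- 3 ln (1 - x)] is a constant. *)
  exists (r ^+ 2); first by rewrite exprn_gt0 // exprn_ilt1 // ltW.
  have e2 : E ^+ 2 = (r + r^-1) ^+ 2 by rewrite -Er real_normK // num_real.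
  have rr : 1 + r ^+ 2 != 0 by rewrite lt0r_neq0 // ltr_wpDr ?sqr_ge0.
  have -> : E ^+ 2 * (r ^+ 2 / (1 + r ^+ 2)) = 1 + r ^+ 2.
    by rewrite e2; field; rewrite rr lt0r_neq0.
  have l0 : 0 <= ln (N%:R : R) by apply: ln_ge0; rewrite ler1n.
  rewrite lnXn // FE; set b := 3 * _.
  have h : - b <= `|b| by rewrite -normrN ler_norm.
  have h2 : `|b| * 1 <= `|b| * (1 + ln N%:R) by rewrite ler_wpM2l // lerDl.
  rewrite -[ln r *+ 2]mulr_natl.
  set u := N%:R; set X := `|b| * (1 + _) in h2 *; lra.
near=> N; have N2 : (2 < N)%N by near: N; exact: nbhs_infty_gt.
have N0 : (0 < N)%N by exact: leq_trans N2.
have [k kN [hk hG]] := hermite_rate_out N0 r01 N2.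
exists k => //=; rewrite Er; split=> //.
by apply: le_trans hG; rewrite FE le_eqVlt; apply/orP; left; apply/eqP; field.
Unshelve. all: by end_near. Qed.

End Limit.

Theorem corollary1p5 (R : realType) (eps : R) (heps : 0 < eps) (p : nat -> R)
  (hp : \forall N \near \oo, N%:R `^ eps / N%:R <= p N <= 1 - eps)
  (d : nat -> measure_display) (T : forall N : nat, measurableType (d N))
  (P : forall N : nat, probability (T N) R)
  (H : forall N : nat, T N -> 'M[R]_N)
  (hH : \forall N \near \oo, rescaled_erdos_renyi (P N) (p N) (@H N))
  (E : R) (hE : `|E| != 2) :
  ((N%:R^-1)%:E *
     lne ('E_(P N)[fun w => `|\det (H N w - E%:M)|%R]))%E @[N --> \oo]
  --> (\int[lebesgue_measure]_x (ln `|x - E| * rho_sc x)%:E)%E.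
Proof.
have [F [A [A0 up low ->]]] : exists F A, [/\ 0 <= A,
    \forall N \near \oo, attained_above E F A N,
    \forall N \near \oo, attained_below E F N &
    (\int[lebesgue_measure]_x (ln `|x - E| * rho_sc x)%:E = F%:E)%E].
  have [E2|E2|E2] := ltgtP `|E| 2; last by rewrite E2 eqxx in hE.
    have [up low] := near_attained_in E2 erefl.
    by exists (E ^+ 2 / 4 - 1 / 2), 5; split => //; exact: semicircle_potential_in.
  pose s := Num.sqrt (`|E| ^+ 2 - 4).
  have E4 : 0 < `|E| ^+ 2 - 4.
    have -> : `|E| ^+ 2 - 4 = (`|E| - 2) * (`|E| + 2) by ring.
    by apply: mulr_gt0; lra.
  have s2 : s ^+ 2 = `|E| ^+ 2 - 4 by rewrite sqr_sqrtr // ltW.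
  have s0 : 0 < s by rewrite sqrtr_gt0.
  (* The smaller root of [r^2 - |E| r + 1]; the two roots have product 1, so this one lies in
     [(0, 1)]. *)
  pose r := (`|E| - s) / 2.
  have rE : r * (`|E| - r) = 1 by rewrite /r; field: s2.
  have r0 : 0 < r by rewrite /r; nra.
  have r1 : r < 1 by move: rE; rewrite /r; nra.
  have r01 : 0 < r < 1 by rewrite r0.
  have Er : `|E| = r + r^-1 by rewrite -[r^-1]mulr1 -rE; field; rewrite lt0r_neq0.
  have [up low] := near_attained_out r01 Er erefl.
  exists (- ln r + r ^+ 2 / 2), `|3 * ln (1 - r ^+ 2)|; split => //.
  exact: semicircle_potential_out.
have [pos cv] := ln_mean_abs_det_cvg heps A0 hp up low.
have : (N%:R^-1 * ln (mean_abs_det N (p N) E))%:E @[N --> \oo] --> F%:E.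
  by apply: cvg_EFin cv; exact: nearW.
apply: cvg_trans.
apply: near_eq_cvg; near=> N.
have N0 : (0 < N)%N by near: N; exact: nbhs_infty_gt.
have hpN : N%:R `^ eps / N%:R <= p N <= 1 - eps by near: N.
have hHN : rescaled_erdos_renyi (P N) (p N) (@H N) by near: N.
(* Positivity is needed to turn [lne] of the expectation into a real logarithm. *)
have y0 : 0 < mean_abs_det N (p N) E by near: N.
have p01 := param01 heps N0 hpN.
rewrite (expectation_erdos_renyi E p01 N0 hHN) -/(mean_abs_det _ _ _).
by rewrite lne_EFin.
Unshelve. all: by end_near. Qed.
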